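(* Let $X$ be a normal algebraic variety over $k$ and let $D$ be an effective Cartier divisor in $X$. Let $X_\eta$ be the generic fiber of the formal completion of $X$ along $D$, and let $r_X: X_\eta\to D$ be the reduction map. Then for any point $x\in X_\eta$ there exists a sequence of divisorial points $x_n\in X_\eta$ that converges to $x$ and such that $r_X(x_n)\in\overline{r_X(x)}$ for all $n$.
   Context: Conventions: $k$ is an algebraically closed field, endowed with the trivial norm; a normal algebraic variety over $k$ is an irreducible, reduced, normal (separated) scheme of finite type over $k$. Generic fiber $X_\eta$ (it depends on $D$). If $X=\mathrm{Spec}\,R$ is affine and $D=\{f=0\}$ with $f\in R$, then $X_\eta$ is the set of functions $\nu: R\to \mathbb{R}_+\cup\{+\infty\}$ with $\nu(ab)=\nu(a)+\nu(b)$, $\nu(a+b)\ge\min\{\nu(a),\nu(b)\}$, $\nu(0)=+\infty$, $\nu=0$ on $k^*$ (the value $+\infty$ is allowed on non-zero elements), and $0<\nu(f)<+\infty$; equivalently, writing $|\cdot|=e^{-\nu}$, it is the set of multiplicative semi-norms $|\cdot|\le 1$ on $R$, trivial on $k$, with $0<|f|<1$. It carries the topology of pointwise convergence, i.e. the coarsest topology such that $|\cdot|\mapsto |g|$ is continuous for every $g\in R$. In general, cover $X$ by finitely many affine open sets $U_i$ on which $D$ is principal; $X_\eta$ is obtained by patching together the $U_{i,\eta}$, where a point of $U_{i,\eta}$ and a point of $U_{j,\eta}$ are identified when both are restrictions of the same point of $(U_i\cap U_j)_\eta$, with the quotient topology. The result is independent of choices. Reduction map: $r_X: X_\eta\to D$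 is defined in the affine case by sending a semi-norm $|\cdot|$ to the prime ideal $\{g\in R:\ |g|<1\}$, viewed as a (not necessarily closed) scheme-theoretic point of $D$; in general it is defined by patching. $\overline{r_X(x)}$ is the Zariski closure of the point $r_X(x)$. Divisorial points: a divisorial valuation on the ring of regular functions of an affine variety $U$ of dimension $\dim X$ is a discrete valuation of rank $1$, trivial on $k$, whose residue field has transcendence degree $\dim(X)-1$ over $k$ (geometrically, it is, up to a positive scalar, the order of vanishing along a prime divisor in a suitable birational model). A point of $X_\eta$ is divisorial if it is given by a divisorial valuation on the ring of regular functions of some affine chart of $X$. *)

(* Defs.v *)
From HB Require Import structures.
From mathcomp Require Import all_boot all_order all_algebra generic_quotient.
From mathcomp Require Import all_classical all_reals all_analysis.
From mathcomp Require mpoly.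
From Stdlib Require Relations.

Set Implicit Arguments.
Unset Strict Implicit.
Unset Printing Implicit Defensive.
Import Order.TTheory GRing.Theory Num.Theory.
Import numFieldNormedType.Exports.
Local Open Scope classical_set_scope.
Local Open Scope ring_scope.
Local Open Scope quotient_scope.

Record opens (X : topologicalType) := Opens {
  oset :> set X;
  open_oset : open oset }.

Definition opensT (X : topologicalType) : opens X := Opens openT.
Definition opensI (X : topologicalType) (U V : opens X) : opens X :=
  Opens (openI (open_oset U) (open_oset V)).
Definition opens_preimage (X Y : topologicalType) (f : X -> Y)
    (cf : continuous f) (U : opens Y) : opens X :=
  Opens (proj1 (continuousP f) cf _ (open_oset U)).

Definition prime_ideal (A : comPzRingType) (p : set A) : Prop :=
  [/\ p 0, forall a b, p a -> p b -> p (a + b),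
      forall a b, p b -> p (a * b), ~ p 1 &
      forall a b, p (a * b) -> p a \/ p b].

Record ringedSpace := RingedSpace {
  rs_space :> topologicalType;
  sect : opens rs_space -> comPzRingType;
  res : forall U V : opens rs_space, V `<=` U -> {rmorphism sect U -> sect V};
  res_id : forall (U : opens rs_space) (h : U `<=` U) (s : sect U),
    res h s = s;
  res_comp : forall (U V W : opens rs_space)
    (hUV : V `<=` U) (hVW : W `<=` V) (hUW : W `<=` U) (s : sect U),
    res hVW (res hUV s) = res hUW s;
  sect_separated : forall (U : opens rs_space) (I : Type)
    (V : I -> opens rs_space) (hV : forall i, V i `<=` U) (s t : sect U),
    (forall x, oset U x -> exists i, oset (V i) x) ->
    (forall i, res (hV i) s = res (hV i) t) -> s = t;
  sect_glue : forall (U : opens rs_space) (I : Type)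
    (V : I -> opens rs_space) (hV : forall i, V i `<=` U)
    (s : forall i, sect (V i)),
    (forall x, oset U x -> exists i, oset (V i) x) ->
    (forall i j (W : opens rs_space) (hi : W `<=` V i) (hj : W `<=` V j),
      res hi (s i) = res hj (s j)) ->
    exists t : sect U, forall i, res (hV i) t = s i }.

Section RingedSpaceTheory.
Context {X : ringedSpace}.
Implicit Types U V W : opens X.

(* The germ of [f] at [x] is a unit of the stalk at [x]. *)
Definition unit_at U (f : sect U) (x : X) : Prop :=
  exists (V : opens X) (h : V `<=` U), oset V x /\ exists g, res h f * g = 1.

Definition vanishing_ideal U (x : X) : set (sect U) :=
  [set f | ~ unit_at f x].
Arguments vanishing_ideal U x : clear implicits.

(* The canonical map U -> Spec O(U), sending x to the ideal of the functions
   whose germ at x is not a unit, is well defined and is an isomorphism of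
   ringed spaces: it is a bijection, the sets D(f) = {f is a unit} form a basis
   of the topology of U, and O(U) -> O(D(f)) is the localization at f. *)
Definition affine U : Prop :=
  [/\ forall x, oset U x -> prime_ideal (vanishing_ideal U x),
      forall p : set (sect U), prime_ideal p ->
        exists! x, oset U x /\ p = vanishing_ideal U x,
      forall V (x : X), V `<=` U -> oset V x ->
        exists f : sect U, unit_at f x /\ U `&` unit_at f `<=` V &
      forall (f : sect U) W (h : W `<=` U), oset W = U `&` unit_at f ->
        (forall s : sect W, exists n (a : sect U), s * res h f ^+ n = res h a)
        /\ (forall a : sect U, res h a = 0 -> exists n, f ^+ n * a = 0)].

End RingedSpaceTheory.
Arguments vanishing_ideal {X} U x.

Record scheme := Scheme {
  sch_space :> ringedSpace;
  sch_affine : forall x : sch_space,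
    exists U : opens sch_space, oset U x /\ affine U }.

Record kscheme (k : fieldType) := KScheme {
  ksch :> scheme;
  structural : {rmorphism k -> sect (opensT ksch)} }.

Definition cst (k : fieldType) (X : kscheme k) (U : opens X) (c : k) : sect U :=
  res (@subsetT _ U : U `<=` opensT X) (structural X c).

Record kmorphism (k : fieldType) (X Y : kscheme k) := KMorphism {
  kmap :> X -> Y;
  kmap_continuous : continuous kmap;
  pull : forall U : opens Y,
    {rmorphism sect U -> sect (opens_preimage kmap_continuous U)};
  pull_res : forall (U V : opens Y) (h : V `<=` U)
    (h' : opens_preimage kmap_continuous V `<=`
          opens_preimage kmap_continuous U) (s : sect U),
    pull V (res h s) = res h' (pull U s);
  pull_cst : forall (U : opens Y) c, pull U (cst U c) = cst _ c;
  pull_local : forall (U : opens Y) (s : sect U) (x : X), oset U (kmap x) ->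
    unit_at (pull U s) x -> unit_at s (kmap x) }.

Arguments kmap_continuous {k X Y} _.

(* [kcomp_eq g f h] means g o f = h. The two pullbacks of a section of Z live
   over preimages that are equal only propositionally, hence the comparison on
   smaller open sets. *)
Definition kcomp_eq (k : fieldType) (X Y Z : kscheme k) (g : kmorphism Y Z)
    (f : kmorphism X Y) (h : kmorphism X Z) : Prop :=
  (forall x, g (f x) = h x) /\
  forall (U : opens Z) (W : opens X)
    (hgf : W `<=` opens_preimage (kmap_continuous f)
                     (opens_preimage (kmap_continuous g) U))
    (hh : W `<=` opens_preimage (kmap_continuous h) U) (s : sect U),
    res hgf (pull f _ (pull g U s)) = res hh (pull h U s).

Definition kcomp_eq_id (k : fieldType) (X Y : kscheme k) (g : kmorphism Y X)
    (f : kmorphism X Y) : Prop :=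
  (forall x, g (f x) = x) /\
  forall (U : opens X) (W : opens X)
    (hgf : W `<=` opens_preimage (kmap_continuous f)
                     (opens_preimage (kmap_continuous g) U))
    (hU : W `<=` U) (s : sect U),
    res hgf (pull f _ (pull g U s)) = res hU s.

Definition kmorphism_eq (k : fieldType) (X Y : kscheme k)
    (f g : kmorphism X Y) : Prop :=
  (forall x, f x = g x) /\
  forall (U : opens Y) (W : opens X)
    (hf : W `<=` opens_preimage (kmap_continuous f) U)
    (hg : W `<=` opens_preimage (kmap_continuous g) U) (s : sect U),
    res hf (pull f U s) = res hg (pull g U s).

Definition is_product (k : fieldType) (X Y P : kscheme k)
    (p : kmorphism P X) (q : kmorphism P Y) : Prop :=
  forall (T : kscheme k) (f : kmorphism T X) (g : kmorphism T Y),
    exists h : kmorphism T P, [/\ kcomp_eq p h f, kcomp_eq q h g &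
      forall h' : kmorphism T P,
        kcomp_eq p h' f -> kcomp_eq q h' g -> kmorphism_eq h' h].

(* The diagonal of X in the (always existing, unique up to a unique
   isomorphism) product of X with itself over k is closed. *)
Definition separated (k : fieldType) (X : kscheme k) : Prop :=
  exists (P : kscheme k) (p q : kmorphism P X) (delta : kmorphism X P),
    [/\ is_product p q, kcomp_eq_id p delta, kcomp_eq_id q delta &
        closed (range delta)].

Definition irreducible_set (X : topologicalType) (A : set X) : Prop :=
  A !=set0 /\ forall U V : set X, open U -> open V ->
    A `&` U !=set0 -> A `&` V !=set0 -> A `&` (U `&` V) !=set0.

Definition reduced (X : scheme) : Prop :=
  forall (U : opens X) (s : sect U) n, s ^+ n = 0 -> s = 0.

Definition finitely_generated (k : fieldType) (X : kscheme k) (U : opens X) :=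
  exists g : seq (sect U), forall S : set (sect U),
    (forall c, S (cst U c)) -> (forall i, (i < size g)%N -> S g`_i) ->
    (forall a b, S a -> S b -> S (a + b)) ->
    (forall a b, S a -> S b -> S (a * b)) -> S = setT.

Definition finite_type (k : fieldType) (X : kscheme k) : Prop :=
  exists (m : nat) (U : 'I_m -> opens X),
    (forall x, exists i, oset (U i) x) /\
    forall i, affine (U i) /\ finitely_generated (U i).

(* Every local ring is an integrally closed domain. Finitely many elements of
   the local ring at x are germs of sections over a common neighbourhood V of
   x, and an equality of germs is an equality over a smaller neighbourhood;
   in the second clause a/b is a fraction of germs that is a root of the monic
   polynomial T^n - sum_(i < n) c_i T^i. *)
Definition normal_scheme (X : scheme) : Prop :=
  forall (x : X) (V : opens X), oset V x ->
  (forall a b : sect V, a * b = 0 ->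
     exists (W : opens X) (h : W `<=` V), oset W x /\ (res h a = 0 \/ res h b = 0))
  /\
  (forall (a b : sect V) (n : nat) (c : 'I_n -> sect V),
     (forall (W : opens X) (h : W `<=` V), oset W x -> res h b <> 0) ->
     a ^+ n = \sum_(i < n) c i * a ^+ i * b ^+ (n - i) ->
     exists (W : opens X) (h : W `<=` V) (d : sect W),
       oset W x /\ res h a = d * res h b).

Definition normal_variety (k : fieldType) (X : kscheme k) : Prop :=
  [/\ irreducible_set [set: X], reduced X, normal_scheme X, separated X
    & finite_type X].

Definition has_chain (X : topologicalType) (d : nat) : Prop :=
  exists C : nat -> set X,
    (forall i, (i <= d)%N -> closed (C i) /\ irreducible_set (C i)) /\
    (forall i, (i < d)%N -> C i `<` C i.+1).

Definition krull_dim (X : topologicalType) (d : nat) : Prop :=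
  has_chain X d /\ ~ has_chain X d.+1.

(* I is generated over U by the single nonzerodivisor f. *)
Definition generates (X : ringedSpace) (I : forall U : opens X, set (sect U))
    (U : opens X) (f : sect U) : Prop :=
  forall (W : opens X) (h : W `<=` U),
    (forall a : sect W, a * res h f = 0 -> a = 0) /\
    (forall s : sect W, I W s <-> exists a, s = a * res h f).

(* A closed subscheme is given by its ideal sheaf, here required to be locally
   generated by a nonzerodivisor. *)
Record cartierDivisor (X : scheme) := CartierDivisor {
  ideal : forall U : opens X, set (sect U);
  ideal_res : forall (U V : opens X) (h : V `<=` U) (s : sect U),
    ideal s -> ideal (res h s);
  ideal_local : forall (U : opens X) (s : sect U),
    (forall x, oset U x -> exists (V : opens X) (h : V `<=` U),
       oset V x /\ ideal (res h s)) ->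
    ideal s;
  ideal_invertible : forall x : X, exists (U : opens X) (f : sect U),
    oset U x /\ generates (@ideal) f }.

Definition local_equation (X : scheme) (D : cartierDivisor X) (U : opens X)
  (f : sect U) : Prop := generates (@ideal X D) f.

Definition divisor_support (X : scheme) (D : cartierDivisor X) : set X :=
  [set x | forall (U : opens X) (s : sect U), oset U x -> ideal D s ->
     vanishing_ideal U x s].

Section ChartFiber.
Context (R : realType) (k : fieldType) (X : kscheme k) (D : cartierDivisor X).

(* Two local equations of D on U differ by a unit, on which nu vanishes, so the
   last condition does not depend on the choice of f. *)
Record chart_fiber (U : opens X) := ChartFiber {
  nu :> sect U -> \bar R;
  nu_ge0 : forall a, (0 <= nu a)%E;
  nuM : forall a b, nu (a * b) = (nu a + nu b)%E;
  nuD : forall a b, (mine (nu a) (nu b) <= nu (a + b)%R)%E;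
  nu0 : nu 0 = +oo%E;
  nu_cst : forall c : k, c != 0 -> nu (cst U c) = 0%E;
  nu_equation : exists f : sect U, local_equation D f /\ (0 < nu f < +oo)%E }.

Definition seminorm (U : opens X) (x : chart_fiber U) (g : sect U) : R :=
  fine (expeR (- x g)%E).

HB.instance Definition _ (U : opens X) := gen_eqMixin (chart_fiber U).
HB.instance Definition _ (U : opens X) := gen_choiceMixin (chart_fiber U).

Definition seminorm_ptws (U : opens X) (x : chart_fiber U) :
  {ptws sect U -> R} := seminorm x.

HB.instance Definition _ (U : opens X) :=
  Topological.copy (chart_fiber U) (initial_topology (@seminorm_ptws U)).

Lemma nu1 (U : opens X) (x : chart_fiber U) : x 1 = 0%E.
Proof.
have := nu_cst x (oner_neq0 k); rewrite /cst rmorph1.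
by rewrite rmorph1.
Qed.

Lemma seminorm_lt1 (U : opens X) (x : chart_fiber U) g :
  (seminorm x g < 1) = (0 < x g)%E.
Proof.
rewrite /seminorm; have := nu_ge0 x g.
case: (x g) => [r||] //= r0; last by rewrite ltr01 ltry.
by rewrite lte_fin -[X in _ < X]expR0 ltr_expR oppr_lt0.
Qed.

Definition reduction_ideal (U : opens X) (x : chart_fiber U) : set (sect U) :=
  [set g | seminorm x g < 1].

Lemma reduction_ideal_prime (U : opens X) (x : chart_fiber U) :
  prime_ideal (reduction_ideal x).
Proof.
rewrite /reduction_ideal; split=> /= [|a b|a b||a b]; rewrite ?seminorm_lt1.
- by rewrite nu0 ltry.
- move=> a0 b0; apply: lt_le_trans (nuD x a b).
  by rewrite lt_min a0.
- by move=> b0; rewrite nuM; apply: (lt_le_trans b0); rewrite leeDr// nu_ge0.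
- by rewrite nu1 ltxx.
- rewrite nuM => ab0; have := nu_ge0 x a; rewrite le_eqVlt => /orP[/eqP a0|].
    by right; rewrite -a0 add0e in ab0.
  by left.
Qed.

Lemma chart_reduction_subproof (U : opens X) (aU : affine U)
  (x : chart_fiber U) :
  exists y, oset U y /\ reduction_ideal x = vanishing_ideal U y.
Proof.
case: aU => _ /(_ _ (reduction_ideal_prime x)) [y [Hy _]] _ _.
by exists y.
Qed.

Definition chart_reduction (U : opens X) (aU : affine U) (x : chart_fiber U) :
  X := projT1 (cid (chart_reduction_subproof aU x)).

Lemma chart_reductionP (U : opens X) (aU : affine U) (x : chart_fiber U) :
  oset U (chart_reduction aU x) /\
  reduction_ideal x = vanishing_ideal U (chart_reduction aU x).
Proof. by rewrite /chart_reduction; case: cid. Qed.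

Lemma chart_reduction_unique (U : opens X) (aU : affine U) (x : chart_fiber U)
    y : oset U y -> reduction_ideal x = vanishing_ideal U y ->
  chart_reduction aU x = y.
Proof.
move=> Uy xy; have [_ bij _ _] := aU.
have [z [_ Hz]] := bij _ (reduction_ideal_prime x).
by rewrite -(Hz _ (chart_reductionP aU x)); exact: Hz.
Qed.

Lemma unit_at_res (U V : opens X) (h : V `<=` U) (g : sect U) (x : X) :
  oset V x -> unit_at (res h g) x <-> unit_at g x.
Proof.
move=> Vx; split=> -[W [hW [Wx [t gt1]]]].
  exists W, (subset_trans hW h); split=> //; exists t.
  by rewrite -(res_comp h hW).
have hWV : opensI V W `<=` V by move=> ? [].
have hWW : opensI V W `<=` W by move=> ? [].
exists (opensI V W), hWV; split=> //; exists (res hWW t).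
rewrite (res_comp h hWV (subset_trans hWV h)).
by rewrite -(res_comp hW hWW) -rmorphM gt1 rmorph1.
Qed.

End ChartFiber.

Section Patching.
Context (R : realType) (k : fieldType) (X : kscheme k) (D : cartierDivisor X).

Record atlas := Atlas {
  atlas_size : nat;
  chart : 'I_atlas_size -> opens X;
  chart_affine : forall i, affine (chart i);
  chart_principal : forall i, exists f : sect (chart i), local_equation D f;
  chart_cover : forall x, exists i, oset (chart i) x }.

Arguments chart : clear implicits.
Arguments chart_affine : clear implicits.

Context (A : atlas).

Definition prefiber := {i : 'I_(atlas_size A) & chart_fiber R D (chart A i)}.
HB.instance Definition _ := Topological.on prefiber.

(* Two points are identified when they are restrictions of a point of the
   generic fiber of the intersection W of their charts. On a separated scheme W
   is affine and one may take V = W; a point of the fiber of a smaller affine V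
   restricts to a point of the fiber of W, so allowing V changes nothing. *)
Definition glued (p q : prefiber) : Prop :=
  exists (V : opens X) (hp : V `<=` chart A (projT1 p))
    (hq : V `<=` chart A (projT1 q)) (w : chart_fiber R D V),
    [/\ affine V, forall a, projT2 p a = w (res hp a)
      & forall a, projT2 q a = w (res hq a)].

Definition glue_rel : rel prefiber :=
  fun p q => `[< Relation_Operators.clos_refl_sym_trans prefiber glued p q >].

Lemma glue_refl : reflexive glue_rel.
Proof. by move=> p; apply/asboolP; apply: Relation_Operators.rst_refl. Qed.

Lemma glue_sym : symmetric glue_rel.
Proof. by move=> p q; apply/asboolP/asboolP; apply: Relation_Operators.rst_sym. Qed.

Lemma glue_trans : transitive glue_rel.
Proof. by move=> q p r /asboolP pq /asboolP qr; apply/asboolP/Relation_Operators.rst_trans/qr. Qed.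

Canonical glue_equiv := EquivRel glue_rel glue_refl glue_sym glue_trans.

Definition generic_fiber := quotient_topology {eq_quot glue_equiv}.
HB.instance Definition _ := Topological.on generic_fiber.
HB.instance Definition _ := Quotient.on generic_fiber.

Definition fiber_class (p : prefiber) : generic_fiber :=
  (\pi_generic_fiber p)%qT.

Definition prereduction (p : prefiber) : X :=
  chart_reduction (chart_affine A (projT1 p)) (projT2 p).

Lemma glued_prereduction (p q : prefiber) :
  glued p q -> prereduction p = prereduction q.
Proof.
case=> V [hp [hq [w [aV pw qw]]]].
have [Vy wy] := chart_reductionP aV w.
have key (r : prefiber) (h : V `<=` chart A (projT1 r)) :
    (forall a, projT2 r a = w (res h a)) ->
    prereduction r = chart_reduction aV w.
  move=> rw; apply: chart_reduction_unique; first exact: h Vy.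
  have rwE g : reduction_ideal (projT2 r) g <-> reduction_ideal w (res h g).
    by rewrite /reduction_ideal/= !seminorm_lt1 rw.
  apply/seteqP; split=> g.
    by move=> /rwE; rewrite wy => wg /(unit_at_res h _ Vy); exact: wg.
  by move=> gy; apply/rwE; rewrite wy => /(unit_at_res h _ Vy); exact: gy.
by rewrite (key p hp)// (key q hq).
Qed.

Definition reduction (x : generic_fiber) : X := prereduction (repr x).

Lemma reductionE (p : prefiber) : reduction (fiber_class p) = prereduction p.
Proof.
have /eqmodP : (repr (fiber_class p) = p %[mod {eq_quot glue_equiv}])%qT.
  exact: reprK.
rewrite /reduction => /asboolP.
move: (repr _) => q; elim=> //; last by move=> ? ? ? _ -> _ ->.
exact: glued_prereduction.
Qed.

Lemma reduction_support (x : generic_fiber) : divisor_support D (reduction x).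
Proof.
rewrite /reduction; case: (repr x) => i nui; rewrite /prereduction /=.
have [] := chart_reductionP (chart_affine A i) nui.
move: (chart_reduction _ _) => y Uy redE V s Vy sV.
have [f [fD /andP[f0 _]]] := nu_equation nui.
have fy : ~ unit_at f y.
  have : reduction_ideal nui f by rewrite /reduction_ideal/= seminorm_lt1.
  by rewrite redE.
move=> [W [hW [Wy [t st1]]]]; apply: fy.
have hWU : opensI W (chart A i) `<=` chart A i by move=> ? [].
have hWW : opensI W (chart A i) `<=` W by move=> ? [].
have hWV := subset_trans hWW hW.
have [a sE] := proj1 ((fD _ hWU).2 (res hWV s)) (ideal_res hWV sV).
exists (opensI W (chart A i)), hWU; split=> //.
exists (a * res hWW t); rewrite mulrA [X in X * _]mulrC -sE.
by rewrite -(res_comp hW hWW) -rmorphM st1 rmorph1.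
Qed.

End Patching.
Arguments chart {k X D} _ _.
Arguments chart_affine {k X D} _ _.
Arguments fiber_class {R k X D A} _.
Arguments reduction {R k X D A} _.

(* Injectivity of the evaluation k[T_1, ..., T_n] -> L at t. *)
Definition algebraically_independent (k L : fieldType) (j : k -> L) (n : nat)
    (t : 'I_n -> L) : Prop :=
  injective (fun P : mpoly.mpoly n k => mpoly.mmap j t P).

Definition transcendence_degree (k L : fieldType) (j : k -> L) (n : nat) :=
  (exists t : 'I_n -> L, algebraically_independent j t) /\
  ~ (exists t : 'I_n.+1 -> L, algebraically_independent j t).

Definition field_of_fractions (A : comPzRingType) (K : fieldType)
    (i : {rmorphism A -> K}) : Prop :=
  injective i /\ forall z, exists a b, i b != 0 /\ z = i a / i b.

Definition discrete_valuation (R : realType) (K : fieldType) (v : K -> \bar R) :=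
  [/\ forall z, v z = +oo%E <-> z = 0,
      forall z w, v (z * w) = (v z + v w)%E,
      forall z w, (mine (v z) (v w) <= v (z + w)%R)%E &
      exists2 e : R, 0 < e &
        [set v z | z in [set z | z != 0]] =
        [set (e *~ n)%:E | n in [set: int]]].

(* [p], meaningful on the valuation ring only, is the quotient map to the
   residue field. *)
Definition residue_map (R : realType) (K : fieldType) (v : K -> \bar R)
    (F : fieldType) (p : K -> F) : Prop :=
  [/\ p 1 = 1,
      forall z w, (0 <= v z)%E -> (0 <= v w)%E -> p (z + w) = p z + p w,
      forall z w, (0 <= v z)%E -> (0 <= v w)%E -> p (z * w) = p z * p w,
      forall y, exists2 z, (0 <= v z)%E & p z = y &
      forall z, (0 <= v z)%E -> p z = 0 <-> (0 < v z)%E].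

Definition divisorial_valuation (R : realType) (k : fieldType) (X : kscheme k)
    (U : opens X) (v : sect U -> \bar R) : Prop :=
  exists (K : fieldType) (i : {rmorphism sect U -> K}) (vK : K -> \bar R)
    (F : fieldType) (p : K -> F),
    [/\ field_of_fractions i, forall a, vK (i a) = v a, discrete_valuation vK,
        residue_map vK p &
        exists d, krull_dim X d.+1 /\
          transcendence_degree (fun c => p (i (cst U c))) d].

Definition divisorial (R : realType) (k : fieldType) (X : kscheme k)
    (D : cartierDivisor X) (A : atlas D) (x : generic_fiber R A) : Prop :=
  exists p : prefiber R A,
    x = fiber_class p /\ divisorial_valuation (nu (projT2 p)).

(* Main.v *)
Require Import Defs.
From HB Require Import structures.
From mathcomp Require Import all_boot all_order all_algebra.
From mathcomp Require Import boolp classical_sets generic_quotient ring_quotient.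
From mathcomp Require Import ring lra zify.

(** The idea is to replace the point x, a function nu with values in [0, +oo] on
  the sections over an affine chart U, by valuations of divisorial type on the
  function field K of X, with the same centre and almost the same values.

  The set where nu = +oo may be a nonzero prime, so nu need not extend to K, but
  Chevalley's theorem gives a valuation ring V0 of K that dominates the ring of
  the fractions a / b with nu b <= nu a and nu b finite.  A finite-dimensional
  space of sections takes finitely many values at V0 (span_values), and the
  comparison of these values with a local equation f of D, up to 1 / n, follows from
  the membership in V0 of finitely many elements of K.  It is therefore enough to
  find, for finitely many elements Y of V0, a valuation ring V of divisorial type
  that contains Y and has the same centre as V0 on k[Y] (divisorial_center).

  For this the residual transcendence basis of V0 is made part of the base field
  k', over which the centre of V0 on k'[Y] is a maximal ideal.  After the
  quotients of finitely many elements of the centre by the least one, y, have been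
  added to Y, every valuation ring that contains Y and has y as a nonunit has the
  right centre.  By Noether normalization k'[Y] is integral over a polynomial
  ring, over which 1 / y is not integral; as polynomial rings are normal, this
  failure already occurs in codimension one (not_ic_codim1), that is, over a
  polynomial ring in one variable with coefficients in a larger field.  There
  the valuation rings are discrete (discrete_valring), with a residue field of
  the right transcendence degree (residue_transcendence).

  The remaining ingredients identify the dimension of X with the transcendence
  degree of K (krull_dim_trdeg): closed irreducible sets in an affine chart are
  primes, strict chains of primes give independent elements (prime_chain_bound),
  and composed places give chains of primes (prime_chain_exists). *)

Set Implicit Arguments.
Unset Strict Implicit.
Unset Printing Implicit Defensive.
Import Order.TTheory GRing.Theory Num.Theory.
Local Open Scope classical_set_scope.
Local Open Scope ring_scope.

(** * Subrings, valuation rings and integral closure *)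

Section Subrings.
Context (K : fieldType).
Implicit Types (R S V F J : set K) (p q : {poly K}).

(** Rings are subsets of a fixed field, so that valuation rings, generated
  fields and integral closures can be intersected and compared. *)
Definition subring S : Prop :=
  [/\ S 1, forall a b, S a -> S b -> S (a - b)
    & forall a b, S a -> S b -> S (a * b)].

Definition subfield F : Prop := subring F /\ forall a, F a -> F a^-1.

Definition valring V : Prop := subring V /\ forall z, V z \/ V z^-1.

(** The nonunits, when V is a valuation ring. *)
Definition maxid V : set K := [set z | z = 0 \/ ~ V z^-1].

Definition pover S p : Prop := forall i, S p`_i.

Lemma subring1 S : subring S -> S 1. Proof. by case. Qed.
Lemma subringB S : subring S -> forall a b, S a -> S b -> S (a - b).
Proof. by case. Qed.
Lemma subringM S : subring S -> forall a b, S a -> S b -> S (a * b).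
Proof. by case. Qed.
Lemma subring0 S : subring S -> S 0.
Proof. by case=> S1 SB _; rewrite -(subrr 1); exact: SB. Qed.
Lemma subringN S : subring S -> forall a, S a -> S (- a).
Proof. by move=> hS a Sa; rewrite -sub0r; apply: subringB => //; exact: subring0. Qed.
Lemma subringD S : subring S -> forall a b, S a -> S b -> S (a + b).
Proof. by move=> hS a b Sa Sb; rewrite -[b]opprK; apply: subringB => //; exact: subringN. Qed.
Lemma subringX S : subring S -> forall a n, S a -> S (a ^+ n).
Proof.
move=> hS a n Sa; elim: n => [|n IH]; first by rewrite expr0; exact: subring1.
by rewrite exprS; exact: subringM.
Qed.
Lemma subring_sum S : subring S -> forall (I : Type) (r : seq I) (P : pred I) (f : I -> K),
  (forall i, P i -> S (f i)) -> S (\sum_(i <- r | P i) f i).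
Proof.
by move=> hS I r P f Sf; elim/big_ind: _ => //; [exact: subring0|exact: subringD].
Qed.
Lemma subring_prod S : subring S -> forall (I : Type) (r : seq I) (P : pred I) (f : I -> K),
  (forall i, P i -> S (f i)) -> S (\prod_(i <- r | P i) f i).
Proof.
by move=> hS I r P f Sf; elim/big_ind: _ => //; [exact: subring1|exact: subringM].
Qed.
Lemma subfieldV F : subfield F -> forall a, F a -> F a^-1. Proof. by case. Qed.
Lemma subfield_div F : subfield F -> forall a b, F a -> F b -> F (a / b).
Proof. by move=> [hF FV] a b Fa Fb; apply: subringM => //; exact: FV. Qed.

Lemma mulfXV (z : K) n i : z != 0 -> (i <= n)%N -> z ^+ n * z^-1 ^+ i = z ^+ (n - i).
Proof. by move=> z0 ni; rewrite exprVn -{1}(subnK ni) exprD mulfK // expf_neq0. Qed.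

Lemma subringT : subring [set: K]. Proof. by split. Qed.
Lemma valringT : valring [set: K].
Proof. by split; [exact: subringT|left]. Qed.

Section Pover.
Context (S : set K) (hS : subring S).
Lemma pover0 : pover S 0. Proof. by move=> i; rewrite coef0; exact: subring0. Qed.
Lemma poverC c : S c -> pover S c%:P.
Proof. by move=> Sc i; rewrite coefC; case: ifP => // _; exact: subring0. Qed.
Lemma poverX : pover S 'X.
Proof. by move=> i; rewrite coefX; case: eqP => _; [exact: subring1|exact: subring0]. Qed.
Lemma poverD p q : pover S p -> pover S q -> pover S (p + q).
Proof. by move=> Sp Sq i; rewrite coefD; exact: subringD. Qed.
Lemma poverN p : pover S p -> pover S (- p).
Proof. by move=> Sp i; rewrite coefN; exact: subringN. Qed.
Lemma poverB p q : pover S p -> pover S q -> pover S (p - q).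
Proof. by move=> Sp Sq; apply: poverD => //; exact: poverN. Qed.
Lemma poverM p q : pover S p -> pover S q -> pover S (p * q).
Proof.
by move=> Sp Sq i; rewrite coefM; apply: subring_sum => // j _; exact: subringM.
Qed.
Lemma poverZ c p : S c -> pover S p -> pover S (c *: p).
Proof. by move=> Sc Sp i; rewrite coefZ; exact: subringM. Qed.
Lemma poverXn n : pover S 'X^n.
Proof. by move=> i; rewrite coefXn; case: eqP => _; [exact: subring1|exact: subring0]. Qed.
Lemma pover_horner p z : pover S p -> S z -> S p.[z].
Proof.
move=> Sp Sz; rewrite horner_coef; apply: subring_sum => // i _.
by apply: subringM => //; exact: subringX.
Qed.
End Pover.

Lemma pover_cons S p c : pover S (p * 'X + c%:P) -> S c /\ pover S p.
Proof.
move=> Sp; split=> [|i]; first by have := Sp 0%N; rewrite coefD coefMX coefC /= add0r.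
by have := Sp i.+1; rewrite coefD coefMX coefC /= addr0.
Qed.
Lemma poverS S R p : S `<=` R -> pover S p -> pover R p.
Proof. by move=> SR Sp i; exact: SR. Qed.

Definition radj S t : set K := [set w | exists2 p, pover S p & w = p.[t]].

Lemma radj_sub S t : subring S -> S `<=` radj S t.
Proof. by move=> hS a Sa; exists a%:P; [exact: poverC|rewrite hornerC]. Qed.
Lemma radj_gen S t : subring S -> radj S t t.
Proof. by move=> hS; exists 'X; [exact: poverX|rewrite hornerX]. Qed.
Lemma subring_radj S t : subring S -> subring (radj S t).
Proof.
move=> hS; split.
- by apply: radj_sub => //; exact: subring1.
- by move=> _ _ [p Sp ->] [q Sq ->]; exists (p - q); [exact: poverB|rewrite hornerD hornerN].
- by move=> _ _ [p Sp ->] [q Sq ->]; exists (p * q); [exact: poverM|rewrite hornerM].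
Qed.
Lemma radj_min S t R : subring R -> S `<=` R -> R t -> radj S t `<=` R.
Proof. by move=> hR SR Rt _ [p Sp ->]; apply: pover_horner => //; exact: poverS Sp. Qed.

Section Valring.
Context (V : set K) (hV : valring V).
Let hS : subring V := hV.1.

Lemma maxid_sub z : maxid V z -> V z.
Proof. by case=> [->|nV]; [exact: subring0|case: (hV.2 z)]. Qed.
Lemma maxid0 : maxid V 0. Proof. by left. Qed.
Lemma maxidMl a b : V a -> maxid V b -> maxid V (a * b).
Proof.
move=> Va [->|nVb]; first by rewrite mulr0; left.
have [->|b0] := eqVneq b 0; first by rewrite mulr0; left.
have [->|a0] := eqVneq a 0; first by rewrite mul0r; left.
right=> Vab; apply: nVb; have := subringM hS Va Vab.
by rewrite invfM mulrA divff // mul1r.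
Qed.
Lemma maxidMr a b : V b -> maxid V a -> maxid V (a * b).
Proof. by rewrite mulrC; exact: maxidMl. Qed.
Lemma maxidD a b : maxid V a -> maxid V b -> maxid V (a + b).
Proof.
have [->|a0] := eqVneq a 0; first by rewrite add0r.
have [->|b0] := eqVneq b 0; first by rewrite addr0.
move=> ma mb; case: (hV.2 (a / b)) => [Vab|].
  have -> : a + b = (a / b + 1) * b by rewrite mulrDl mul1r divfK.
  by apply: maxidMl => //; apply: subringD => //; exact: subring1.
rewrite invf_div => Vba.
have -> : a + b = (1 + b / a) * a by rewrite mulrDl mul1r divfK.
by apply: maxidMl => //; apply: subringD => //; exact: subring1.
Qed.
Lemma maxidN a : maxid V a -> maxid V (- a).
Proof. by rewrite -mulN1r; apply: maxidMl; apply: subringN => //; exact: subring1. Qed.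
Lemma maxidB a b : maxid V a -> maxid V b -> maxid V (a - b).
Proof. by move=> ma mb; apply: maxidD => //; exact: maxidN. Qed.
Lemma maxid_sum (I : Type) (r : seq I) (P : pred I) (f : I -> K) :
  (forall i, P i -> maxid V (f i)) -> maxid V (\sum_(i <- r | P i) f i).
Proof. by move=> mf; elim/big_ind: _ => //; [exact: maxid0|exact: maxidD]. Qed.
Lemma maxid1 : ~ maxid V 1.
Proof. by case=> [/eqP|]; [rewrite oner_eq0|rewrite invr1; apply; exact: subring1]. Qed.
Lemma maxidP a : V a -> ~ maxid V a -> V a^-1 /\ a != 0.
Proof.
move=> Va na; split; first by apply: contrapT => nV; apply: na; right.
by apply/eqP => a0; apply: na; left.
Qed.
Lemma unit_maxid a : a != 0 -> V a^-1 -> ~ maxid V a.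
Proof. by move=> a0 Va [/eqP|//]; rewrite (negPf a0). Qed.
Lemma notV_maxid a : ~ V a -> maxid V a^-1 /\ a != 0.
Proof.
move=> nV; split; first by right; rewrite invrK.
by apply/eqP => a0; apply: nV; rewrite a0; exact: subring0.
Qed.
Lemma maxidM_prime a b : V a -> V b -> maxid V (a * b) -> maxid V a \/ maxid V b.
Proof.
move=> Va Vb mab; apply: contrapT => /not_orP[/(maxidP Va)[Vai a0] /(maxidP Vb)[Vbi b0]].
apply: (unit_maxid _ _ mab); first by rewrite mulf_neq0.
by rewrite invfM; exact: subringM.
Qed.
Lemma maxidX a n : V a -> maxid V (a ^+ n) -> maxid V a.
Proof.
move=> Va; elim: n => [|n IH]; first by rewrite expr0 => /maxid1.
by rewrite exprS => /maxidM_prime[] //; exact: subringX.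
Qed.
Lemma maxid_expr a n : maxid V a -> (0 < n)%N -> maxid V (a ^+ n).
Proof.
case: n => // n ma _; rewrite exprS; apply: maxidMr => //.
by apply: subringX => //; exact: maxid_sub.
Qed.
Lemma maxid_1D a : maxid V a -> ~ maxid V (1 + a).
Proof.
by move=> ma m1; apply: maxid1; rewrite -(addrK a 1); exact: maxidB.
Qed.
Lemma maxid_nD a b : ~ maxid V a -> maxid V b -> ~ maxid V (a + b).
Proof. by move=> na mb mab; apply: na; rewrite -(addrK b a); exact: maxidB. Qed.
Lemma subfield_maxid F a : subfield F -> F `<=` V -> F a -> maxid V a -> a = 0.
Proof.
move=> hF FV Fa ma; apply: contrapT => /eqP a0.
by apply: (unit_maxid a0 _ ma); apply: FV; exact: subfieldV.
Qed.
End Valring.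

Definition rideal R J : Prop :=
  [/\ subring R, J `<=` R, J 0, forall a b, J a -> J b -> J (a + b)
    & forall a b, R a -> J b -> J (a * b)] /\ ~ J 1.

Lemma rideal_sum R J : rideal R J -> forall (I : Type) (r : seq I) (P : pred I) (f : I -> K),
  (forall i, P i -> J (f i)) -> J (\sum_(i <- r | P i) f i).
Proof. by move=> [[_ _ J0 JD _] _] I r P f Jf; elim/big_ind: _. Qed.

Lemma rideal_adj R J z : rideal R J ->
  (exists2 p, pover J p & p.[z] = 1) \/ rideal (radj R z) (radj J z).
Proof.
move=> RJ; have [[hR JR J0 JD JM] J1] := RJ.
case: (pselect (exists2 p, pover J p & p.[z] = 1)) => [|np]; first by left.
right; split; last by case=> p Jp p1; apply: np; exists p.
split.
- exact: subring_radj.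
- by move=> _ [p Jp ->]; exists p => //; exact: poverS Jp.
- by exists 0 => [i|]; rewrite ?coef0 ?horner0.
- move=> _ _ [p Jp ->] [q Jq ->]; exists (p + q); rewrite ?hornerD //.
  by move=> i; rewrite coefD; exact: JD.
- move=> _ _ [p Rp ->] [q Jq ->]; exists (p * q); rewrite ?hornerM //.
  move=> i; rewrite coefM; apply: (rideal_sum RJ) => j _; exact: JM.
Qed.

Definition rmax R J := rideal R J /\ forall R' J', rideal R' J' ->
  R `<=` R' -> J `<=` J' -> R' `<=` R.

(** A maximal pair is local: otherwise 1 / (1 - a) could be adjoined. *)
Lemma rmax_unit R J a : rmax R J -> J a -> R (1 - a)^-1.
Proof.
move=> [RJ maxR] Ja; have [[hR JR J0 JD JM] J1] := RJ.
set z := (1 - a)^-1.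
have a1 : 1 - a != 0.
  by apply/eqP => /subr0_eq a1; apply: J1; rewrite a1.
case: (rideal_adj z RJ) => [[p Jp pz1]|RJ']; last first.
  apply: (maxR _ _ RJ'); last exact: radj_gen.
    exact: radj_sub.
  move=> b Jb; exists b%:P; last by rewrite hornerC.
  by move=> i; rewrite coefC; case: ifP.
(* a power of 1 - a clears the denominators of p, and is congruent to 1 modulo J *)
exfalso; apply: J1.
have JX n : J ((1 - a) ^+ n - 1).
  elim: n => [|n IH]; first by rewrite expr0 subrr.
  have -> : (1 - a) ^+ n.+1 - 1 = ((1 - a) ^+ n - 1) + (- (1 - a) ^+ n) * a.
    by rewrite exprSr mulrBr mulr1 mulNr addrAC.
  apply: JD => //; apply: JM => //; apply: subringN => //; apply: subringX => //.
  by apply: subringB => //; [exact: subring1|exact: JR].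
have Jn : J ((1 - a) ^+ (size p)).
  rewrite -[_ ^+ _]mulr1 -[X in _ * X]pz1 horner_coef mulr_sumr.
  apply: (rideal_sum RJ) => i _; rewrite mulrCA mulrC; apply: JM => //.
  rewrite /z mulfXV // 1?ltnW //.
  apply: subringX => //.
  by apply: subringB => //; [exact: subring1|exact: JR].
have -> : 1 = (1 - a) ^+ size p + (- 1) * ((1 - a) ^+ size p - 1).
  by rewrite mulN1r opprB addrCA subrr addr0.
apply: JD => //; apply: JM => //; apply: subringN => //; exact: subring1.
Qed.

(** The constant term of q lies in J, so q(1/z) = 1 expresses the leading
  monomial of p at z through lower ones. *)
Lemma rmax_shorten R J z p q : rmax R J -> z != 0 -> pover J p -> pover J q ->
  p.[z] = 1 -> q.[z^-1] = 1 -> (size q <= size p)%N ->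
  exists p', [/\ pover J p', p'.[z] = 1 & (size p' < size p)%N].
Proof.
move=> RJm z0 Jp Jq pz qz sqp; have [RJ _] := RJm.
have [[hR JR J0 JD JM] J1] := RJ.
have JN b : J b -> J (- b).
  by move=> Jb; rewrite -mulN1r; apply: JM => //; apply: subringN => //; exact: subring1.
have p_neq0 : p != 0.
  by apply/eqP => e; move/eqP: pz; rewrite e horner0 eq_sym oner_eq0.
have [n sP] : exists n, size p = n.+1 by exists (size p).-1; rewrite prednK // size_poly_gt0.
set u := (1 - q`_0)^-1.
have Ru : R u by apply: (rmax_unit RJm); exact: Jq.
have u0 : 1 - q`_0 != 0.
  by apply/eqP => /subr0_eq a1; apply: J1; rewrite a1; exact: Jq.
have q1 : z ^+ n = \sum_(i < n) u * q`_i.+1 * z ^+ (n - i.+1).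
  have : 1 - q`_0 = \sum_(i < n) q`_i.+1 * z^-1 ^+ i.+1.
    rewrite -qz (@horner_coef_wide _ n.+1) ?(leq_trans sqp) ?sP //.
    by rewrite big_ord_recl expr0 mulr1 addrAC subrr add0r.
  move=> /(congr1 (fun w => u * z ^+ n * w)); rewrite mulrAC mulVf // mul1r => ->.
  rewrite mulr_sumr; apply: eq_bigr => i _.
  rewrite -!mulrA; congr (_ * _); rewrite mulrCA; congr (_ * _).
  by rewrite mulfXV.
pose p' := \sum_(i < n) p`_i *: 'X^i
         + \sum_(i < n) (p`_n * (u * q`_i.+1)) *: 'X^(n - i.+1).
have J'sum (f : 'I_n -> K) (g : 'I_n -> nat) : (forall i, J (f i)) ->
    pover J (\sum_(i < n) f i *: 'X^(g i)).
  move=> Jf j; rewrite coef_sum; apply: (rideal_sum RJ) => i _.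
  by rewrite coefZ coefXn; case: eqP => _; rewrite ?mulr1 ?mulr0.
exists p'; split.
- move=> j; rewrite coefD; apply: JD; apply: J'sum => i; first exact: Jp.
  by apply: (JM); [apply: JR; exact: Jp|exact: JM].
- rewrite -pz [in RHS]horner_coef sP big_ord_recr /= q1 hornerD !horner_sum; congr (_ + _).
    by apply: eq_bigr => i _; rewrite hornerZ hornerXn.
  rewrite mulr_sumr; apply: eq_bigr => i _.
  by rewrite hornerZ hornerXn !mulrA.
- rewrite sP ltnS; apply: (leq_trans (size_polyD _ _)).
  rewrite geq_max; apply/andP; split; apply: (leq_trans (size_sum _ _ _));
    apply/bigmax_leqP => i _; apply: (leq_trans (size_scale_leq _ _)); rewrite size_polyXn //.
  by rewrite ltn_subrL /= (leq_ltn_trans _ (ltn_ord i)).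
Qed.

Lemma rmax_valring R J : rmax R J -> valring R /\ J `<=` maxid R.
Proof.
move=> RJm; have [RJ maxR] := RJm; have [[hR JR J0 JD JM] J1] := RJ.
have JC b : J b -> pover J b%:P by move=> Jb i; rewrite coefC; case: ifP.
have adj z : ~ R z -> exists2 p, pover J p & p.[z] = 1.
  move=> nR; case: (rideal_adj z RJ) => // RJ'; case: nR.
  apply: (maxR _ _ RJ'); [exact: radj_sub| |exact: radj_gen].
  by move=> b Jb; exists b%:P; [exact: JC|rewrite hornerC].
have Rval : valring R.
  split=> // z; apply: contrapT => /not_orP[nz nzi].
  have z0 : z != 0 by apply/eqP => z0; apply: nz; rewrite z0; exact: subring0.
  have [p Jp pz] := adj _ nz; have [q Jq qz] := adj _ nzi.
  have [m] := ubnP (size p + size q); elim: m p q Jp pz Jq qz => // m IH p q Jp pz Jq qz.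
  rewrite ltnS => le_m; have [qp|/ltnW pq] := leqP (size q) (size p).
    have [p' [Jp' p'z lt_p]] := rmax_shorten RJm z0 Jp Jq pz qz qp.
    apply: (IH p' q) => //; apply: leq_trans le_m.
    by rewrite ltn_add2r.
  have [||p' [Jp' p'z lt_p]] := rmax_shorten RJm _ Jq Jp qz _ pq.
  - by rewrite invr_eq0.
  - by rewrite invrK.
  apply: (IH p p') => //; apply: leq_trans le_m.
  by rewrite ltn_add2l.
split=> // a Ja; have [->|a0] := eqVneq a 0; first by left.
by right=> Ra; apply: J1; rewrite -(mulVf a0); exact: JM.
Qed.

Lemma rmax_exists R J : rideal R J -> exists R' J',
  [/\ rmax R' J', R `<=` R' & J `<=` J'].
Proof.
move=> RJ.
pose P (A : set (K * bool)) := (exists a, A a) ->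
  [/\ rideal [set z | A (z, true)] [set z | A (z, false)],
      R `<=` [set z | A (z, true)] & J `<=` [set z | A (z, false)]].
have [|A [PA maxA]] := @Zorn_bigcup _ P.
  move=> F FP totF [a0 [X0 FX0 X0a0]].
  have FX X a : F X -> X a ->
      [/\ rideal [set z | X (z, true)] [set z | X (z, false)],
      R `<=` [set z | X (z, true)] & J `<=` [set z | X (z, false)]].
    by move=> FX Xa; apply: (FP _ FX); exists a.
  have two X Y a b : F X -> F Y -> X a -> Y b -> exists2 Z, F Z & Z a /\ Z b.
    move=> hX hY Xa Yb; case: (totF X Y) => // XY; first by exists Y => //; split=> //; exact: XY.
    by exists X => //; split=> //; exact: XY.
  have [R0 RX0 JX0] := FX _ _ FX0 X0a0.
  split.
  - split; [split|].
    + split.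
      * by exists X0 => //=; apply: RX0; have [[/subring1]] := RJ.
      * move=> a b [X hX Xa] [Y hY Yb]; have [Z hZ [Za Zb]] := two _ _ _ _ hX hY Xa Yb.
        exists Z => //=; have [[[hR' JR' J0' JD' JM'] _] _ _] := FX _ _ hZ Za.
        exact: (subringB hR').
      * move=> a b [X hX Xa] [Y hY Yb]; have [Z hZ [Za Zb]] := two _ _ _ _ hX hY Xa Yb.
        exists Z => //=; have [[[hR' JR' J0' JD' JM'] _] _ _] := FX _ _ hZ Za.
        exact: (subringM hR').
    + move=> a [X hX Xa]; exists X => //=.
      have [[[hR' JR' J0' JD' JM'] _] _ _] := FX _ _ hX Xa; exact: JR'.
    + by exists X0 => //=; apply: JX0; have [[_ _]] := RJ.
    + move=> a b [X hX Xa] [Y hY Yb]; have [Z hZ [Za Zb]] := two _ _ _ _ hX hY Xa Yb.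
      exists Z => //=; have [[[hR' JR' J0' JD' JM'] _] _ _] := FX _ _ hZ Za.
      exact: JD'.
    + move=> a b [X hX Xa] [Y hY Yb]; have [Z hZ [Za Zb]] := two _ _ _ _ hX hY Xa Yb.
      exists Z => //=; have [[[hR' JR' J0' JD' JM'] _] _ _] := FX _ _ hZ Za.
      exact: JM'.
    + by move=> [X hX X1]; have [[_ nX1] _ _] := FX _ _ hX X1; exact: nX1.
  - by move=> a Ra; exists X0 => //; exact: RX0.
  - by move=> a Ja; exists X0 => //; exact: JX0.
have [a0 Aa0] : exists a, A a.
  apply: contrapT => nA.
  apply: (maxA [set a | if a.2 then R a.1 else J a.1]).
    split; first by move=> a Aa; case: nA; exists a.
    move=> sub; apply: nA; exists (1, true); apply: sub => /=.
    by have [[/subring1]] := RJ.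
  by move=> _; split.
have [RJA RA JA] := PA (ex_intro _ _ Aa0).
exists [set z | A (z, true)], [set z | A (z, false)]; split=> //; split=> //.
move=> R' J' RJ' RR' JJ' z R'z /=; apply: contrapT => nA.
apply: (maxA [set a | if a.2 then R' a.1 else J' a.1]).
  split; first by move=> [a []] Aa; [exact: RR'|exact: JJ'].
  by move=> /(_ (z, true)); move/(_ R'z).
move=> _; split=> //=; first by move=> a /RA /RR'.
by move=> a /JA /JJ'.
Qed.

(** Zorn's lemma on pairs of a ring and a proper ideal of it: a maximal pair is a
  valuation ring with its maximal ideal, because one of z and 1/z can always be
  adjoined. *)
Theorem Chevalley R J : rideal R J ->
  exists V, [/\ valring V, R `<=` V & J `<=` maxid V].
Proof.
move=> /rmax_exists[V [J' [/rmax_valring[hV J'V] RV JJ']]].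
by exists V; split=> // a /JJ'/J'V.
Qed.

(** The integral closure of S, as the intersection of the valuation rings that
  contain S; in this form transitivity and closure under the ring operations
  are immediate.  For a subfield it is the algebraic closure in K. *)
Definition ic S : set K := [set z | forall V, valring V -> S `<=` V -> V z].

Lemma ic_sub S : S `<=` ic S. Proof. by move=> a Sa V _; exact. Qed.
Lemma subring_ic S : subring (ic S).
Proof.
split.
- by move=> V [/subring1].
- by move=> a b Ia Ib V hV SV; apply: (subringB hV.1); [exact: Ia|exact: Ib].
- by move=> a b Ia Ib V hV SV; apply: (subringM hV.1); [exact: Ia|exact: Ib].
Qed.
Lemma ic_min S R : S `<=` ic R -> ic S `<=` ic R.
Proof. by move=> SR a Ia V hV RV; apply: Ia => // b /SR; exact. Qed.
Lemma icS S R : S `<=` R -> ic S `<=` ic R.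
Proof. by move=> SR; apply: ic_min => a /SR; exact: ic_sub. Qed.

(** Otherwise 1/z generates a proper ideal of S[1/z], and by Chevalley's theorem
  some valuation ring contains S and has 1/z as a nonunit. *)
Lemma ic_inv S z : subring S -> ic S z -> z = 0 \/ exists2 p, pover S p & z = p.[z^-1].
Proof.
move=> hS Iz; have [->|z0] := eqVneq z 0; [by left|right].
apply: contrapT => np.
have hR := subring_radj z^-1 hS.
pose J := [set w | exists2 r, radj S z^-1 r & w = z^-1 * r].
have [|V [hV RV JV]] := @Chevalley (radj S z^-1) J.
  split; [split=> //|].
  - by move=> _ [r Rr ->]; apply: subringM => //; exact: radj_gen.
  - by exists 0; [exact: subring0|rewrite mulr0].
  - by move=> _ _ [r Rr ->] [s Rs ->]; exists (r + s); [exact: subringD|rewrite mulrDr].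
  - by move=> r _ Rr [s Rs ->]; exists (r * s); [exact: subringM|rewrite mulrCA].
  - move=> [_ [p Sp ->] e]; apply: np; exists p => //.
    by rewrite -[LHS]mulr1 e mulrA divff // mul1r.
have mz : maxid V z^-1.
  by apply: JV; exists 1; [exact: subring1|rewrite mulr1].
have Vz : V z by apply: Iz => // a Sa; apply: RV; exact: radj_sub.
by apply: unit_maxid mz; rewrite ?invr_eq0 // invrK.
Qed.

Lemma ic_eq S z : subring S -> ic S z ->
  exists p, [/\ pover S p, p \is monic & root p z].
Proof.
move=> hS /(ic_inv hS)[->|[p Sp e]].
  by exists 'X; split; [exact: poverX|exact: monicX|rewrite rootE hornerX].
have [z0|z0] := eqVneq z 0.
  by exists 'X; split; [exact: poverX|exact: monicX|rewrite rootE hornerX z0].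
pose n := size p.
exists ('X^(n.+1) - \sum_(i < n) p`_i *: 'X^(n - i)).
have sz : (size (\sum_(i < n) p`_i *: 'X^(n - i))%R < size ('X^(n.+1) : {poly K})%R)%N.
  rewrite size_polyXn ltnS; apply: (leq_trans (size_sum _ _ _)); apply/bigmax_leqP => i _.
  by apply: (leq_trans (size_scale_leq _ _)); rewrite size_polyXn ltnS leq_subr.
split.
- apply: poverB; [by []|exact: poverXn|].
  move=> j; rewrite coef_sum; apply: subring_sum => // i _.
  by rewrite coefZ; apply: subringM => //; exact: poverXn.
- by rewrite monicE lead_coefDl ?size_polyN // lead_coefXn.
- rewrite rootE hornerD hornerN hornerXn horner_sum subr_eq0; apply/eqP.
  rewrite exprSr {2}e horner_coef mulr_sumr; apply: eq_bigr => i _.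
  rewrite hornerZ hornerXn mulrCA; congr (_ * _).
  by rewrite mulfXV // ltnW.
Qed.

(** If z had a pole at V, a monic equation divided by the leading power of z
  would make 1 a nonunit of V. *)
Lemma eq_ic S z p : pover (ic S) p -> p \is monic -> root p z -> ic S z.
Proof.
move=> Ip pm pz V hV SV; apply: contrapT => nV.
have [mz z0] := notV_maxid hV nV.
have Vp i : V p`_i by exact: Ip.
have [n sp] : exists n, size p = n.+1.
  by exists (size p).-1; rewrite prednK // lt0n size_poly_eq0 monic_neq0.
have pn : p`_n = 1 by rewrite -(monicP pm) lead_coefE sp.
apply: (maxid_1D hV (a := \sum_(i < n) p`_i * z^-1 ^+ (n - i))).
  apply: maxid_sum => // i _; apply: maxidMl => //; apply: maxid_expr => //.
  by rewrite subn_gt0.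
have -> : 1 + \sum_(i < n) p`_i * z^-1 ^+ (n - i)
   = z^-1 ^+ n * p.[z].
  rewrite horner_coef sp big_ord_recr /= [LHS]addrC mulrDr; congr (_ + _).
    rewrite mulr_sumr; apply: eq_bigr => i _; rewrite mulrCA; congr (_ * _).
    by rewrite -[z ^+ i](congr1 (fun w => w ^+ i) (invrK z)) mulfXV ?invr_eq0 // ltnW.
  by rewrite pn mul1r -exprMn mulVf // expr1n.
by rewrite (eqP pz) mulr0; exact: maxid0.
Qed.

Lemma subring_range (A : pzRingType) (f : {rmorphism A -> K}) : subring (range f).
Proof.
split.
- by exists 1 => //; rewrite rmorph1.
- by move=> _ _ [a _ <-] [b _ <-]; exists (a - b) => //; rewrite rmorphB.
- by move=> _ _ [a _ <-] [b _ <-]; exists (a * b) => //; rewrite rmorphM.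
Qed.

End Subrings.

(** * Generated fields and transcendence degree *)

Section Generation.
Context (K : fieldType).
Implicit Types (R S V F L : set K) (p q : {poly K}) (s : seq K).

Definition gen F s : set K :=
  [set z | forall L, subfield L -> F `<=` L -> (forall t, t \in s -> L t) -> L z].
Definition rgen S s : set K :=
  [set z | forall R, subring R -> S `<=` R -> (forall t, t \in s -> R t) -> R z].

Lemma subfield_gen F s : subfield (gen F s).
Proof.
split; first split.
- by move=> L [/subring1].
- by move=> a b ga gb L hL FL sL; apply: (subringB hL.1); [exact: ga|exact: gb].
- by move=> a b ga gb L hL FL sL; apply: (subringM hL.1); [exact: ga|exact: gb].
- by move=> a ga L hL FL sL; apply: subfieldV => //; exact: ga.
Qed.
Lemma subring_rgen S s : subring (rgen S s).
Proof.
split.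
- by move=> L /subring1.
- by move=> a b ga gb L hL FL sL; apply: (subringB hL); [exact: ga|exact: gb].
- by move=> a b ga gb L hL FL sL; apply: (subringM hL); [exact: ga|exact: gb].
Qed.
Lemma gen_sub F s : F `<=` gen F s. Proof. by move=> a Fa L _ FL _; exact: FL. Qed.
Lemma rgen_sub S s : S `<=` rgen S s. Proof. by move=> a Fa L _ FL _; exact: FL. Qed.
Lemma gen_mem F s t : t \in s -> gen F s t. Proof. by move=> ts L _ _; exact. Qed.
Lemma rgen_mem S s t : t \in s -> rgen S s t. Proof. by move=> ts L _ _; exact. Qed.
Lemma gen_min F s L : subfield L -> F `<=` L -> (forall t, t \in s -> L t) -> gen F s `<=` L.
Proof. by move=> hL FL sL z; exact. Qed.
Lemma rgen_min S s R : subring R -> S `<=` R -> (forall t, t \in s -> R t) -> rgen S s `<=` R.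
Proof. by move=> hL FL sL z; exact. Qed.
Lemma genS F F' s s' : F `<=` gen F' s' -> (forall t, t \in s -> gen F' s' t) ->
  gen F s `<=` gen F' s'.
Proof. by move=> FF ss; apply: gen_min => //; exact: subfield_gen. Qed.
Lemma rgenS F F' s s' : F `<=` rgen F' s' -> (forall t, t \in s -> rgen F' s' t) ->
  rgen F s `<=` rgen F' s'.
Proof. by move=> FF ss; apply: rgen_min => //; exact: subring_rgen. Qed.
Lemma rgen_gen F s : rgen F s `<=` gen F s.
Proof.
by apply: rgen_min; [exact: (subfield_gen _ _).1|exact: gen_sub|exact: gen_mem].
Qed.

Lemma gen_cat F s1 s2 : gen F (s1 ++ s2) = gen (gen F s2) s1.
Proof.
apply/seteqP; split.
  apply: genS; first by move=> a Fa; do 2 apply: gen_sub.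
  by move=> t; rewrite mem_cat => /orP[]; [exact: gen_mem|move=> /gen_mem ts; apply: gen_sub; exact: ts].
apply: genS; last by move=> t ts; apply: gen_mem; rewrite mem_cat ts.
apply: genS; first exact: gen_sub.
by move=> t ts; apply: gen_mem; rewrite mem_cat ts orbT.
Qed.
Lemma rgen_cat F s1 s2 : rgen F (s1 ++ s2) = rgen (rgen F s2) s1.
Proof.
apply/seteqP; split.
  apply: rgenS; first by move=> a Fa; do 2 apply: rgen_sub.
  by move=> t; rewrite mem_cat => /orP[]; [exact: rgen_mem|move=> /rgen_mem ts; apply: rgen_sub; exact: ts].
apply: rgenS; last by move=> t ts; apply: rgen_mem; rewrite mem_cat ts.
apply: rgenS; first exact: rgen_sub.
by move=> t ts; apply: rgen_mem; rewrite mem_cat ts orbT.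
Qed.
Lemma gen_cons F t s : gen F (t :: s) = gen (gen F s) [:: t].
Proof. by rewrite -cat1s gen_cat. Qed.
Lemma rgen_cons F t s : rgen F (t :: s) = rgen (rgen F s) [:: t].
Proof. by rewrite -cat1s rgen_cat. Qed.
Lemma eq_gen F s s' : s =i s' -> gen F s = gen F s'.
Proof.
by move=> ss; apply/seteqP; split; apply: genS; try exact: gen_sub;
   move=> t ts; apply: gen_mem; rewrite ?ss // -ss.
Qed.
Lemma eq_rgen F s s' : s =i s' -> rgen F s = rgen F s'.
Proof.
by move=> ss; apply/seteqP; split; apply: rgenS; try exact: rgen_sub;
   move=> t ts; apply: rgen_mem; rewrite ?ss // -ss.
Qed.
Lemma gen_nil F : subfield F -> gen F [::] = F.
Proof. by move=> hF; apply/seteqP; split; [apply: gen_min|exact: gen_sub]. Qed.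
Lemma rgen_nil F : subring F -> rgen F [::] = F.
Proof. by move=> hF; apply/seteqP; split; [apply: rgen_min|exact: rgen_sub]. Qed.
Lemma rgen1 S t : subring S -> rgen S [:: t] = radj S t.
Proof.
move=> hS; apply/seteqP; split.
  apply: rgen_min; [exact: subring_radj|exact: radj_sub|].
  by move=> u; rewrite inE => /eqP ->; exact: radj_gen.
apply: radj_min; [exact: subring_rgen|exact: rgen_sub|].
by apply: rgen_mem; rewrite inE.
Qed.

Definition frac S : set K :=
  [set z | exists a b, [/\ S a, S b, b != 0 & z = a / b]].
Lemma frac_sub S : subring S -> S `<=` frac S.
Proof. by move=> hS a Sa; exists a, 1; split=> //; [exact: subring1|exact: oner_neq0|rewrite divr1]. Qed.
Lemma subfield_frac S : subring S -> subfield (frac S).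
Proof.
move=> hS; split; first split.
- by apply: frac_sub => //; exact: subring1.
- move=> _ _ [a [b [Sa Sb b0 ->]]] [c [d [Sc Sd d0 ->]]].
  exists (a * d - c * b), (b * d); split.
  + by apply: subringB => //; exact: subringM.
  + exact: subringM.
  + by rewrite mulf_neq0.
  + by rewrite -mulNr addf_div // mulNr.
- move=> _ _ [a [b [Sa Sb b0 ->]]] [c [d [Sc Sd d0 ->]]].
  exists (a * c), (b * d); split; try exact: subringM; first by rewrite mulf_neq0.
  by rewrite mulf_div.
- move=> _ [a [b [Sa Sb b0 ->]]]; have [->|a0] := eqVneq a 0.
    by rewrite mul0r invr0; apply: frac_sub => //; exact: subring0.
  by exists b, a; split=> //; rewrite invf_div.
Qed.
Lemma frac_min S F : subfield F -> S `<=` F -> frac S `<=` F.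
Proof. by move=> hF SF _ [a [b [/SF Fa /SF Fb _ ->]]]; exact: subfield_div. Qed.
Lemma frac_rgen F s : subring F -> frac (rgen F s) = gen F s.
Proof.
move=> hF; apply/seteqP; split.
  by apply: frac_min; [exact: subfield_gen|exact: rgen_gen].
apply: gen_min; first by apply: subfield_frac; exact: subring_rgen.
  by move=> a Fa; apply: frac_sub; [exact: subring_rgen|exact: rgen_sub].
by move=> t ts; apply: frac_sub; [exact: subring_rgen|exact: rgen_mem].
Qed.
Lemma common_denom S p : subring S -> pover (frac S) p ->
  exists b, [/\ S b, b != 0 & pover S (b *: p)].
Proof.
move=> hS; elim/poly_ind: p => [|p c IH] Sp.
  exists 1; split; [exact: subring1|exact: oner_neq0|].
  by move=> i; rewrite scaler0 coef0; exact: subring0.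
have [[a [d [Sa Sd d0 e]]] /IH[b [Sb b0 Sbp]]] := pover_cons Sp.
exists (d * b); split; [exact: subringM|by rewrite mulf_neq0|].
move=> [|i]; rewrite coefZ coefD coefMX coefC /= ?add0r ?addr0.
  by rewrite e mulrC mulrA divfK //; exact: subringM.
by rewrite -mulrA; apply: subringM => //; have := Sbp i; rewrite coefZ.
Qed.

(** The constant term of an equation of z is a multiple of z, hence a nonunit of V
  that lies in F; so it vanishes and the equation can be divided by z. *)
Lemma alg_maxid V F p z : valring V -> subfield F -> F `<=` V ->
  pover F p -> p != 0 -> root p z -> maxid V z -> z = 0.
Proof.
move=> hV hF FV; elim/poly_ind: p => [|p c IH]; first by rewrite eqxx.
move=> Fp p0 /eqP pz mz.
have [Fc Fp'] := pover_cons Fp.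
have c0 : c = 0.
  apply: (subfield_maxid hF FV Fc).
  have -> : c = (- p.[z]) * z.
    apply/eqP; rewrite mulNr -subr_eq0 opprK addrC.
    by rewrite hornerD hornerMX hornerC in pz; rewrite pz.
  apply: maxidMl => //; apply: subringN; first exact: hV.1.
  apply: pover_horner; [exact: hV.1|exact: poverS Fp'|exact: maxid_sub].
rewrite c0 addr0 in p0 pz.
move: pz; rewrite hornerMX => /eqP; rewrite mulf_eq0 => /orP[pz|/eqP//].
by apply: IH => //; apply: contra_neq p0 => ->; rewrite mul0r.
Qed.

Lemma alg_ic F p z : subfield F -> pover F p -> p != 0 -> root p z -> ic F z.
Proof.
move=> hF Fp p0 pz; apply: (@eq_ic _ _ _ ((lead_coef p)^-1 *: p)).
- move=> i; apply: ic_sub; rewrite coefZ; apply: subringM; first exact: hF.1.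
    by apply: subfieldV => //; rewrite lead_coefE; exact: Fp.
  exact: Fp.
- by rewrite monicE lead_coefZ mulVf // lead_coef_eq0.
- by rewrite rootE hornerZ (eqP pz) mulr0.
Qed.

Lemma transc_eq0 F p z : subfield F -> ~ ic F z -> pover F p -> p.[z] = 0 -> p = 0.
Proof.
move=> hF nz Fp pz; apply: contrapT => /eqP p0; apply: nz.
by apply: (alg_ic hF Fp p0); apply/rootP.
Qed.

Lemma subfield_ic F : subfield F -> subfield (ic F).
Proof.
move=> hF; split; first exact: subring_ic.
move=> z Iz V hV FV; apply: contrapT => nV.
have [p [Fp pm pz]] := ic_eq hF.1 Iz.
have := alg_maxid hV hF FV Fp (monic_neq0 pm) pz (or_intror nV).
by move=> z0; apply: nV; rewrite z0 invr0; exact: (subring0 hV.1).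
Qed.

Lemma gen_ic F L s : subfield L -> F `<=` ic L -> (forall t, t \in s -> ic L t) ->
  gen F s `<=` ic L.
Proof. by move=> hL; apply: gen_min; exact: subfield_ic. Qed.

(** An equation of u over F(v), freed of denominators, is a polynomial in v over
  F[u]; it is not zero because u is transcendental over F. *)
Lemma exchange F u v : subfield F ->
  ic (gen F [:: v]) u -> ~ ic F u -> ic (gen F [:: u]) v.
Proof.
move=> hF /(ic_eq (subfield_gen _ _).1)[p [Fp pm pu]] nu.
have hR := subring_radj v hF.1.
rewrite -frac_rgen in Fp; last exact: hF.1.
rewrite (rgen1 _ hF.1) in Fp.
have [b [Rb b0 Rbp]] := common_denom hR Fp.
have /choice[G hG] : forall i, exists g, pover F g /\ (b *: p)`_i = g.[v].
  by move=> i; have [g Fg e] := Rbp i; exists g.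
have bp0 : b *: p != 0 by rewrite scaler_eq0 negb_or b0 monic_neq0.
set n := size (b *: p) in bp0 *.
have Gn : G n.-1 != 0.
  apply/eqP => G0; have := (hG n.-1).2; rewrite G0 horner0 -lead_coefE => /eqP.
  by rewrite lead_coef_eq0 (negPf bp0).
have n0 : (n.-1 < n)%N by rewrite prednK // size_poly_gt0.
pose H := \sum_(i < n) u ^+ i *: G i.
have Hv : H.[v] = 0.
  transitivity (b *: p).[u]; last by rewrite hornerZ (eqP pu) mulr0.
  rewrite [RHS]horner_coef horner_sum; apply: eq_bigr => i _.
  by rewrite hornerZ mulrC (hG i).2.
have hgu := (subfield_gen F [:: u]).1.
have gu : gen F [:: u] u by apply: gen_mem; rewrite inE.
have [H0|H0] := eqVneq H 0; last first.
  apply: (alg_ic _ _ H0); [exact: subfield_gen| |by apply/rootP].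
  move=> j; rewrite coef_sum; apply: (subring_sum hgu) => i _.
  rewrite coefZ; apply: (subringM hgu); first exact: (subringX hgu).
  by apply: gen_sub; exact: (hG i).1.
exfalso; apply: (negP Gn); apply/eqP/polyP => j; rewrite coef0.
have : \poly_(i < n) (G i)`_j = 0.
  apply: (transc_eq0 hF nu).
    move=> i; rewrite coef_poly; case: ifP => _; first exact: (hG i).1.
    exact: (subring0 hF.1).
  rewrite horner_poly; transitivity H`_j; last by rewrite H0 coef0.
  by rewrite coef_sum; apply: eq_bigr => i _; rewrite coefZ mulrC.
by move=> /polyP/(_ n.-1); rewrite coef_poly n0 coef0.
Qed.

(** Algebraic independence over F, in a form suited to induction on s. *)
Fixpoint trl F s : Prop :=
  if s is t :: s' then ~ ic (gen F s') t /\ trl F s' else True.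

Lemma trl_cat F s1 s2 : subfield F ->
  trl F (s1 ++ s2) <-> trl F s2 /\ trl (gen F s2) s1.
Proof.
move=> hF; elim: s1 => [|t s1 IH] /=; first by split=> [|[]].
rewrite gen_cat; split; first by move=> [nt /IH[]].
by move=> [? [? ?]]; split=> //; apply/IH.
Qed.

Lemma trl_swap F t s : subfield F -> trl F (t :: s) -> trl (gen F [:: t]) s.
Proof.
move=> hF; elim: s => [//|u s IH] /= [nt [nu trs]]; split; last first.
  apply: IH; split=> // It; apply: nt; apply: icS It.
  by rewrite gen_cons; exact: gen_sub.
rewrite -gen_cat => Iu; apply: nt; rewrite gen_cons.
apply: exchange nu; first exact: subfield_gen.
rewrite -gen_cons; rewrite (@eq_gen _ _ (s ++ [:: t])) // => w.
by rewrite mem_cat !inE orbC.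
Qed.

Lemma trl_rot F t s : subfield F -> trl F (t :: s) -> trl F (s ++ [:: t]).
Proof.
move=> hF trs; apply/trl_cat => //; split; last exact: trl_swap.
move: trs => /= [nt _]; split=> // It; apply: nt; apply: icS It.
by apply: genS; [exact: gen_sub|].
Qed.

(** The last member of us is exchanged with a member of s and then adjoined to F. *)
Lemma Steinitz F us s : subfield F -> trl F us ->
  (forall u, u \in us -> ic (gen F s) u) -> (size us <= size s)%N.
Proof.
elim/last_ind: us F s => [//|us u IH] F s hF.
rewrite -cats1 => /(trl_cat _ _ hF)[] /= [nu _] trus usI.
have [s1 [v [s2 [es Iv nIv]]]] : exists s1 v s2,
    [/\ s = s1 ++ v :: s2, ic (gen F (v :: s2)) u & ~ ic (gen F s2) u].
  have : ic (gen F s) u by apply: usI; rewrite mem_cat inE eqxx orbT.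
  elim: s {usI} => [//|v s IHs] Iu.
  case: (pselect (ic (gen F s) u)) => [/IHs[s1 [w [s2 [-> ? ?]]]]|]; last by exists [::], v, s.
  by exists (v :: s1), w, s2.
rewrite gen_cons in Iv.
have Iv' := exchange (subfield_gen _ _) Iv nIv.
rewrite size_cat addn1 es size_cat /= addnS ltnS -size_cat.
apply: (IH (gen F [:: u])) => //; first exact: subfield_gen.
move=> w wus.
have Iw : ic (gen F s) w by apply: usI; rewrite mem_cat wus.
apply: (ic_min _ Iw); apply: gen_ic; first exact: subfield_gen.
  by move=> a Fa; apply: ic_sub; do 2 apply: gen_sub.
have sub2 : gen F s2 `<=` gen (gen F [:: u]) (s1 ++ s2).
  apply: genS; first by move=> a Fa; do 2 apply: gen_sub.
  by move=> t ts; apply: gen_mem; rewrite mem_cat ts orbT.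
move=> t; rewrite es mem_cat inE => /or3P[ts|/eqP->|ts].
- by apply: ic_sub; apply: gen_mem; rewrite mem_cat ts.
- apply: icS Iv'; apply: genS => // x; rewrite inE => /eqP ->.
  by apply: gen_sub; apply: gen_mem; rewrite inE.
- by apply: ic_sub; apply: gen_mem; rewrite mem_cat ts orbT.
Qed.

(** * Normality of polynomial rings *)

Definition normal S := forall z, frac S z -> ic S z -> S z.

Lemma monic_division S p d : subring S -> pover S p -> pover S d -> d \is monic ->
  exists q r, [/\ pover S q, pover S r, p = q * d + r & (size r < size d)%N].
Proof.
move=> hS Sp Sd dm; have [m] := ubnP (size p); elim: m p Sp => // m IH p Sp.
rewrite ltnS => sp; have [lt_pd|le_dp] := ltnP (size p) (size d).
  by exists 0, p; split=> //; [exact: pover0|rewrite mul0r add0r].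
have d0 : (0 < size d)%N by rewrite size_poly_gt0 monic_neq0.
have p0 : p != 0 by rewrite -size_poly_gt0 (leq_trans d0).
set c := lead_coef p; set e := (size p - size d)%N.
have Sc : S c by rewrite /c lead_coefE; exact: Sp.
pose p' := p - c *: 'X^e * d.
have Scd : pover S (c *: 'X^e) by apply: poverZ => //; exact: poverXn.
have Sp' : pover S p' by apply: poverB => //; exact: poverM.
have lt_p' : (size p' < size p)%N.
  have scd : size (c *: 'X^e * d) = size p.
    rewrite -scalerAl size_scale ?lead_coef_eq0 // size_monicM ?monicXn ?monic_neq0 //.
    by rewrite size_polyXn addSn /= subnK.
  have le_p' : (size p' <= size p)%N.
    apply: (leq_trans (size_polyD _ _)); rewrite size_polyN scd maxnn //.
  rewrite ltn_neqAle le_p' andbT; apply/eqP => e'.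
  have : lead_coef p' = 0.
    rewrite lead_coefE e' coefB -lead_coefE -scd -lead_coefE lead_coefM lead_coefZ.
    by rewrite lead_coefXn (monicP dm) !mulr1 subrr.
  by move/eqP; rewrite lead_coef_eq0 => /eqP p'0; move: e'; rewrite p'0 size_poly0 => /esym/eqP;
     rewrite size_poly_eq0 (negPf p0).
have [q [r [Sq Sr e1 lt_r]]] := IH p' Sp' (leq_trans lt_p' sp).
exists (q + c *: 'X^e), r; split=> //; first exact: poverD.
by rewrite mulrDl addrAC -e1 /p' subrK.
Qed.

Lemma bezout F a b : subfield F -> pover F a -> pover F b -> b != 0 ->
  exists a' b' d u v, [/\ pover F a', pover F b', pover F u & pover F v] /\
    [/\ a = a' * d, b = b' * d, d != 0 & d = u * a + v * b].
Proof.
move=> hF Fa Fb b0.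
pose J (d : {poly K}) := [/\ d != 0 , pover F d & exists u v, [/\ pover F u, pover F v & d = u * a + v * b]].
have [d [Jd mind]] : exists d, J d /\ forall e, J e -> (size d <= size e)%N.
  have exm : exists m, `[< exists2 d, J d & size d = m >].
    exists (size b); apply/asboolP; exists b => //; split=> //; exists 0, 1; split.
    - exact: (pover0 hF.1).
    - by apply: (poverC hF.1); exact: (subring1 hF.1).
    - by rewrite mul0r mul1r add0r.
  case: (ex_minnP exm) => m /asboolP[d Jd sd] min; exists d; split=> // e Je.
  by rewrite sd; apply: min; apply/asboolP; exists e.
have [d0 Fd [u [v [Fu Fv ed]]]] := Jd.
have hc : lead_coef d != 0 by rewrite lead_coef_eq0.
have Fc : F (lead_coef d)^-1 by apply: subfieldV => //; rewrite lead_coefE; exact: Fd.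
have div w u' v' : pover F w -> pover F u' -> pover F v' -> w = u' * a + v' * b ->
    exists2 w', pover F w' & w = w' * d.
  move=> Fw Fu' Fv' ew.
  have [||q [r [Fq Fr e lt_r]]] := @monic_division F w ((lead_coef d)^-1 *: d) hF.1 Fw.
  - exact: (poverZ hF.1).
  - by rewrite monicE lead_coefZ mulVf.
  exists ((lead_coef d)^-1 *: q); first exact: (poverZ hF.1).
  have [r0|r0] := eqVneq r 0.
    by rewrite e r0 addr0 -scalerAr -scalerAl.
  exfalso; move: lt_r; rewrite size_scale ?invr_eq0 // ltnNge mind //; split=> //.
  pose Q := (lead_coef d)^-1 *: q.
  have FQ : pover F Q by exact: (poverZ hF.1).
  exists (u' - Q * u), (v' - Q * v); split.
  - by apply: (poverB hF.1) => //; exact: (poverM hF.1).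
  - by apply: (poverB hF.1) => //; exact: (poverM hF.1).
  have -> : r = w - Q * d by rewrite {1}e /Q -scalerAr -scalerAl addrAC subrr add0r.
  rewrite ew {1}ed mulrDr !mulrBl !mulrA opprD addrACA //.
have F1 : pover F 1 by apply: (poverC hF.1); exact: (subring1 hF.1).
have F0 := pover0 hF.1.
have [a' Fa' ea] : exists2 w', pover F w' & a = w' * d.
  by apply: (div a 1 0) => //; rewrite mul1r mul0r addr0.
have [b' Fb' eb] : exists2 w', pover F w' & b = w' * d.
  by apply: (div b 0 1) => //; rewrite mul1r mul0r add0r.
by exists a', b', d, u, v; split; split.
Qed.

(** If z = a(t)/b(t) in lowest terms is integral then so is 1/b(t). *)
Lemma normal_radj_field F t : subfield F -> normal (radj F t).
Proof.
move=> hF z [_ [_ [[a Fa ->] [b Fb ->] b0 ez]]] Iz.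
have hR := subring_radj t hF.1.
have bn0 : b != 0 by apply: contraNneq b0 => ->; rewrite horner0.
have [a' [b' [d [u [v [[Fa' Fb' Fu Fv] [ea eb d0 ed]]]]]]] := bezout hF Fa Fb bn0.
have uv1 : u * a' + v * b' = 1.
  by apply: (mulIf d0); rewrite mul1r mulrDl -!mulrA -ea -eb -ed.
have b'0 : b'.[t] != 0 by apply: contraNneq b0 => e; rewrite eb hornerM e mul0r.
have d'0 : d.[t] != 0 by apply: contraNneq b0 => e; rewrite eb hornerM e mulr0.
have {}ez : z = a'.[t] / b'.[t].
  by rewrite ez ea eb !hornerM -mulf_div divff // mulr1.
have Ib : ic (radj F t) b'.[t]^-1.
  have -> : b'.[t]^-1 = u.[t] * z + v.[t].
    apply: (mulIf b'0); rewrite mulVf // mulrDl ez mulrA divfK //.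
    by rewrite -!hornerM -hornerD uv1 hornerC.
  apply: (subringD (subring_ic _)); last by apply: ic_sub; exists v.
  apply: (subringM (subring_ic _)) => //; by apply: ic_sub; exists u.
rewrite ez; apply: (subringM hR); first by exists a'.
case: (ic_inv hR Ib) => [/eqP|[p Rp ->]]; first by rewrite invr_eq0 (negPf b'0).
by apply: (pover_horner hR) => //; rewrite invrK; exists b'.
Qed.

Definition infinite_pred F := forall l : seq K, exists2 c, F c & c \notin l.

(** Newton interpolation: p is recovered from its values at points of the infinite
  field F, whose nonzero differences are invertible in S. *)
Lemma interpolation S F p (l : seq K) : subring S -> subfield F -> F `<=` S -> infinite_pred F ->
  (forall c, F c -> c \notin l -> S p.[c]) -> pover S p.
Proof.
move=> hS hF FS Finf; have [m] := ubnP (size p); elim: m p l => // m IH p l.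
rewrite ltnS => sp Spc.
have [c Fc cl] := Finf l.
have Sc := Spc c Fc cl.
have : root (p - p.[c]%:P) c by rewrite rootE hornerD hornerN hornerC subrr.
case/factor_theorem=> q eq.
have ep : p = q * ('X - c%:P) + p.[c]%:P by rewrite -eq subrK.
have [q0|q0] := eqVneq q 0.
  by rewrite ep q0 mul0r add0r; exact: (poverC hS).
have Sq : pover S q.
  apply: (IH q (c :: l)).
    have := congr1 (size \o polyseq) eq; rewrite /= size_Mmonic ?monicXsubC // size_XsubC addn2 /=.
    move=> e; rewrite -ltnS -e; apply: leq_ltn_trans (size_polyD _ _) _.
    rewrite ltnS size_polyN size_polyC geq_max sp /=.
    case: eqP => // _; apply: leq_trans sp; rewrite size_poly_gt0.
    apply: contraNneq q0 => p0; move/eqP: eq.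
    by rewrite p0 horner0 polyC0 subr0 eq_sym mulf_eq0 polyXsubC_eq0 orbF.
  move=> e Fe; rewrite inE negb_or => /andP[ec el].
  have : S (p.[e] - p.[c]) by apply: subringB => //; exact: Spc.
  have -> : p.[e] - p.[c] = q.[e] * (e - c).
    by rewrite {1}ep hornerD hornerM hornerC hornerXsubC addrK.
  move=> Sqe.
  rewrite -[q.[e]](@mulfK _ (e - c)) ?subr_eq0 //.
  apply: subringM => //; apply: FS; apply: subfieldV => //.
  by apply: (subringB hF.1).
rewrite ep; apply: (poverD hS); last exact: (poverC hS).
apply: (poverM hS) => //; apply: (poverB hS); first exact: (poverX hS).
by apply: (poverC hS); exact: FS.
Qed.

(** By the case of a field, z is a polynomial in t over the fraction field of S.
  Its integral equation over S[t] is an identity of polynomials, which at points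
  c of F becomes an integral equation over S of the value at c; interpolation
  then brings the coefficients into S. *)
Lemma normal_radj S F t : subring S -> subfield F -> F `<=` S -> infinite_pred F ->
  normal S -> ~ ic (frac S) t -> normal (radj S t).
Proof.
move=> hS hF FS Finf nS nt z fz Iz.
have hE := subfield_frac hS.
have hR := subring_radj t hS.
have sub : radj S t `<=` radj (frac S) t.
  apply: radj_min; [exact: (subring_radj _ hE.1)| |exact: (radj_gen _ hE.1)].
  by move=> a /(frac_sub hS)/(radj_sub t hE.1).
have [ze Eze ez] : radj (frac S) t z.
  apply: normal_radj_field => //; last exact: icS Iz.
  move: fz; apply: frac_min; first by apply: subfield_frac; exact: subring_radj hE.1.
  by move=> a /sub; apply: frac_sub; exact: subring_radj hE.1.
have [P [RP Pm Pz]] := ic_eq hR Iz.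
have /choice[G hG] : forall i, exists g, pover S g /\ P`_i = g.[t].
  by move=> i; have [g Fg e] := RP i; exists g.
have [n sP] : exists n, size P = n.+1.
  by exists (size P).-1; rewrite prednK // size_poly_gt0 monic_neq0.
have Pn : P`_n = 1 by rewrite -(monicP Pm) lead_coefE sP.
pose Q := ze ^+ n + \sum_(i < n) G i * ze ^+ i.
have EX m : pover (frac S) (ze ^+ m).
  elim: m => [|m IH]; first by rewrite expr0; apply: (poverC hE.1); exact: (subring1 hE.1).
  by rewrite exprS; exact: (poverM hE.1).
have Q0 : Q = 0.
  apply: (transc_eq0 hE nt).
    apply: (poverD hE.1) => //; elim/big_ind: _ => //; first exact: (pover0 hE.1).
      by move=> x y; exact: (poverD hE.1).
    move=> i _; apply: (poverM hE.1) => //; apply: (poverS (frac_sub hS)).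
    exact: (hG i).1.
  transitivity P.[z]; last exact/eqP.
  rewrite /Q hornerD horner_sum horner_exp -ez.
  rewrite [RHS]horner_coef sP big_ord_recr /= Pn mul1r [RHS]addrC.
  congr (_ + _); apply: eq_bigr => i _.
  by rewrite hornerM horner_exp -ez (hG i).2.
exists ze => //; apply: (@interpolation S F ze [::]) => // c Fc _.
apply: nS; first by apply: (pover_horner hE.1) => //; apply: frac_sub => //; exact: FS.
pose T := 'X^n + \poly_(i < n) (G i).[c].
have sT : (size (\poly_(i < n) (G i).[c]) < size ('X^n : {poly K}))%N.
  by rewrite size_polyXn ltnS size_poly.
apply: (@eq_ic _ _ _ T).
- move=> i; apply: ic_sub; apply: (poverD hS); first exact: (poverXn hS).
  move=> j; rewrite coef_poly; case: ifP => _; last exact: subring0.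
  by apply: (pover_horner hS); [exact: (hG j).1|exact: FS].
- by rewrite monicE lead_coefDl // lead_coefXn.
- rewrite rootE /T hornerD hornerXn horner_poly -[X in _ == X](horner0 c) -Q0.
  rewrite /Q hornerD horner_sum horner_exp; apply/eqP; congr (_ + _).
  by apply: eq_bigr => i _; rewrite hornerM horner_exp.
Qed.

Lemma normal_rgen F s : subfield F -> infinite_pred F -> trl F s -> normal (rgen F s).
Proof.
move=> hF Finf; elim: s => [|t s IH] /=.
  by move=> _; rewrite (rgen_nil hF.1) => z fz _; apply: (frac_min hF) fz.
move=> [nt /IH ns]; rewrite rgen_cons rgen1; last exact: subring_rgen.
apply: (@normal_radj _ F) => //; first exact: subring_rgen.
  exact: rgen_sub.
by rewrite (frac_rgen _ hF.1).
Qed.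

End Generation.

(** * Integrality in codimension one *)

Section Codim.
Context (K : fieldType).
Implicit Types (R S V F L : set K) (p q : {poly K}) (s : seq K).

(** The least value among the f i, and its first occurrence. *)
Lemma first_dominant V (f : nat -> K) n : valring V ->
  (exists2 i, (i < n)%N & f i != 0) ->
  exists i0, [/\ (i0 < n)%N, f i0 != 0 &
    forall i, (i < n)%N -> V (f i / f i0) /\ ((i < i0)%N -> maxid V (f i / f i0))].
Proof.
move=> hV; elim: n => [[]//|n IH] [j jn fj].
case: (pselect (exists2 i, (i < n)%N & f i != 0)) => [/IH[i0 [i0n fi0 h]]|nex]; last first.
  have {}nex i : (i < n)%N -> f i = 0.
    by move=> ilt; apply: contrapT => /eqP fi; apply: nex; exists i.
  have ej : j = n.
    move: jn; rewrite ltnS leq_eqVlt => /orP[/eqP//|/nex f0].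
    by rewrite f0 eqxx in fj.
  subst j; exists n; split=> // i; rewrite ltnS leq_eqVlt => /orP[/eqP->|ilt].
    by rewrite ltnn divff //; split=> //; exact: (subring1 hV.1).
  by rewrite nex // mul0r; split; [exact: (subring0 hV.1)|left].
case: (pselect (V (f n / f i0))) => [Vn|/(notV_maxid hV)[]].
  exists i0; split=> //; first exact: leqW.
  move=> i; rewrite ltnS leq_eqVlt => /orP[/eqP->|/h//].
  by split=> //; rewrite ltnNge (ltnW i0n).
rewrite invf_div mulf_eq0 negb_or => mn /andP[fn _].
have e i : f i / f n = (f i / f i0) * (f i0 / f n) by rewrite mulrA divfK.
exists n; split=> // i; rewrite ltnS leq_eqVlt => /orP[/eqP->|/h[Vi _]].
  by rewrite ltnn divff //; split=> //; exact: (subring1 hV.1).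
have mi : maxid V (f i / f n) by rewrite e; exact: maxidMl.
by split=> // ; exact: maxid_sub.
Qed.

(** Gauss's lemma over a valuation ring: in the product of p and q the product
  of the first dominant coefficients of p and of q is not cancelled. *)
Lemma Gauss_valring V p q : valring V -> p \is monic -> q \is monic ->
  pover V (p * q) -> pover V p.
Proof.
move=> hV pm qm Vpq.
have dom r : r \is monic -> exists i0, r`_i0 != 0 /\
    forall i, V (r`_i / r`_i0) /\ ((i < i0)%N -> maxid V (r`_i / r`_i0)).
  move=> rm; have [|i0 [i0n ri0 h]] := @first_dominant V (fun i => r`_i) (size r) hV.
    exists (size r).-1; last by rewrite -lead_coefE lead_coef_eq0 monic_neq0.
    by rewrite prednK // size_poly_gt0 monic_neq0.
  exists i0; split=> // i; have [/h//|sr] := ltnP i (size r).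
  by rewrite nth_default // mul0r; split; [exact: (subring0 hV.1)|left].
have [i0 [pi0 hp]] := dom p pm; have [j0 [qj0 hq]] := dom q qm.
have inv r (rm : r \is monic) k : (forall i, V (r`_i / r`_k) /\ ((i < k)%N -> maxid V (r`_i / r`_k))) -> V (r`_k)^-1.
  by move=> /(_ (size r).-1)[]; rewrite -lead_coefE (monicP rm) mul1r.
have Vpi := inv p pm i0 hp; have Vqi := inv q qm j0 hq.
pose w := (p * q)`_(i0 + j0) / (p`_i0 * q`_j0).
have mw : maxid V (w - 1).
  have ilt : (i0 < (i0 + j0).+1)%N by rewrite ltnS leq_addr.
  rewrite /w coefM (bigD1 (Ordinal ilt)) //= addKn mulrDl divff ?mulf_neq0 //.
  rewrite addrAC subrr add0r mulr_suml; apply: (maxid_sum hV) => i ni.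
  rewrite -mulf_div; have [ii|ii|ii] := ltngtP i i0.
  - by apply: (maxidMr hV); [exact: (hq _).1|exact: (hp _).2].
  - apply: (maxidMl hV); [exact: (hp _).1|apply: (hq _).2].
    by rewrite ltn_subLR ?ltn_add2r // -ltnS.
  - by case/negP: ni; apply/eqP/val_inj.
have nw : ~ maxid V w.
  by rewrite -[w](subrK 1) addrC; exact: maxid_1D.
have Vw : V w.
  by rewrite -[w](subrK 1); apply: (subringD hV.1); [exact: maxid_sub|exact: (subring1 hV.1)].
have [Vwi w0] := maxidP Vw nw.
have Vp0 : V p`_i0.
  have -> : p`_i0 = (p * q)`_(i0 + j0) * w^-1 * (q`_j0)^-1.
    rewrite /w invf_div mulrA [_ * (p`_i0 * _)]mulrC mulfK; first by rewrite mulfK.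
    by apply: contraNneq w0 => e; rewrite /w e mul0r.
  apply: (subringM hV.1) => //; apply: (subringM hV.1) => //; exact: Vpq.
by move=> i; rewrite -[p`_i](divfK pi0); apply: (subringM hV.1) => //; exact: (hp i).1.
Qed.

Lemma minpoly_exists E z : subfield E -> ic E z ->
  exists m, [/\ pover E m, m \is monic, root m z &
    forall p, pover E p -> root p z -> exists2 q, pover E q & p = q * m].
Proof.
move=> hE /(ic_eq hE.1)[p0 [Ep0 p0m p0z]].
have exn : exists n, `[< exists p, [/\ pover E p, p \is monic, root p z & size p = n] >].
  by exists (size p0); apply/asboolP; exists p0.
case: (ex_minnP exn) => n /asboolP[m [Em mm mz sm]] min.
exists m; split=> // p Ep pz.
have [q [r [Eq Er e lt_r]]] := monic_division hE.1 Ep Em mm.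
exists q => //; have [r0|r0] := eqVneq r 0; first by rewrite e r0 addr0.
have : (n <= size r)%N; last by rewrite leqNgt -sm lt_r.
have r0' : lead_coef r != 0 by rewrite lead_coef_eq0.
apply: min; apply/asboolP; exists ((lead_coef r)^-1 *: r); split.
- apply: (poverZ hE.1) => //; apply: subfieldV => //; rewrite lead_coefE; exact: Er.
- by rewrite monicE lead_coefZ mulVf.
- have -> : r = p - q * m by rewrite e addrAC subrr add0r.
  by rewrite rootE hornerZ hornerD hornerN hornerM (eqP pz) (eqP mz) mulr0 subrr mulr0.
- by rewrite size_scale // invr_eq0.
Qed.

(** Gauss's lemma, applied in every valuation ring that contains S to the minimal
  polynomial m as a factor of an integral equation. *)
Lemma minpoly_coef S E z m : subring S -> S `<=` E -> ic S z -> m \is monic ->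
  (forall p, pover E p -> root p z -> exists2 q, pover E q & p = q * m) ->
  pover (ic S) m.
Proof.
move=> hS SE Iz mm div.
have [G [SG Gm Gz]] := ic_eq hS Iz.
have [q Eq e] := div G (poverS SE SG) Gz.
have qm : q \is monic by rewrite -(monicMr _ mm) -e.
move=> i V hV SV; apply: (@Gauss_valring V m q) => //.
by rewrite mulrC -e; exact: poverS SG.
Qed.

Lemma rgen_frac_denom S s e : subring S -> rgen (frac S) s e ->
  exists b, [/\ S b, b != 0 & rgen S s (b * e)].
Proof.
move=> hS.
have hR := subring_rgen S s.
have : subring [set e | exists b, [/\ S b, b != 0 & rgen S s (b * e)]].
  split.
  - exists 1; split; [exact: subring1|exact: oner_neq0|rewrite mulr1; exact: subring1].
  - move=> x y [b [Sb b0 gb]] [c [Sc c0 gc]]; exists (b * c); split.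
    + exact: subringM.
    + by rewrite mulf_neq0.
    + have -> : b * c * (x - y) = c * (b * x) - b * (c * y).
        by rewrite mulrBr mulrA [c * b]mulrC mulrA.
      by apply: (subringB hR); apply: (subringM hR) => //; exact: rgen_sub.
  - move=> x y [b [Sb b0 gb]] [c [Sc c0 gc]]; exists (b * c); split.
    + exact: subringM.
    + by rewrite mulf_neq0.
    + by rewrite mulrACA; exact: (subringM hR).
move=> hD; move=> he; apply: (rgen_min hD _ _ he).
  move=> _ [a [b [Sa Sb b0 ->]]]; exists b; split=> //.
  by rewrite mulrC divfK //; exact: rgen_sub.
move=> t ts; exists 1; split; [exact: subring1|exact: oner_neq0|].
by rewrite mul1r; exact: rgen_mem.
Qed.

(** For some Q over F and some b free of t, both Q(t) e and b e are polynomials;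
  made monic, Q then divides Q(t) e as a polynomial in t. *)
Lemma rgen_inter F t s e : subfield F -> trl F (t :: s) ->
  rgen (gen F [:: t]) s e -> rgen (gen F s) [:: t] e -> rgen F (t :: s) e.
Proof.
move=> hF [nt _] e1 e2.
have hS := subring_rgen F s.
have hFt := subring_radj t hF.1.
have ets : rgen F (t :: s) = radj (rgen F s) t by rewrite rgen_cons rgen1.
rewrite -frac_rgen in e1; last exact: hF.1.
rewrite rgen1 in e1; last exact: hF.1.
have [_ [[Q FQ ->] Qt0]] := rgen_frac_denom hFt e1.
rewrite -(rgen1 _ hF.1) -rgen_cat (eq_rgen _ (_ : s ++ [:: t] =i t :: s)); last first.
  by move=> w; rewrite mem_cat !inE orbC.
rewrite ets => -[P SP eP].
rewrite -frac_rgen in e2; last exact: hF.1.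
have [b [Sb b0]] := rgen_frac_denom hS e2.
rewrite rgen1 // => -[U SU eU].
have Q0 : Q != 0 by apply: contraNneq Qt0 => ->; rewrite horner0.
have lQ : lead_coef Q != 0 by rewrite lead_coef_eq0.
have SQ : pover (rgen F s) Q by apply: poverS FQ; exact: rgen_sub.
have eq : b *: P = Q * U.
  apply/eqP; rewrite -subr_eq0; apply/eqP.
  apply: (transc_eq0 (subfield_gen F s) nt).
    apply: (poverS (@rgen_gen _ F s)); apply: (poverB hS); first exact: (poverZ hS).
    exact: (poverM hS).
  by rewrite hornerD hornerN hornerM hornerZ -eP -eU mulrCA subrr.
pose M := (lead_coef Q)^-1 *: Q.
have Fl : F (lead_coef Q)^-1 by apply: subfieldV => //; rewrite lead_coefE; exact: FQ.
have SM : pover (rgen F s) M by apply: (poverZ hS) => //; exact: rgen_sub.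
have Mm : M \is monic by rewrite monicE lead_coefZ mulVf.
have [q [r [Sq Sr e3 lt_r]]] := monic_division hS SP SM Mm.
have eQ : Q = lead_coef Q *: M by rewrite scalerA divff // scale1r.
have r0 : r = 0.
  apply/eqP; apply: contraT => r0.
  have : b *: r = (lead_coef Q *: U - b *: q) * M.
    rewrite mulrBl -scalerAl -scalerAl [in LHS](_ : r = P - q * M); last by rewrite e3 addrAC subrr add0r.
    by rewrite scalerBr eq {1}eQ -scalerAl mulrC.
  set W := _ - _ => e4.
  have W0 : W != 0.
    by apply: contraNneq r0 => W0; move/eqP: e4; rewrite W0 mul0r scaler_eq0 (negPf b0).
  have := congr1 (size \o polyseq) e4; rewrite /= size_scale // size_Mmonic //.
  move=> sr; move: lt_r; rewrite sr ltnNge.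
  have : (0 < size W)%N by rewrite size_poly_gt0.
  by case: (size W) => // n _; rewrite addSn /= leq_addl.
exists ((lead_coef Q)^-1 *: q).
  by apply: (poverZ hS) => //; exact: rgen_sub.
apply: (mulfI Qt0); rewrite eP e3 r0 addr0 {1}eQ !hornerM !hornerZ.
by rewrite mulrACA divff // mul1r mulrC.
Qed.

(** A failure of integrality over a polynomial ring already occurs in
  codimension one: it persists over the ring of polynomials in one of the
  variables with coefficients in the field generated by the others.
  Otherwise the coefficients of the minimal polynomial of z would lie in two
  normal rings whose intersection is the polynomial ring. *)
Lemma not_ic_codim1 F s z : subfield F -> infinite_pred F -> trl F s ->
  ic (gen F s) z -> ~ ic (rgen F s) z ->
  exists t s', [/\ size s = (size s').+1, gen F s = gen F (t :: s'),
    rgen F s `<=` rgen (gen F s') [:: t], trl F (t :: s') &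
    ~ ic (rgen (gen F s') [:: t]) z].
Proof.
elim: s F => [|t s IH] F hF Finf trs Iz nIz.
  by rewrite (gen_nil hF) in Iz; rewrite (rgen_nil hF.1) in nIz.
have hFt := subfield_gen F [:: t].
have FFt : F `<=` gen F [:: t] by exact: gen_sub.
have Ftinf : infinite_pred (gen F [:: t]).
  by move=> l; have [c Fc cl] := Finf l; exists c => //; exact: FFt.
have trs' := trl_swap hF trs.
have ecs : s ++ [:: t] =i t :: s by move=> w; rewrite mem_cat !inE orbC.
have egen : gen (gen F [:: t]) s = gen F (t :: s) by rewrite -gen_cat (eq_gen _ ecs).
case: (pselect (ic (rgen (gen F [:: t]) s) z)) => [I1|n1]; last first.
  rewrite -egen in Iz.
  have [t0 [s0 [ss es rs tr0 n0]]] := IH _ hFt Ftinf trs' Iz n1.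
  exists t0, (s0 ++ [:: t]); split.
  - by rewrite /= ss size_cat addn1.
  - by rewrite -egen es -cat_cons gen_cat.
  - rewrite gen_cat; apply: subset_trans rs; rewrite -(eq_rgen _ ecs).
    by rewrite rgen_cat; apply: rgenS; [move=> a /rgen_gen; exact: rgen_sub|exact: rgen_mem].
  - by rewrite -cat_cons; apply/trl_cat => //; split=> //;
      have /(trl_cat _ _ hF)[] := trl_rot hF trs.
  - by rewrite gen_cat.
case: (pselect (ic (rgen (gen F s) [:: t]) z)) => [I2|n2]; last first.
  exists t, s; split=> //; rewrite rgen_cons.
  by apply: rgenS; [move=> a /rgen_gen; exact: rgen_sub|exact: rgen_mem].
case: nIz.
have hE := subfield_gen F (t :: s).
have [m [Em mm mz div]] := minpoly_exists hE Iz.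
apply: (@eq_ic _ _ _ m) => // i; apply: ic_sub.
apply: rgen_inter => //.
  apply: (normal_rgen hFt Ftinf trs'); first by rewrite (frac_rgen _ hFt.1) egen; exact: Em.
  apply: (minpoly_coef _ _ I1 mm div); first exact: subring_rgen.
  by rewrite -egen; exact: rgen_gen.
have Fsinf : infinite_pred (gen F s).
  by move=> l; have [c Fc cl] := Finf l; exists c => //; exact: gen_sub.
have hFs := subfield_gen F s.
apply: (normal_rgen hFs Fsinf).
- by move: trs => /= [nt _]; rewrite (gen_nil hFs).
- by rewrite (frac_rgen _ hFs.1) -gen_cons; exact: Em.
apply: (minpoly_coef _ _ I2 mm div); first exact: subring_rgen.
by rewrite gen_cons; exact: rgen_gen.
Qed.

End Codim.

(** * Algebraic independence and Noether normalization *)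

Module MPoly.
From mathcomp Require Import mpoly.

Section MpolyLink.
Context (k : fieldType).
Local Notation mpol n := ({mpoly k[n]}).
Local Notation wid := (widen_ord (leqnSn _)).

Definition mfront n (m : multinom n.+1) : multinom n :=
  Multinom [tuple m (wid i) | i < n].

Lemma muniE' n (P : mpol n.+1) : muni P =
  \sum_(m <- msupp P)
    (mcoeff m P *: mpolyX k (mfront m)) *: 'X^(m ord_max).
Proof. exact: muniE. Qed.

Lemma mfront_inj n (m1 m2 : multinom n.+1) :
  mfront m1 = mfront m2 -> m1 ord_max = m2 ord_max -> m1 = m2.
Proof.
move=> e1 e2; apply/mnmP => i.
have [ilt|] := ltnP i n; last first.
  by move=> ni; have -> : i = ord_max by apply/val_inj/eqP; rewrite /= eqn_leq ni -ltnS ltn_ord.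
have -> : i = wid (Ordinal ilt) by exact: val_inj.
have := congr1 (fun m : multinom n => m (Ordinal ilt)) e1.
by rewrite /mfront !mnmE.
Qed.

Lemma muni_eq0 n (P : mpol n.+1) : muni P = 0 -> P = 0.
Proof.
move=> e; apply/mpolyP => m0; rewrite mcoeff0.
apply: contrapT => /eqP; rewrite -mcoeff_msupp => m0P.
have := congr1 (fun q : {poly mpol n} => mcoeff (mfront m0) q`_(m0 ord_max)) e.
rewrite muniE' coef_sum raddf_sum coef0 mcoeff0 /=.
rewrite (bigD1_seq m0) //= ?msupp_uniq // big1 => [|m mm].
  rewrite addr0 coefZ coefXn eqxx mulr1 mcoeffZ mcoeffX eqxx mulr1.
  by move/eqP; rewrite -[_ == _]negbK -mcoeff_msupp m0P.
rewrite coefZ coefXn; case: eqP => [e1|_]; last by rewrite mulr0 mcoeff0.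
rewrite mulr1 mcoeffZ mcoeffX; case: eqP => [e2|_]; last by rewrite mulr0.
by case/eqP: mm; apply: mfront_inj.
Qed.

Lemma muniXE n (m : multinom n.+1) :
  muni (mpolyX k m) = mpolyX k (mfront m) *: 'X^(m ord_max).
Proof.
by rewrite muniE' msuppX big_seq1 mcoeffX eqxx scale1r.
Qed.

Lemma muni_mwiden n (q : mpol n) : muni (mwiden q) = q%:P.
Proof.
rewrite [in LHS](mpolyE q) [in RHS](mpolyE q) (raddf_sum (@mwiden n k)) (raddf_sum (@muni n k)) raddf_sum /=.
apply: eq_bigr => m _; rewrite mwidenZ muniZ mwidenX muniXE.
rewrite mnmwiden_ordmax expr0.
have -> : mfront (mnmwiden m) = m.
  by apply/mnmP => i; rewrite /mfront mnmE mnmwiden_widen.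
by rewrite -mul_polyC -mul_polyC mulr1 -polyCM mul_mpolyC.
Qed.

Lemma muni_surj n (Q : {poly mpol n}) : exists P : mpol n.+1, muni P = Q.
Proof.
exists (\sum_(i < size Q) mwiden Q`_i * mpolyX k (mnm1 ord_max) ^+ i).
rewrite (raddf_sum (@muni n k)) -[RHS]coefK poly_def; apply: eq_bigr => i _ /=.
rewrite muniM (rmorphXn (@muni n k)) /= muni_mwiden muniXE mnmE eqxx expr1 mul_polyC.
have -> : mfront (mnm1 ord_max) = mnm0 :> multinom n.
  apply/mnmP => l; rewrite /mfront !mnmE.
  by case: eqP => // /(congr1 val) /= e; have := ltn_ord l; rewrite -e ltnn.
by rewrite mpolyX0 scale1r.
Qed.

Section Eval.
Context (K : fieldType) (j : {rmorphism k -> K}).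

Definition front n (t : 'I_n.+1 -> K) : 'I_n -> K := fun i => t (wid i).

Lemma mmap_muni n (t : 'I_n.+1 -> K) (P : mpol n.+1) :
  mmap j t P = (map_poly (mmap j (front t)) (muni P)).[t ord_max].
Proof.
rewrite muniE' raddf_sum horner_sum /mmap; apply: eq_bigr => m _ /=.
rewrite map_polyZ map_polyXn hornerZ hornerXn /= mmapZ mmapX.
rewrite -mulrA; congr (_ * _).
rewrite /mmap1 big_ord_recr /=; congr (_ * _); apply: eq_bigr => i _.
by rewrite /mfront mnmE.
Qed.

(** Listed from the last variable down, because muni makes the last variable the
  outer one. *)
Fixpoint lst n : ('I_n -> K) -> seq K :=
  match n with
  | 0 => fun _ => [::]
  | n'.+1 => fun t => t ord_max :: lst (front t)
  end.

Lemma size_lst n (t : 'I_n -> K) : size (lst t) = n.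
Proof. by elim: n t => //= n IH t; rewrite IH. Qed.

Lemma mem_lst n (t : 'I_n -> K) i : t i \in lst t.
Proof.
elim: n t i => [|n IH] t i; first by case: i.
rewrite inE; have [ilt|ni] := ltnP i n.
  by have -> : i = wid (Ordinal ilt); [exact: val_inj|rewrite [X in _ || X]IH orbT].
have -> : i = ord_max by apply/val_inj/eqP; rewrite /= eqn_leq ni -ltnS ltn_ord.
by rewrite eqxx.
Qed.

Lemma lst_mem n (t : 'I_n -> K) w : w \in lst t -> exists i, w = t i.
Proof.
elim: n t => [//|n IH] t; rewrite inE => /orP[/eqP->|/IH[i ->]]; first by exists ord_max.
by exists (wid i).
Qed.

Lemma lst_surj (s : seq K) : exists t : 'I_(size s) -> K, lst t = s.
Proof.
elim: s => [|x s [t et]]; first by exists (fun=> 0).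
exists (fun i => oapp t x (unlift ord_max i)) => /=.
rewrite unlift_none -[in RHS]et; congr (_ :: _); congr lst.
apply: funext => i; rewrite /front.
have -> : wid i = lift ord_max i by apply: val_inj; rewrite /= /bump leqNgt ltn_ord.
by rewrite liftK.
Qed.

Let F : set K := range j.

Lemma subfield_range : subfield F.
Proof.
split; first exact: subring_range.
by move=> _ [a _ <-]; exists a^-1 => //; rewrite fmorphV.
Qed.

Lemma mmap_rgen n (t : 'I_n -> K) P : rgen F (lst t) (mmap j t P).
Proof.
have hR := subring_rgen F (lst t).
rewrite /mmap; apply: (subring_sum hR) => m _; apply: (subringM hR).
  by apply: rgen_sub; exists (mcoeff m P).
rewrite /mmap1; apply: (subring_prod hR) => i _; apply: (subringX hR).
by apply: rgen_mem; exact: mem_lst.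
Qed.

Lemma rgen_mmap n (t : 'I_n -> K) z : rgen F (lst t) z -> exists P, z = mmap j t P.
Proof.
apply: (@rgen_min _ F (lst t) [set z | exists P, z = mmap j t P]).
- split.
  + by exists 1; rewrite rmorph1.
  + by move=> _ _ [P ->] [Q ->]; exists (P - Q); rewrite rmorphB.
  + by move=> _ _ [P ->] [Q ->]; exists (P * Q); rewrite rmorphM.
- by move=> _ [c _ <-]; exists (mpolyC n c); rewrite mmapC.
- move=> w /lst_mem[i ->]; exists (mpolyX k (mnm1 i)).
  by rewrite mmapX mmap1U.
Qed.

(** By induction on n: muni turns P into a polynomial in the last variable over the
  polynomials in the others. *)
Lemma trl_mmap n (t : 'I_n -> K) :
  trl F (lst t) <-> forall P : mpol n, mmap j t P = 0 -> P = 0.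
Proof.
have hF := subfield_range.
elim: n t => [|n IH] t /=.
  split=> // _ P; have E (m : multinom 0) : m = (@mnm0 0) by apply/mnmP => -[].
  move=> eP; apply/mpolyP => m; rewrite mcoeff0 (E m).
  have -> : P = mpolyC 0 (mcoeff ((@mnm0 0)) P) :> mpol 0.
    by apply/mpolyP => m'; rewrite (E m') mcoeffC eqxx mulr1.
  move: eP; rewrite {1}(_ : P = mpolyC 0 (mcoeff ((@mnm0 0)) P)); last first.
    by apply/mpolyP => m'; rewrite (E m') mcoeffC eqxx mulr1.
  rewrite mmapC mcoeffC eqxx mulr1 => /eqP.
  by rewrite fmorph_eq0 => /eqP.
split.
  move=> [nt /IH trt] P; rewrite mmap_muni => e.
  apply: muni_eq0; apply/polyP => i; rewrite coef0; apply: trt.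
  have := transc_eq0 (subfield_gen F (lst (front t))) nt _ e.
  move=> /(_ _)/polyP/(_ i); rewrite coef_map coef0; apply.
  by move=> l; rewrite coef_map; apply: rgen_gen; exact: mmap_rgen.
move=> ind.
have ind' (Q : {poly mpol n}) :
    (map_poly (mmap j (front t)) Q).[t ord_max] = 0 -> Q = 0.
  by have [P <-] := muni_surj Q; rewrite -mmap_muni => /ind ->; rewrite raddf0.
split; last first.
  apply/IH => P eP.
  have /ind' : (map_poly (mmap j (front t)) P%:P).[t ord_max] = 0.
    by rewrite map_polyC /= hornerC.
  by move/eqP; rewrite polyC_eq0 => /eqP.
move=> /(ic_eq (subfield_gen _ _).1)[p [Gp pm pz]].
rewrite -(frac_rgen _ hF.1) in Gp.
have [b [Rb b0 Rbp]] := common_denom (subring_rgen _ _) Gp.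
have /choice[G hG] : forall i, exists P, (b *: p)`_i = mmap j (front t) P.
  by move=> i; apply: rgen_mmap; exact: Rbp.
have bp0 : b *: p != 0 by rewrite scaler_eq0 negb_or b0 monic_neq0.
have eQ : map_poly (mmap j (front t)) (\poly_(i < size (b *: p)) G i) = b *: p.
  apply/polyP => i; rewrite coef_map coef_poly; case: ltnP => [_|le]; first by rewrite hG.
  by rewrite /= rmorph0 nth_default.
have /ind' Q0 : (map_poly (mmap j (front t)) (\poly_(i < size (b *: p)) G i)).[t ord_max] = 0.
  by rewrite eQ hornerZ (eqP pz) mulr0.
by move: bp0; rewrite -eQ Q0 rmorph0 eqxx.
Qed.

Lemma digits_inj n D (a b : 'I_n -> nat) : (forall i, a i < D)%N -> (forall i, b i < D)%N ->
  (\sum_(i < n) a i * D ^ i = \sum_(i < n) b i * D ^ i)%N -> forall i, a i = b i.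
Proof.
elim: n a b => [|n IH] a b aD bD; first by move=> _ [].
have D0 : (0 < D)%N by apply: leq_ltn_trans (aD ord0).
have E (c : 'I_n.+1 -> nat) : (\sum_(i < n.+1) c i * D ^ i =
    (\sum_(i < n) c (lift ord0 i) * D ^ i) * D + c ord0)%N.
  rewrite big_ord_recl expn0 muln1 addnC big_distrl /=; congr (_ + _)%N.
  by apply: eq_bigr => i _; rewrite /bump /= add1n expnSr mulnA.
rewrite !E => e.
have e0 : a ord0 = b ord0.
  by have := congr1 (modn^~ D) e; rewrite !modnMDl !modn_small.
have eS : (\sum_(i < n) a (lift ord0 i) * D ^ i = \sum_(i < n) b (lift ord0 i) * D ^ i)%N.
  by move/eqP: e; rewrite e0 eqn_add2r eqn_pmul2r // => /eqP.
have h := IH _ _ (fun i => aD (lift ord0 i)) (fun i => bD (lift ord0 i)) eS.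
by move=> i; have [i' ->|->//] := unliftP ord0 i; exact: h.
Qed.

Lemma msupp_argmax n (P : mpol n) (w : multinom n -> nat) : P != 0 ->
  exists2 m, m \in msupp P & forall m', m' \in msupp P -> (w m' <= w m)%N.
Proof.
rewrite -msupp_eq0; elim: (msupp P) => [//|m s IH] _.
have [->|/IH[m0 m0s max]] := eqVneq s [::].
  by exists m; rewrite ?inE // => m'; rewrite inE => /eqP->.
have [le|lt] := leqP (w m) (w m0).
  by exists m0; rewrite ?inE ?m0s ?orbT // => m'; rewrite inE => /orP[/eqP->|/max].
exists m; rewrite ?inE ?eqxx // => m'; rewrite inE => /orP[/eqP->//|/max le].
by apply: leq_trans le _; exact: ltnW.
Qed.

(** Nagata's change of variables: given a relation P between the t i, weights
  in a base exceeding its degrees make one monomial dominate at the places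
  where t ord0 is infinite and all the t i - t ord0 ^ D ^ i are finite; so
  there is no such place. *)
Lemma nagata n (t : 'I_n.+1 -> K) (P : mpol n.+1) : P != 0 -> mmap j t P = 0 ->
  exists u : seq K, [/\ (size u <= n)%N, forall x, x \in u -> rgen F (lst t) x
    & forall i, ic (rgen F u) (t i)].
Proof.
move=> P0 eP.
have hF := subfield_range.
pose D := msize P; pose x := t ord0.
pose u := [seq t (lift ord0 i) - x ^+ (D ^ (lift ord0 i)) | i <- enum 'I_n].
have hR := subring_rgen F u.
have hI := subring_ic (rgen F u).
have um (i : 'I_n) : t (lift ord0 i) - x ^+ (D ^ (lift ord0 i)) \in u.
  by apply/mapP; exists i; rewrite ?mem_enum.
have Ix : ic (rgen F u) x.
  move=> V hV RV; apply: contrapT => nV.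
  have [mx x0] := notV_maxid hV nV.
  have FV : F `<=` V by move=> a Fa; apply: RV; exact: rgen_sub.
  pose y i := t i / x ^+ (D ^ i).
  have xi i : t i = y i * x ^+ (D ^ i) by rewrite /y divfK // expf_neq0.
  have y1 i : ~ maxid V (y i) /\ V (y i).
    have m1 : maxid V (y i - 1).
      rewrite /y; have [i' ->|->] := unliftP ord0 i; last first.
        by rewrite /= expn0 expr1 divff // subrr; exact: maxid0.
      have -> : t (lift ord0 i') / x ^+ (D ^ (lift ord0 i')) - 1 =
         (t (lift ord0 i') - x ^+ (D ^ (lift ord0 i'))) * x^-1 ^+ (D ^ (lift ord0 i')).
        by rewrite mulrBl exprVn divff // expf_neq0.
      apply: (maxidMl hV); first by apply: RV; apply: rgen_mem.
      apply: (maxid_expr hV mx); rewrite expn_gt0 /D lt0n msize_poly_eq0 P0 //.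
    have e : y i = 1 + (y i - 1) by rewrite addrC subrK.
    split; rewrite e; first exact: maxid_1D.
    by apply: (subringD hV.1); [exact: (subring1 hV.1)|exact: maxid_sub].
  have nX i a : ~ maxid V (y i ^+ a) /\ V (y i ^+ a).
    split; last by apply: (subringX hV.1); exact: (y1 i).2.
    by move=> /(maxidX hV (y1 i).2); exact: (y1 i).1.
  have ny (m : multinom n.+1) : ~ maxid V (mmap1 y m) /\ V (mmap1 y m).
    rewrite /mmap1; elim/big_ind: _ => //.
      by split; [exact: maxid1|exact: (subring1 hV.1)].
    move=> a b [na Va] [nb Vb]; split; last exact: (subringM hV.1).
    by move=> /(maxidM_prime hV Va Vb)[].
  pose W (m : multinom n.+1) := (\sum_(i < n.+1) m i * D ^ i)%N.
  have tW m : mmap1 t m = mmap1 y m * x ^+ W m.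
    rewrite /mmap1 /W expr_sum -big_split /=; apply: eq_bigr => i _.
    by rewrite xi exprMn -exprM mulnC.
  have [m0 m0P max] := msupp_argmax W P0.
  have Winj m : m \in msupp P -> W m = W m0 -> m = m0.
    move=> mP eW; apply/mnmP; apply: (digits_inj _ _ eW) => i.
      by apply: leq_ltn_trans (msize_mdeg_lt mP); rewrite mdegE (bigD1 i) //= leq_addr.
    by apply: leq_ltn_trans (msize_mdeg_lt m0P); rewrite mdegE (bigD1 i) //= leq_addr.
  have c0 : j P@_m0 != 0 by rewrite fmorph_eq0 -mcoeff_msupp.
  have Vj m : V (j P@_m) by apply: FV; exists P@_m.
  have : maxid V (j P@_m0 * mmap1 y m0).
    have : mmap j t P * x^-1 ^+ W m0 = 0 by rewrite eP mul0r.
    rewrite /mmap (bigD1_seq m0) //= ?msupp_uniq // mulrDl tW.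
    rewrite mulrA -mulrA -exprMn divff // expr1n mulr1 => /eqP.
    rewrite addr_eq0 => /eqP->; apply: (maxidN hV); rewrite mulr_suml.
    rewrite big_seq_cond; apply: (maxid_sum hV) => m /andP[mP mm].
    have lt : (W m < W m0)%N.
      rewrite ltn_neqAle max // andbT; apply: contraNneq mm => /(Winj _ mP)->.
      by rewrite eqxx.
    rewrite tW mulrA -mulrA [x ^+ _ * _](_ : _ = x^-1 ^+ (W m0 - W m)); last first.
      by rewrite mulrC -{2}[x]invrK mulfXV ?invr_eq0 // ltnW.
    apply: (maxidMl hV); last by apply: (maxid_expr hV mx); rewrite subn_gt0.
    by apply: (subringM hV.1) => //; exact: (ny m).2.
  move=> /(maxidM_prime hV (Vj _) (ny _).2)[|]; last exact: (ny m0).1.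
  apply: unit_maxid => //; apply: FV; apply: subfieldV => //; by exists P@_m0.
exists u; split.
- by rewrite size_map size_enum_ord.
- move=> w /mapP[i _ ->]; apply: (subringB (subring_rgen _ _)).
    by apply: rgen_mem; exact: mem_lst.
  by apply: (subringX (subring_rgen _ _)); apply: rgen_mem; exact: mem_lst.
- move=> i; have [i' ->|->//] := unliftP ord0 i.
  rewrite -[t _](subrK (x ^+ (D ^ (lift ord0 i')))); apply: (subringD hI).
    by apply: ic_sub; apply: rgen_mem; exact: um.
  exact: (subringX hI).
Qed.

(** As long as the generators satisfy a relation, the change of variables of nagata
  replaces them with fewer ones. *)
Theorem Noether (s : seq K) : exists ts, [/\ trl F ts,
  forall x, x \in ts -> rgen F s x & forall x, x \in s -> ic (rgen F ts) x].
Proof.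
have hF := subfield_range.
have [m] := ubnP (size s); elim: m s => // m IH s; rewrite ltnS => sm.
case: (pselect (trl F s)) => [trs|ntrs].
  by exists s; split=> // x xs; [exact: rgen_mem|apply: ic_sub; exact: rgen_mem].
have [t et] := lst_surj s.
have [P P0 eP] : exists2 P : mpol (size s), P != 0 & mmap j t P = 0.
  apply: contrapT => nP; apply: ntrs; rewrite -et; apply/trl_mmap => P eP.
  by apply: contrapT => /eqP P0; apply: nP; exists P.
case es: (size s) t et P P0 eP => [|n] t et P P0 eP.
  by case: ntrs; move/eqP: es; rewrite size_eq0 => /eqP->.
have [u [su us ut]] := nagata P0 eP.
have [ts [trts tsu uts]] := IH u (leq_ltn_trans su (leq_trans (eq_leq (esym es)) sm)).
rewrite et in us.
exists ts; split=> //.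
  move=> x /tsu; apply: rgen_min; [exact: subring_rgen|exact: rgen_sub|exact: us].
move=> x; rewrite -et => /lst_mem[i ->].
apply: (ic_min _ (ut i)); apply: rgen_min; [exact: subring_ic| |exact: uts].
by move=> a Fa; apply: ic_sub; exact: rgen_sub.
Qed.

End Eval.
End MpolyLink.

End MPoly.

(** * Values on finite-dimensional spaces *)

Section Span.
Context (K : fieldType).
Implicit Types (R S V E F L : set K) (p q : {poly K}) (s l : seq K).

Fixpoint span E l : set K :=
  if l is e :: l' then
    [set z | exists c w, [/\ E c, span E l' w & z = c * e + w]]
  else [set 0].

Section Subspaces.
Context (E : set K) (hE : subfield E).

Definition linear_subspace (N : set K) := [/\ N 0, forall a b, N a -> N b -> N (a + b)
  & forall c a, E c -> N a -> N (c * a)].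

Lemma span_sub N l : linear_subspace N -> (forall e, e \in l -> N e) -> span E l `<=` N.
Proof.
move=> [N0 ND NZ]; elim: l => [|e l IH] lN z /=; first by move=> ->.
move=> [c [w [Ec lw ->]]]; apply: (ND); last first.
  by apply: IH lw => x xl; apply: lN; rewrite inE xl orbT.
by apply: (NZ) => //; apply: lN; rewrite inE eqxx.
Qed.

Lemma span_subspace l : linear_subspace (span E l).
Proof.
elim: l => [|e l [IH0 IHD IHZ]] /=.
  by split=> [//|a b -> ->|c a _ ->]; rewrite ?addr0 ?mulr0.
split.
- by exists 0, 0; split=> //; [exact: (subring0 hE.1)|rewrite mul0r addr0].
- move=> _ _ [c [w [Ec lw ->]]] [c' [w' [Ec' lw' ->]]]; exists (c + c'), (w + w'); split.
  + exact: (subringD hE.1).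
  + exact: IHD.
  + by rewrite mulrDl addrACA.
- move=> d _ Ed [c [w [Ec lw ->]]]; exists (d * c), (d * w); split.
  + exact: (subringM hE.1).
  + exact: IHZ.
  + by rewrite mulrDr mulrA.
Qed.

Lemma spanW e l : span E l `<=` span E (e :: l).
Proof. by move=> w lw; exists 0, w; split=> //; [exact: (subring0 hE.1)|rewrite mul0r add0r]. Qed.

Lemma span_mem l e : e \in l -> span E l e.
Proof.
elim: l => [//|a l IH]; rewrite inE => /orP[/eqP->|/IH]; last exact: spanW.
exists 1, 0; split; [exact: (subring1 hE.1)| |by rewrite mul1r addr0].
by have [] := span_subspace l.
Qed.

Lemma spanS l l' : (forall e, e \in l -> span E l' e) -> span E l `<=` span E l'.
Proof. by move=> h; apply: span_sub => //; exact: span_subspace. Qed.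

Lemma span_sum (I : Type) (r : seq I) (P : pred I) (f : I -> K) l :
  (forall i, P i -> span E l (f i)) -> span E l (\sum_(i <- r | P i) f i).
Proof. by have [h0 hD _] := span_subspace l; move=> hf; elim/big_ind: _. Qed.

Lemma subspace_span N l : linear_subspace N -> exists l', span E l' = N `&` span E l.
Proof.
move=> hN; have [N0 ND NZ] := hN; elim: l => [|e l [m em]].
  by exists [::]; apply/seteqP; split=> [z /= ->|z [_ /=]].
case: (pselect (exists c w, [/\ E c, c != 0, span E l w & N (c * e + w)])) => [|nex].
  move=> [c [w [Ec c0 lw Nw]]]; exists ((c * e + w) :: m).
  apply/seteqP; split.
    move=> z [d [w' [Ed mw' ->]]].
    have [Nw' lw'] : (N `&` span E l) w' by rewrite -em.
    split.
      by apply: ND => //; exact: NZ.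
    have [_ hD hZ] := span_subspace l.
    exists (d * c), (d * w + w'); split; first exact: (subringM hE.1).
      by apply: hD => //; exact: hZ.
    by rewrite mulrDr mulrA addrA.
  move=> z [Nz [d [w' [Ed lw' ez]]]].
  exists (d / c), (z - d / c * (c * e + w)); split; last by rewrite addrC subrK.
    exact: subfield_div.
  have Edc : E (d / c) by exact: subfield_div.
  have EN : E (- (d / c)) by exact: (subringN hE.1).
  suff : (N `&` span E l) (z - d / c * (c * e + w)) by rewrite -em.
  split.
    by rewrite -mulNr; apply: ND => //; exact: NZ.
  have -> : z - d / c * (c * e + w) = w' + (- (d / c)) * w.
    by rewrite ez mulrDr mulrA divfK // mulNr opprD addrACA subrr add0r.
  have [_ hD hZ] := span_subspace l.
  by apply: hD => //; exact: hZ.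
exists m; rewrite em; apply/seteqP; split=> z [Nz]; first by split=> //; exact: spanW.
move=> [c [w [Ec lw ez]]]; split=> //.
have [c0|c0] := eqVneq c 0; first by rewrite ez c0 mul0r add0r.
by case: nex; exists c, w; rewrite -ez.
Qed.

Lemma span_trans L l l' : L `<=` span E l ->
  span L l' `<=` span E [seq a * b | a <- l, b <- l'].
Proof.
move=> Ll; elim: l' => [|b l' IH] z /=.
  by move=> ->; have [] := span_subspace [seq a * b | a <- l, b <- [::]].
move=> [c [w [/Ll lc /IH lw ->]]].
have [_ hD _] := span_subspace [seq a * b0 | a <- l, b0 <- b :: l'].
apply: hD; last first.
  move: lw; apply: spanS => e /allpairsPdep[x [y [xl yl ->]]].
  by apply: span_mem; apply/allpairsPdep; exists x, y; rewrite inE yl orbT.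
move: lc; apply: (@span_sub [set x | span E [seq a * b0 | a <- l, b0 <- b :: l'] (x * b)]).
  have [s0 sD sZ] := span_subspace [seq a * b0 | a <- l, b0 <- b :: l'].
  split=> /=; first by rewrite mul0r.
    by move=> x y hx hy; rewrite mulrDl; exact: sD.
  by move=> d x Ed hx; rewrite -mulrA; exact: sZ.
by move=> e el; apply: (span_mem (l := [seq a * b0 | a <- l, b0 <- b :: l']));
   apply: allpairs_f; rewrite // inE eqxx.
Qed.

End Subspaces.

(** By ic_inv the inverse of a is a polynomial in a. *)
Lemma subring_alg_field S F : subring S -> subfield F -> F `<=` S -> S `<=` ic F -> subfield S.
Proof.
move=> hS hF FS SF; split=> // a Sa.
have Ia : ic F a^-1 by apply: (subfieldV (subfield_ic hF)); exact: SF.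
have [->|[p Fp ->]] := ic_inv hF.1 Ia; first exact: subring0.
by rewrite invrK; apply: (pover_horner hS) => //; exact: poverS Fp.
Qed.

Lemma gen_span E s : subfield E -> (forall x, x \in s -> ic E x) ->
  exists l, gen E s `<=` span E l.
Proof.
move=> hE; elim: s => [|x s IH] sE.
  exists [:: 1]; rewrite gen_nil // => c Ec; exists c, 0.
  by split=> //; rewrite mulr1 addr0.
have [l hl] := IH (fun y ys => sE y (mem_behead (s := x :: s) ys)).
set L := gen E s in hl *; have hL : subfield L := subfield_gen E s.
have Ix : ic L x by apply: (icS (@gen_sub _ E s)); apply: sE; rewrite inE eqxx.
have [m [Lm mm mx]] := ic_eq hL.1 Ix.
exists [seq a * b | a <- l, b <- [seq x ^+ i | i <- iota 0 (size m)]].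
rewrite gen_cons; apply: subset_trans (span_trans hE hl).
have hR : subfield (radj L x).
  apply: (@subring_alg_field _ L) => //; first exact: (subring_radj x hL.1).
    exact: (radj_sub x hL.1).
  by apply: radj_min => //; [exact: subring_ic|exact: ic_sub].
apply: (@subset_trans _ (radj L x)).
  apply: gen_min => //; first exact: (radj_sub x hL.1).
  by move=> t; rewrite inE => /eqP->; exact: (radj_gen x hL.1).
move=> _ [p Lp ->].
have [q [r [Lq Lr -> lt_r]]] := monic_division hL.1 Lp Lm mm.
rewrite hornerD hornerM (eqP mx) mulr0 add0r horner_coef.
apply: (span_sum hL) => i _.
have [_ _ hZ] := span_subspace hL [seq x ^+ i | i <- iota 0 (size m)].
apply: hZ; first exact: Lr.
apply: (span_mem hL); apply/mapP; exists (i : nat) => //.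
by rewrite mem_iota add0n (ltn_trans (ltn_ord i)).
Qed.

Definition vunit V z := [/\ V z, V z^-1 & z != 0].
Section Vunit.
Context (V : set K) (hV : valring V).
Lemma vunit1 : vunit V 1.
Proof. by split; rewrite ?invr1 ?oner_neq0 //; exact: (subring1 hV.1). Qed.
Lemma vunitM a b : vunit V a -> vunit V b -> vunit V (a * b).
Proof.
move=> [? ? ?] [? ? ?]; split; [exact: (subringM hV.1)| |by rewrite mulf_neq0].
by rewrite invfM; exact: (subringM hV.1).
Qed.
Lemma vunitV a : vunit V a -> vunit V a^-1.
Proof. by move=> [? ? ?]; split; rewrite ?invrK ?invr_eq0. Qed.
Lemma vunitX a n : vunit V a -> vunit V (a ^+ n).
Proof. by move=> Va; elim: n => [|n IH]; [rewrite expr0; exact: vunit1|rewrite exprS; exact: vunitM]. Qed.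
Lemma vunit_maxid a : vunit V a <-> V a /\ ~ maxid V a.
Proof.
split=> [[Va Vai a0]|[Va /(maxidP Va)[]]]; last by split.
by split=> //; exact: unit_maxid.
Qed.
Lemma subfield_vunit F a : subfield F -> F `<=` V -> F a -> a != 0 -> vunit V a.
Proof. by move=> hF FV Fa a0; split=> //; apply: FV => //; exact: subfieldV. Qed.
Lemma vunit_trans a b c : b != 0 -> vunit V (a / b) -> vunit V (b / c) -> vunit V (a / c).
Proof. by move=> b0 ab bc; rewrite -(divfK b0 a) -mulrA; exact: vunitM. Qed.
End Vunit.

(** The nonzero elements of an n-dimensional space over E have at most n values
  modulo the values of E: two vectors with the same first coordinate and
  distinct values have a difference that takes the smaller value. *)
Lemma span_values V E l : valring V -> subfield E ->
  exists r : seq K, (forall e, e \in r -> span E l e /\ e != 0) /\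
    forall z, span E l z -> z != 0 -> exists e c, [/\ e \in r, E c, c != 0 & vunit V (z / (c * e))].
Proof.
move=> hV hE; elim: l => [|a l [r [hr1 hr2]]].
  by exists [::]; split=> // z /= ->; rewrite eqxx.
pose bad z := [/\ span E (a :: l) z, z != 0 &
  ~ exists e c, [/\ e \in r, E c, c != 0 & vunit V (z / (c * e))]].
case: (pselect (exists z, bad z)) => [[z0 [sz0 z00 bz0]]|nb]; last first.
  exists r; split=> [e /hr1[le e0]|z sz z0]; first by split=> //; exact: spanW.
  by apply: contrapT => nex; apply: nb; exists z.
exists (z0 :: r); split.
  by move=> e; rewrite inE => /orP[/eqP->//|/hr1[le e0]]; split=> //; exact: spanW.
move=> z sz zn0.
case: (pselect (exists e c, [/\ e \in r, E c, c != 0 & vunit V (z / (c * e))])).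
  by move=> [e [c [er Ec c0 u]]]; exists e, c; rewrite inE er orbT.
move=> bz.
have [c0 [w0 [Ec0 lw0 e0]]] := sz0; have [c [w [Ec lw e]]] := sz.
have c00 : c0 != 0.
  apply/eqP => c00; apply: bz0; apply: hr2 => //.
  by rewrite e0 c00 mul0r add0r.
have cn0 : c != 0.
  apply/eqP => cn0; apply: bz; apply: hr2 => //.
  by rewrite e cn0 mul0r add0r.
exists z0, (c / c0); rewrite inE eqxx /= mulf_neq0 ?invr_eq0 //.
split=> //; first exact: subfield_div.
(* the vectors y0 and y have a-coordinate 1 *)
pose y0 := z0 / c0; pose y := z / c.
have -> : z / (c / c0 * z0) = y / y0.
  by rewrite /y /y0 !invfM !invrK -!mulrA [c0 * _]mulrC.
have y00 : y0 != 0 by rewrite mulf_neq0 ?invr_eq0.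
have yn0 : y != 0 by rewrite mulf_neq0 ?invr_eq0.
have ld : span E l (y - y0).
  have -> : y - y0 = c^-1 * w + (- c0^-1) * w0.
    rewrite /y /y0 e e0 !mulrDl ![_ * a / _]mulrAC !divff // !mul1r opprD addrACA subrr add0r.
    by rewrite mulNr ![_^-1 * _]mulrC.
  have [_ hD hZ] := span_subspace hE l; apply: hD; apply: hZ => //.
    exact: subfieldV.
  by apply: (subringN hE.1); exact: subfieldV.
have nu u v (cu : E v) (v0 : v != 0) : ~ (exists e c, [/\ e \in r, E c, c != 0 & vunit V (u / (c * e))]) ->
    y - y0 != 0 -> ~ vunit V ((y - y0) / (u / v)).
  move=> nex yy0 /vunitV; rewrite invf_div => un; apply: nex.
  have [e' [c' [er Ec' c'0 u']]] := hr2 _ ld yy0.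
  exists e', (v * c'); rewrite mulf_neq0 //; split=> //; first exact: (subringM hE.1).
  have := vunit_trans hV yy0 un u'.
  by rewrite -mulrA -invfM mulrA.
have V1 := subring1 hV.1.
have [/eqP|yy0] := eqVneq (y - y0) 0.
  by rewrite subr_eq0 => /eqP->; rewrite divff //; exact: vunit1.
have m1 : ~ maxid V (y / y0).
  move=> my; apply: (nu _ _ Ec0 c00 bz0 yy0); apply/vunit_maxid => //.
  rewrite -/y0 mulrBl divff //; split.
    by apply: (subringB hV.1) => //; exact: maxid_sub.
  by move=> /(maxidB hV my); rewrite subKr; exact: maxid1.
have m2 : ~ maxid V (y0 / y).
  move=> my; apply: (nu _ _ Ec cn0 bz yy0); apply/vunit_maxid => //.
  rewrite -/y mulrBl divff //; split.
    by apply: (subringB hV.1) => //; exact: maxid_sub.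
  by move=> /(maxid_1D hV (maxidN hV my)).
have Vy : V (y / y0).
  by apply: contrapT => /(notV_maxid hV)[]; rewrite invf_div.
exact/vunit_maxid.
Qed.

End Span.

(** * Discreteness *)

Section Discrete.
Context (K : fieldType) (V F : set K) (y : K).
Context (hV : valring V) (hF : subfield F) (FV : F `<=` V).
Context (my : maxid V y) (y0 : y != 0).

Lemma vunit_expz a : vunit V (y ^ a) -> a = 0.
Proof.
case: a => n.
  case: n => // n; rewrite -exprnP => /vunit_maxid[_ []].
  exact: maxid_expr.
rewrite NegzE -exprnN => /vunitV; rewrite invrK => /vunit_maxid[_ []].
exact: maxid_expr.
Qed.

(** On F(y) the value is the order of vanishing at y = 0, as the nonzero constants
  are units of V. *)
Lemma adic_value e : gen F [:: y] e -> e != 0 -> exists a : int, vunit V (e * y ^ a).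
Proof.
rewrite -(frac_rgen _ hF.1) (rgen1 _ hF.1).
have poly p : pover F p -> p.[y] != 0 -> exists n, vunit V (p.[y] * y ^- n).
  elim/poly_ind: p => [|p c IH] Fp; first by rewrite horner0 eqxx.
  have [Fc Fp'] := pover_cons Fp.
  rewrite hornerD hornerMX hornerC; have [->|c0] := eqVneq c 0.
    rewrite addr0 => pn0; have /(IH Fp')[n u] : p.[y] != 0.
      by apply: contraNneq pn0 => ->; rewrite mul0r.
    by exists n.+1; rewrite exprS invfM mulrA mulfK.
  move=> _; exists 0%N; rewrite expr0 invr1 mulr1.
  have Vp : V p.[y].
    by apply: (pover_horner hV.1); [exact: poverS Fp'|exact: maxid_sub].
  have mpy : maxid V (p.[y] * y) by exact: maxidMl.
  apply/vunit_maxid => //; split.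
    by apply: (subringD hV.1); [exact: maxid_sub|exact: FV].
  rewrite addrC; apply: maxid_nD => //.
  by have /vunit_maxid[] := subfield_vunit hF FV Fc c0.
move=> [_ [_ [[p Fp ->] [q Fq ->] q0 ->]]] pq0.
have p0 : p.[y] != 0 by apply: contraNneq pq0 => ->; rewrite mul0r.
have [n un] := poly p Fp p0; have [m um] := poly q Fq q0.
exists (m%:Z - n%:Z).
have := vunitM hV un (vunitV um); congr vunit.
rewrite expfzDr // -exprnN -exprnP.
have yn0 : y ^+ n != 0 by exact: expf_neq0.
have ym0 : y ^+ m != 0 by exact: expf_neq0.
by field; rewrite ym0 yn0 q0.
Qed.

(** K is finite-dimensional over F(y); among the powers of z two have the same
  value modulo the values of F(y), which are multiples of the value of y. *)
Lemma ramification (xs : seq K) : (forall x, x \in xs -> ic (gen F [:: y]) x) ->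
  (forall z, gen (gen F [:: y]) xs z) ->
  exists2 M, (0 < M)%N & forall z, z != 0 -> exists a : int, vunit V (z ^+ M * y ^ a).
Proof.
move=> xsI Kxs; have hE := subfield_gen F [:: y].
have [l hl] := gen_span hE xsI.
have [r [_ hr]] := span_values l hV hE.
exists (size r)`!; first exact: fact_gt0.
move=> z z0.
have rep (i : 'I_(size r).+1) : exists n : 'I_(size r), exists c,
    [/\ gen F [:: y] c, c != 0 & vunit V (z ^+ i / (c * tnth (in_tuple r) n))].
  have [||e [c [er Ec c0 u]]] := hr (z ^+ i); [by apply: hl; exact: Kxs|exact: expf_neq0|].
  have /(tnthP (in_tuple r))[n en] : e \in in_tuple r by [].
  by exists n, c; rewrite -en.
have [f hf] := choice rep.
have [i [j [ltij eij]]] : exists i j : 'I_(size r).+1, (i < j)%N /\ f i = f j.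
  apply: contrapT => nex; have : injective f.
    move=> i j e; apply/val_inj/eqP; case: ltngtP => // lt; case: nex.
      by exists i, j.
    by exists j, i.
  by move/leq_card; rewrite !card_ord ltnn.
have [c [Ec c0 u]] := hf i; have [c' [Ec' c'0 u']] := hf j.
rewrite -eij in u'.
set e := tnth _ _ in u u'.
have e0 : e != 0 by have [_ _ ] := u; apply: contraNneq => ->; rewrite mulr0 invr0 mulr0.
have d0 : c' / c != 0 by rewrite mulf_neq0 ?invr_eq0.
have u1 : vunit V (z ^+ (j - i) / (c' / c)).
  have := vunitM hV u' (vunitV u).
  have zi0 : z ^+ i != 0 by exact: expf_neq0.
  congr vunit; rewrite -mulfXV ?(ltnW ltij) // exprVn.
  by field; rewrite zi0 c0 c'0 e0.
have [a ua] := adic_value (subfield_div hE Ec' Ec) d0.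
have u2 : vunit V (z ^+ (j - i) * y ^ a).
  have := vunitM hV u1 ua; congr vunit.
  by rewrite mulrA divfK.
have /dvdnP[q eq] : (j - i %| (size r)`!)%N.
  by apply: dvdn_fact; rewrite subn_gt0 ltij /= (leq_trans (leq_subr _ _)) // -ltnS.
exists (a * q%:Z); rewrite eq mulnC exprM -exprz_exp -exprnP -exprMn.
exact: vunitX.
Qed.

(** By ramification, z |-> a with z ^ M / y ^ a a unit is additive and detects V;
  divided by its least positive value it becomes a normalized valuation. *)
Theorem discrete_valring (xs : seq K) : (forall x, x \in xs -> ic (gen F [:: y]) x) ->
  (forall z, gen (gen F [:: y]) xs z) ->
  exists v : K -> int, [/\ forall a b, a != 0 -> b != 0 -> v (a * b) = v a + v b,
    forall z, z != 0 -> (V z <-> 0 <= v z) & exists2 z, z != 0 & v z = 1].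
Proof.
move=> xsI Kxs; have [M M0 hM] := ramification xsI Kxs.
have /choice[w hw] : forall z, exists a : int, z != 0 -> vunit V (z ^+ M * y ^ (- a)).
  move=> z; have [->|/hM[a u]] := eqVneq z 0; first by exists 0.
  by exists (- a); rewrite opprK.
have wM a b : a != 0 -> b != 0 -> w (a * b) = w a + w b.
  move=> a0 b0; apply/eqP; rewrite -subr_eq0; apply/eqP; apply: vunit_expz.
  have := vunitM hV (hw _ (mulf_neq0 a0 b0)) (vunitV (vunitM hV (hw _ a0) (hw _ b0))).
  move=> /vunitV; congr vunit; rewrite exprMn !(expfzDr, opprD, opprK) //.
  have aM : a ^+ M != 0 by exact: expf_neq0.
  have bM : b ^+ M != 0 by exact: expf_neq0.
  have ez c : y ^ c != 0 by exact: expfz_neq0.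
  rewrite -!invr_expz.
  by field; rewrite aM bM !ez.
have w_ge0 z : z != 0 -> (V z <-> 0 <= w z).
  move=> z0; have u := hw z z0.
  have zw : z ^+ M = z ^+ M * y ^ (- w z) * y ^ w z.
    by rewrite -mulrA -expfzDr // addNr expr0z mulr1.
  split=> [Vz|].
    rewrite leNgt; apply/negP => wn.
    have [n en] : exists n : nat, - w z = n.+1%:Z.
      by move: wn; case: (w z) => // n _; exists n; rewrite NegzE opprK.
    move: u => /vunit_maxid[_]; apply; apply: maxidMl => //; first exact: (subringX hV.1).
    by rewrite en -exprnP; exact: maxid_expr.
  move=> w0; apply: contrapT => /(notV_maxid hV)[mz _].
  have Vz : V (z ^+ M).
    rewrite zw; apply: (subringM hV.1); first by have [] := u.
    by move: w0; case: (w z) => // n _; rewrite -exprnP; apply: (subringX hV.1); exact: maxid_sub.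
  apply: (maxid1 hV); have := maxidMl hV Vz (maxid_expr hV mz M0).
  by rewrite -exprMn divff // expr1n.
have w1 : w 1 = 0.
  by apply: (addrI (w 1)); rewrite addr0 -wM ?oner_neq0 // mulr1.
have wV z : z != 0 -> w z^-1 = - w z.
  move=> z0; apply/eqP; rewrite -addr_eq0 -wM ?invr_eq0 //.
  by rewrite mulVf // w1.
have wy : 0 < w y.
  have wy0 : 0 <= w y by apply/(w_ge0 _ y0); exact: maxid_sub.
  rewrite lt_def wy0 andbT; apply/eqP => w0.
  have : vunit V (y ^+ M * y ^ (- 0)) by rewrite -w0; exact: hw.
  rewrite oppr0 expr0z mulr1 => /vunit_maxid[_]; apply; exact: maxid_expr.
have exn : exists n, `[< exists2 z, z != 0 & w z = n.+1%:Z >].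
  exists `|w y|.-1; apply/asboolP; exists y => //.
  by rewrite prednK ?absz_gt0 ?gt_eqF // gtz0_abs.
case: (ex_minnP exn) => g0 /asboolP[u u0 wu] min.
set g := g0.+1 in wu.
have dv z : z != 0 -> (w z %% g%:Z)%Z = 0.
  move=> z0; apply/eqP; apply: contraT => r0.
  have r_ge0 : 0 <= (w z %% g%:Z)%Z by exact: modz_ge0.
  have r_lt : (w z %% g%:Z)%Z < g%:Z by rewrite ltz_pmod.
  have wuX (n : int) : w (u ^ n) = n * g%:Z.
    have pos (m : nat) : w (u ^+ m) = m%:Z * g%:Z.
      elim: m => [|m IH]; first by rewrite expr0 w1 mul0r.
      by rewrite exprS wM ?expf_neq0 // IH wu intS mulrDl mul1r.
    case: n => n; first by rewrite -exprnP pos.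
    by rewrite NegzE -exprnN wV ?expf_neq0 // pos mulNr.
  have er : w (z * u ^ (- (w z %/ g%:Z)%Z)) = (w z %% g%:Z)%Z.
    rewrite wM ?expfz_neq0 // wuX mulNr {1}(divz_eq (w z) g%:Z).
    by rewrite addrAC subrr add0r.
  have rn : (w z %% g%:Z)%Z = (`|(w z %% g%:Z)%Z|%N.-1).+1%:Z.
    by rewrite prednK ?absz_gt0 // gez0_abs.
  have : (g0 <= `|(w z %% g%:Z)%Z|%N.-1)%N.
    apply: min; apply/asboolP; exists (z * u ^ (- (w z %/ g%:Z)%Z)).
      by rewrite mulf_neq0 // expfz_neq0.
    by rewrite er -rn.
  have N0 : (0 < `|(w z %% g%:Z)%Z|)%N by rewrite absz_gt0.
  move=> le; move: r_lt; rewrite -(gez0_abs r_ge0) ltz_nat ltnS => lt.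
  by have := leq_trans lt le; rewrite leqNgt ltn_predL N0.
exists (fun z => (w z %/ g%:Z)%Z); split.
- move=> a b a0 b0; rewrite wM //.
  have ea := divz_eq (w a) g%:Z; rewrite (dv _ a0) addr0 in ea.
  by rewrite ea divzMDl // mulzK.
- move=> z z0; rewrite w_ge0 //; have ea := divz_eq (w z) g%:Z; rewrite (dv _ z0) addr0 in ea.
  by rewrite {1}ea pmulr_lge0.
- by exists u => //; rewrite wu divzz.
Qed.

End Discrete.

(** * Valuations of divisorial type with a given centre *)

Section SubfieldType.
Context (K : fieldType).

(** A subfield as a type, for the theory of multivariate polynomials over it. *)
Record subfield_of := SubfieldOf { sf_set :> set K; sf_closed : subfield sf_set }.

Definition sf_pred (F : subfield_of) : {pred K} := fun x => `[< sf_set F x >].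

Lemma sf_divring F : divring_closed (sf_pred F).
Proof.
have hF := sf_closed F; split.
- by apply/asboolP; exact: (subring1 hF.1).
- by move=> a b /asboolP Fa /asboolP Fb; apply/asboolP; exact: (subringB hF.1).
- by move=> a b /asboolP Fa /asboolP Fb; apply/asboolP; exact: subfield_div.
Qed.
HB.instance Definition _ F := GRing.isDivringClosed.Build K (sf_pred F) (sf_divring F).

Record sf_type (F : subfield_of) := SfType { sf_val : K; _ : sf_val \in sf_pred F }.
HB.instance Definition _ F := [isSub for @sf_val F].
HB.instance Definition _ F := [Choice of sf_type F by <:].
HB.instance Definition _ F := [SubChoice_isSubIntegralDomain of sf_type F by <:].
HB.instance Definition _ F := [SubIntegralDomain_isSubField of sf_type F by <:].

Lemma range_sf_val F : range (\val : sf_type F -> K) = F.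
Proof.
apply/seteqP; split=> [_ [a _ <-]|a Fa]; first by have /asboolP := valP a.
have Fa' : a \in sf_pred F by apply/asboolP.
by exists (SfType Fa').
Qed.

Lemma Noether_subfield (F : set K) (s : seq K) : subfield F -> exists ts, [/\ trl F ts,
  forall x, x \in ts -> rgen F s x & forall x, x \in s -> ic (rgen F ts) x].
Proof.
move=> hF; have := MPoly.Noether (\val : {rmorphism sf_type (SubfieldOf hF) -> K}) s.
by rewrite range_sf_val.
Qed.

End SubfieldType.

Section Center.
Context (K : fieldType).
Implicit Types (R S V E F L k : set K) (p q : {poly K}) (s l : seq K).

(** A nonzero polynomial over F(b) takes at z a unit of V, hence can be inverted. *)
Lemma gen_transc F b z V : subfield F -> valring V -> gen F b `<=` V -> V z ->
  (forall p, pover (gen F b) p -> p != 0 -> ~ maxid V p.[z]) ->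
  gen F (z :: b) `<=` V /\ ~ ic (gen F b) z.
Proof.
move=> hF hV bV Vz h; split.
  rewrite gen_cons -(frac_rgen _ (subfield_gen _ _).1) (rgen1 _ (subfield_gen _ _).1).
  have Vp p : pover (gen F b) p -> V p.[z].
    by move=> bp; apply: (pover_horner hV.1) => //; exact: poverS bp.
  move=> _ [_ [_ [[p bp ->] [q bq ->] q0 ->]]].
  apply: (subringM hV.1); first exact: Vp.
  have qn0 : q != 0 by apply: contraNneq q0 => ->; rewrite horner0.
  by have [] := maxidP (Vp _ bq) (h _ bq qn0).
move=> /(ic_eq (subfield_gen _ _).1)[p [bp pm /eqP pz]].
by apply: (h p bp (monic_neq0 pm)); rewrite pz; exact: maxid0.
Qed.

(** A family of elements of V with independent residues that is as long as possible;
  its length is bounded by Steinitz's lemma. *)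
Lemma residue_basis k V s : subfield k -> valring V -> k `<=` V ->
  (forall z, gen k s z) ->
  exists b, [/\ trl k b, gen k b `<=` V & forall z, V z ->
    exists p, [/\ pover (gen k b) p, p != 0 & maxid V p.[z]]].
Proof.
move=> hk hV kV Ks.
pose P n := `[< exists b, [/\ size b = n, trl k b & gen k b `<=` V] >].
have exP : exists n, P n.
  by exists 0%N; apply/asboolP; exists [::]; rewrite gen_nil.
have bound n : P n -> (n <= size s)%N.
  move=> /asboolP[b [<- trb _]]; apply: (Steinitz hk trb) => u _.
  by apply: ic_sub; exact: Ks.
case: (ex_maxnP exP bound) => n /asboolP[b [sb trb bV]] max.
exists b; split=> // z Vz; apply: contrapT => nex.
have [|zV nz] := @gen_transc k b z V hk hV bV Vz.
  by move=> p bp p0 mp; apply: nex; exists p.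
have : (n.+1 <= n)%N by apply: max; apply/asboolP; exists (z :: b); rewrite /= sb.
by rewrite ltnn.
Qed.

(** Modulo finitely many elements G of the centre, F[s] is finite-dimensional: the
  generators have algebraic residues, hence equations modulo the centre. *)
Lemma center_reduction F V s : subfield F -> valring V -> rgen F s `<=` V ->
  (forall x, x \in s -> exists p, [/\ pover F p, p != 0 & maxid V p.[x]]) ->
  exists G l : seq K, (forall g, g \in G -> maxid V g) /\
    forall b, rgen F s b -> exists2 w, span F l w &
      forall V', valring V' -> rgen F s `<=` V' -> (forall g, g \in G -> maxid V' g) ->
        maxid V' (b - w).
Proof.
move=> hF hV; elim: s => [|x s IH] sV sp.
  exists [::], [:: 1]; split=> // b; rewrite (rgen_nil hF.1) => Fb; exists b.
    by exists b, 0; split=> //; rewrite mulr1 addr0.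
  by move=> V' _ _ _; rewrite subrr; exact: maxid0.
have sub : rgen F s `<=` rgen F (x :: s) by rewrite rgen_cons; exact: rgen_sub.
have [|y ys|G [l [Gm hl]]] := IH.
- exact: subset_trans sV.
- by apply: sp; rewrite inE ys orbT.
have [p0 [Fp0 p00 mp0]] := sp x (mem_head _ _).
pose p := (lead_coef p0)^-1 *: p0.
have Fl : F (lead_coef p0)^-1 by apply: subfieldV => //; rewrite lead_coefE; exact: Fp0.
have Fp : pover F p by exact: (poverZ hF.1).
have pm : p \is monic by rewrite monicE lead_coefZ mulVf // lead_coef_eq0.
have FV : F `<=` V by move=> a Fa; apply: sV; exact: rgen_sub.
exists (p.[x] :: G), [seq a * b | a <- l, b <- [seq x ^+ i | i <- iota 0 (size p)]]; split.
  move=> g; rewrite inE => /orP[/eqP->|/Gm//].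
  by rewrite /p hornerZ; apply: maxidMl => //; exact: FV.
have hR := subring_rgen F s.
move=> b; rewrite rgen_cons (rgen1 _ hR) => -[B RB ->].
have [q [r [Rq Rr -> lt_r]]] := monic_division hR RB (poverS (@rgen_sub _ F s) Fp) pm.
have /choice[w hw] : forall i, exists w, span F l w /\
      forall V', valring V' -> rgen F s `<=` V' -> (forall g, g \in G -> maxid V' g) ->
        maxid V' (r`_i - w).
  by move=> i; have [w lw h] := hl _ (Rr i); exists w.
exists (\sum_(i < size r) w i * x ^+ i).
  have hsp : subring (gen F s) := (subfield_gen F s).1.
  apply: (span_sum hF) => i _.
  have [_ _ hZ] := span_subspace hF l.
  apply: (@span_trans _ F hF (span F l) l [seq x ^+ i | i <- iota 0 (size p)]) => //.
  have xi : x ^+ i \in [seq x ^+ i | i <- iota 0 (size p)].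
    by apply/mapP; exists (i : nat) => //; rewrite mem_iota add0n (ltn_trans (ltn_ord i)).
  elim: [seq x ^+ i | i <- iota 0 (size p)] xi => [//|e m IHm]; rewrite inE => /orP[/eqP<-|/IHm h].
    exists (w i), 0; split; [exact: (hw i).1| |by rewrite addr0].
    elim: m {IHm} => [//|e' m IHm]; exists 0, 0; split=> //; last by rewrite mul0r addr0.
    by have [] := span_subspace hF l.
  exists 0, (w i * x ^+ i); split=> //; last by rewrite mul0r add0r.
  by have [] := span_subspace hF l.
move=> V' hV' RV' GV'.
have RV2 : rgen F s `<=` V' by move=> a /sub; rewrite rgen_cons rgen1 //; exact: RV'.
have Vx : V' x by apply: RV'; exact: radj_gen.
have -> : (q * p + r).[x] - \sum_(i < size r) w i * x ^+ i =
    q.[x] * p.[x] + \sum_(i < size r) (r`_i - w i) * x ^+ i.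
  rewrite hornerD hornerM -addrA; congr (_ + _).
  rewrite horner_coef -sumrB; apply: eq_bigr => i _; by rewrite mulrBl.
apply: maxidD => //.
  apply: maxidMl => //; last by apply: GV'; rewrite inE eqxx.
  by apply: (pover_horner hV'.1) => //; exact: poverS Rq.
apply: maxid_sum => // i _; apply: maxidMr => //; first exact: (subringX hV'.1).
by apply: (hw i).2 => // g gG; apply: GV'; rewrite inE gG orbT.
Qed.

(** The equation of the residue of z is divided by z until its constant term c is
  not zero. *)
Lemma residue_alg_unit F V p z : subfield F -> valring V -> F `<=` V -> V z ->
  ~ maxid V z -> pover F p -> p != 0 -> maxid V p.[z] ->
  exists q c, [/\ pover F q, F c, c != 0 & maxid V (q.[z] * z + c)].
Proof.
move=> hF hV FV Vz nz; elim/poly_ind: p => [|p c IH] Fp; first by rewrite eqxx.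
move=> pc0 mp.
have [Fc Fp'] := pover_cons Fp.
have [c0|c0] := eqVneq c 0; last first.
  by exists p, c; split=> //; rewrite hornerD hornerMX hornerC in mp.
rewrite c0 addr0 in pc0 mp.
apply: IH => //; first by apply: contra_neq pc0 => ->; rewrite mul0r.
rewrite hornerMX in mp.
have Vp : V p.[z] by apply: (pover_horner hV.1) => //; exact: poverS Fp'.
by have [] := maxidM_prime hV Vp Vz mp.
Qed.

(** Valuations of divisorial type are dense around any place V0 of the function
  field K, with the same centre: finitely many elements Y of V0 are regular at
  some V, on k[Y] the two centres coincide, and V dominates the local ring at
  y = 0 of a curve over the field generated by all but one of the members of a
  transcendence basis.

  Over the field generated by a residual transcendence basis of V0 the centre
  of V0 on k[Y] is a maximal ideal; finitely many elements G of the centre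
  control it.  Adding to Y the quotients of G by its element y of least value
  makes the centre principal up to radical, and y is not invertible in the
  enlarged ring.  Noether normalization and not_ic_codim1 then give V. *)
Theorem divisorial_center k V0 Y f : subfield k -> infinite_pred k -> valring V0 ->
  k `<=` V0 -> (forall z, gen k Y z) -> (forall z, z \in Y -> V0 z) ->
  maxid V0 f -> f != 0 ->
  exists V s y, [/\ valring V, (forall z, z \in Y -> V z),
    forall z, rgen k Y z -> (maxid V z <-> maxid V0 z) &
    [/\ gen k s `<=` V, trl k s, maxid V y, y != 0 &
    forall z, ic (gen k (y :: s)) z]].
Proof.
move=> hk kinf hV0 kV0 KY YV0 mf f0.
have [b [trb bV0 res]] := residue_basis hk hV0 kV0 KY.
set k' := gen k b in bV0 res.
have hk' : subfield k' := subfield_gen k b.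
have k'Y0 : rgen k' Y `<=` V0 by apply: rgen_min => //; exact: hV0.1.
have [G [l [Gm hl]]] := center_reduction hk' hV0 k'Y0 (fun x xY => res x (YV0 x xY)).
have msub : linear_subspace k' (maxid V0).
  split; [exact: maxid0|exact: maxidD|].
  by move=> c a /bV0 Vc ma; exact: maxidMl.
have [l2 hl2] := subspace_span hk' l msub.
have l2m g : g \in l2 -> maxid V0 g.
  by move=> /(span_mem hk'); rewrite hl2 => -[].
pose G' := f :: G ++ l2.
have G'm g : g \in G' -> maxid V0 g.
  by rewrite inE mem_cat => /or3P[/eqP->|/Gm|/l2m].
have [|i0 [i0n y0 ymin]] := @first_dominant _ V0 (fun i => G'`_i) (size G') hV0.
  by exists 0%N.
set y := G'`_i0 in y0 ymin.
have my : maxid V0 y by apply: G'm; exact: mem_nth.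
pose Y' := Y ++ y :: [seq g / y | g <- G'].
have Y'V0 z : z \in Y' -> V0 z.
  rewrite mem_cat inE => /or3P[/YV0//|/eqP->|/mapP[g gG ->]]; first exact: maxid_sub.
  by have := ymin (index g G'); rewrite index_mem nth_index // => /(_ gG)[].
have nIz : ~ rgen k' Y' y^-1.
  move=> Ry; apply: (unit_maxid y0 _ my).
  by apply: (rgen_min hV0.1 _ _ Ry).
have hY' := subring_rgen k' Y'.
have Y'y : rgen k' Y' y by apply: rgen_mem; rewrite mem_cat inE eqxx orbT.
have [ts [trts tsY Yts]] := Noether_subfield Y' hk'.
have RI : rgen k' Y' `<=` ic (rgen k' ts).
  by apply: rgen_min => //; [exact: subring_ic|move=> a ka; apply: ic_sub; exact: rgen_sub].
have nIts : ~ ic (rgen k' ts) y^-1.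
  move=> Iy; have : ic (rgen k' Y') y^-1.
    by apply: icS Iy; apply: rgen_min => //; exact: rgen_sub.
  move=> /(ic_inv hY')[/eqP|[p Rp e]]; first by rewrite invr_eq0 (negPf y0).
  by apply: nIz; rewrite e; apply: (pover_horner hY') => //; rewrite invrK.
have Kts z : ic (gen k' ts) z.
  have : gen k Y z by [].
  apply: gen_ic; [exact: subfield_gen|by move=> a ka; apply: ic_sub; do 2 apply: gen_sub|].
  move=> t tY; apply: (icS (@rgen_gen _ k' ts)); apply: Yts.
  by rewrite mem_cat tY.
have k'inf : infinite_pred k'.
  by move=> m; have [c kc cm] := kinf m; exists c => //; exact: gen_sub.
have [t [s [st ets rts trs nIt]]] := not_ic_codim1 hk' k'inf trts (Kts _) nIts.
have [V [hV RV nV]] : exists V, [/\ valring V, rgen (gen k' s) [:: t] `<=` V & ~ V y^-1].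
  apply: contrapT => nex; apply: nIt => V hV RV; apply: contrapT => nV.
  by apply: nex; exists V.
have Y'V : rgen k' Y' `<=` V.
  by move=> a /RI; apply => //; exact: subset_trans rts RV.
have [mVy _] : maxid V y /\ y^-1 != 0 by have := notV_maxid hV nV; rewrite invrK.
have sV : gen k' s `<=` V by apply: subset_trans RV; exact: rgen_sub.
have k'V : k' `<=` V by apply: subset_trans sV; exact: gen_sub.
have G'V g : g \in G' -> maxid V g.
  move=> gG; rewrite -(divfK y0 g); apply: maxidMl => //; apply: Y'V.
  apply: rgen_mem; rewrite mem_cat inE; apply/or3P/Or33.
  by apply/mapP; exists g.
have k'YV : rgen k' Y `<=` V.
  apply: subset_trans Y'V; apply: rgenS; first exact: rgen_sub.
  by move=> a aY; apply: rgen_mem; rewrite mem_cat aY.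
have fwd z : rgen k' Y z -> maxid V0 z -> maxid V z.
  move=> Rz mz; have [w lw hw] := hl z Rz.
  have m0w : maxid V0 w.
    have := hw V0 hV0 k'Y0 Gm; move=> /(maxidB hV0 mz).
    by rewrite subKr.
  have : span k' l2 w by rewrite hl2.
  have lmV : span k' l2 `<=` maxid V.
    apply: span_sub.
      split; [exact: maxid0|exact: maxidD|].
      by move=> c a /k'V Vc ma; exact: maxidMl.
    by move=> g gl; apply: G'V; rewrite inE mem_cat gl !orbT.
  move=> /lmV mw; rewrite -(subrK w z); apply: maxidD => //.
  by apply: hw => // g gG; apply: G'V; rewrite inE mem_cat gG orbT.
have kYk' : rgen k Y `<=` rgen k' Y.
  by apply: rgenS; [move=> a ka; apply: rgen_sub; exact: gen_sub|exact: rgen_mem].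
have hkY := subring_rgen k' Y.
exists V, (s ++ b), y; split=> //.
- by move=> z zY; apply: k'YV; exact: rgen_mem.
- move=> z /kYk' Rz; split=> [mz|]; last exact: fwd.
  apply: contrapT => nz.
  have V0z : V0 z by exact: k'Y0.
  have [p [k'p p0 mp]] := res z V0z.
  have [q [c [k'q k'c c0 mqc]]] := residue_alg_unit hk' hV0 bV0 V0z nz k'p p0 mp.
  have Rq : rgen k' Y q.[z].
    by apply: (pover_horner hkY) => //; apply: poverS k'q; exact: rgen_sub.
  have mV : maxid V (q.[z] * z + c).
    apply: fwd => //; apply: (subringD hkY); [exact: (subringM hkY)|exact: rgen_sub].
  have mc : maxid V c.
    rewrite -(addrK (q.[z] * z) c) addrC [c + _]addrC addrC; apply: maxidB => //.
    by apply: maxidMl => //; exact: k'YV.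
  by move/eqP: c0; apply; exact: (subfield_maxid hk' k'V k'c mc).
- rewrite gen_cat -/k'; split=> //.
  + by apply/trl_cat => //; split=> //; case: trs.
  move=> z; have : ic (gen k' ts) z by [].
  rewrite -cat_cons gen_cat -/k' => Iz.
  apply: (ic_min _ Iz); rewrite ets; apply: gen_ic.
  - exact: subfield_gen.
  - by move=> a ka; apply: ic_sub; exact: gen_sub.
  have hs := subfield_gen k' s.
  move=> u; rewrite inE => /orP[/eqP->|us]; last first.
    by apply: ic_sub; apply: gen_mem; rewrite inE us orbT.
  rewrite gen_cons; apply: exchange => //.
    by rewrite -gen_cons -ets; exact: Kts.
  move=> /(ic_eq hs.1)[p [sp pm py]].
  by move/eqP: y0; apply; exact: (alg_maxid hV hs sV sp (monic_neq0 pm) py mVy).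
Qed.

End Center.

(** * Residue fields *)

Section ResidueField.
Local Open Scope quotient_scope.
Context (K : fieldType).

Record valring_of := ValringOf { vr_set :> set K; vr_closed : valring vr_set }.

Definition vr_pred (V : valring_of) : {pred K} := fun x => `[< vr_set V x >].

Lemma vr_subring V : subring_closed (vr_pred V).
Proof.
have hV := (vr_closed V).1; split.
- by apply/asboolP; exact: (subring1 hV).
- by move=> a b /asboolP Va /asboolP Vb; apply/asboolP; exact: (subringB hV).
- by move=> a b /asboolP Va /asboolP Vb; apply/asboolP; exact: (subringM hV).
Qed.
HB.instance Definition _ V := GRing.isSubringClosed.Build K (vr_pred V) (vr_subring V).

Record vr_type (V : valring_of) := VrType { vr_val : K; _ : vr_val \in vr_pred V }.
HB.instance Definition _ V := [isSub for @vr_val V].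
HB.instance Definition _ V := [Choice of vr_type V by <:].
HB.instance Definition _ V := [SubChoice_isSubComNzRing of vr_type V by <:].

Definition vr_max (V : valring_of) : {pred vr_type V} :=
  fun a => `[< maxid V (\val a) >].
Arguments vr_max V : clear implicits.

Lemma vr_max_ideal V : idealr_closed (vr_max V).
Proof.
have hV := vr_closed V; split.
- by apply/asboolP; exact: maxid0.
- by apply/asboolP; exact: maxid1.
- move=> a u v /asboolP mu /asboolP mv; apply/asboolP.
  by apply: maxidD => //; apply: maxidMl => //; have /asboolP := valP a.
Qed.
HB.instance Definition _ V := isIdealr.Build (vr_type V) (vr_max V) (vr_max_ideal V).

Local Notation residue V := {ideal_quot (vr_max V)}.

Lemma residue_unit V (x : residue V) : x != 0 -> exists y, y * x = 1.
Proof.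
have hV := vr_closed V.
rewrite -[x]reprK; move: (repr x) => a a0.
have Va : vr_set V (\val a) by have /asboolP := valP a.
have na : ~ maxid V (\val a).
  move=> ma; case/eqP: a0; apply/eqP.
  rewrite -[0 in X in _ == X](rmorph0 (\pi_(residue V))) -Quotient.idealrBE subr0.
  exact/asboolP.
have [Vai a0'] := maxidP Va na.
have Vai' : (\val a)^-1 \in vr_pred V by apply/asboolP.
exists (\pi_(residue V) (VrType Vai')); rewrite -rmorphM /=.
rewrite [_ * _](_ : _ = 1) ?rmorph1 //.
by apply: val_inj; rewrite /= mulVf.
Qed.

Definition residue_inv V (x : residue V) : residue V :=
  if pselect (exists y, y * x = 1) is left h then projT1 (cid h) else 0.

Lemma residue_mulVf V (x : residue V) : x != 0 -> residue_inv x * x = 1.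
Proof. by move=> /residue_unit h; rewrite /residue_inv; case: pselect => // h'; case: cid. Qed.

Lemma residue_invr0 V : residue_inv (0 : residue V) = 0.
Proof.
rewrite /residue_inv; case: pselect => // h; exfalso; case: h => y; rewrite mulr0 => /esym/eqP.
by rewrite oner_eq0.
Qed.
HB.instance Definition _ V := GRing.ComNzRing_isField.Build (residue V)
  (@residue_mulVf V) (@residue_invr0 V).

Definition residue_hom (V : set K) (L : fieldType) (p : K -> L) : Prop :=
  [/\ p 1 = 1, forall z w, V z -> V w -> p (z + w) = p z + p w,
      forall z w, V z -> V w -> p (z * w) = p z * p w,
      forall y, exists2 z, V z & p z = y & forall z, V z -> p z = 0 <-> maxid V z].

Lemma residue_field_exists (V : set K) : valring V ->
  exists (L : fieldType) (p : K -> L), residue_hom V p.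
Proof.
move=> hV; pose W := ValringOf hV.
pose p z : residue W :=
  if pselect (z \in vr_pred W) is left h then \pi_(residue W) (VrType h) else 0.
have pE z (h : z \in vr_pred W) : p z = \pi_(residue W) (VrType h).
  by rewrite /p; case: pselect => // h'; congr (\pi_(residue W) _); exact: val_inj.
have inW z : V z -> z \in vr_pred W by move=> Vz; apply/asboolP.
exists (residue W), p; split.
- have h1 := inW _ (subring1 hV.1); rewrite (pE _ h1) -(rmorph1 (\pi_(residue W))).
  by congr (\pi_(residue W) _); exact: val_inj.
- move=> z w /inW hz /inW hw.
  have hzw : z + w \in vr_pred W by rewrite rpredD.
  rewrite (pE _ hz) (pE _ hw) (pE _ hzw) -rmorphD; congr (\pi_(residue W) _); exact: val_inj.
- move=> z w /inW hz /inW hw.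
  have hzw : z * w \in vr_pred W by rewrite rpredM.
  rewrite (pE _ hz) (pE _ hw) (pE _ hzw) -rmorphM; congr (\pi_(residue W) _); exact: val_inj.
- move=> y; have Vy : V (\val (repr y)) by have /asboolP := valP (repr y).
  exists (\val (repr y)) => //; rewrite (pE _ (inW _ Vy)) -[RHS]reprK.
  by congr (\pi_(residue W) _); exact: val_inj.
- move=> z /inW hz; rewrite (pE _ hz).
  have e : (\pi_(residue W) (VrType hz) == 0) = (VrType hz \in vr_max W).
    by rewrite -[0 in LHS](rmorph0 (\pi_(residue W))) -Quotient.idealrBE subr0.
  split=> [/eqP|mz]; first by rewrite e => /asboolP.
  by apply/eqP; rewrite e; apply/asboolP.
Qed.

End ResidueField.

(** * Dimension and transcendence degree *)

Module MPolyResidue.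
From mathcomp Require Import mpoly.
Import MPoly.

Section Transcendence.
Context (k K : fieldType) (j : {rmorphism k -> K}).
Let F : set K := range j.
Local Notation mpol n := {mpoly k[n]}.

(** The residue map, a homomorphism on V only, is tracked by a relation along the
  sums and products that define mmap. *)
Lemma residue_mmap (V : set K) (L : fieldType) (p : K -> L) n (t : 'I_n -> K) (P : mpol n) :
  subring V -> F `<=` V -> (forall i, V (t i)) -> p 0 = 0 -> p 1 = 1 ->
  (forall z w, V z -> V w -> p (z + w) = p z + p w) ->
  (forall z w, V z -> V w -> p (z * w) = p z * p w) ->
  p (mmap j t P) = mmap (p \o j) (p \o t) P.
Proof.
move=> hV FV Vt p0 p1 pD pM.
have Vj c : V (j c) by apply: FV; exists c.
pose rel (a : K) (b : L) := V a /\ p a = b.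
have relM a b a' b' : rel a b -> rel a' b' -> rel (a * a') (b * b').
  by move=> [Va <-] [Va' <-]; split; [exact: (subringM hV)|rewrite pM].
have relX i a : rel (t i ^+ a) (p (t i) ^+ a).
  elim: a => [|a IH]; first by rewrite !expr0; split=> //; exact: (subring1 hV).
  by rewrite !exprS; apply: relM.
suff [] : rel (mmap j t P) (mmap (p \o j) (p \o t) P) by [].
rewrite /mmap; elim/big_ind2: _ => [|a b a' b' [Va <-] [Va' <-]|m _].
- by split=> //; exact: (subring0 hV).
- by split; [exact: (subringD hV)|rewrite pD].
- apply: (relM); first by split.
  rewrite /mmap1; elim/big_ind2: _ => [|*|i _]; [by split=> //; exact: (subring1 hV)|exact: relM|].
  exact: relX.
Qed.

(** The residue field of V has transcendence degree one less than K: a family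
  of units of V with independent residues is independent, and stays so when an
  element of the maximal ideal is added. *)
Theorem residue_transcendence (V : set K) (s : seq K) (y : K) (L : fieldType) (p : K -> L) :
  valring V -> gen F s `<=` V -> trl F s -> maxid V y -> y != 0 ->
  (forall z, ic (gen F (y :: s)) z) ->
  residue_hom V p ->
  transcendence_degree (p \o j) (size s).
Proof.
move=> hV sV trs my y0 Ky [p1 pD pM psurj pK].
have hF := subfield_range j.
have FV : F `<=` V by apply: subset_trans sV; exact: gen_sub.
have p0 : p 0 = 0 by apply/pK; [exact: (subring0 hV.1)|exact: maxid0].
have mV n (t : 'I_n -> K) (P : mpol n) : (forall i, V (t i)) -> V (mmap j t P).
  move=> Vt; have : rgen F (lst t) (mmap j t P) by exact: mmap_rgen.
  apply: rgen_min; [exact: hV.1|exact: FV|].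
  by move=> w /lst_mem[i ->].
have pinj n (t : 'I_n -> K) : (forall i, V (t i)) ->
    (forall P : mpol n, maxid V (mmap j t P) -> P = 0) ->
    algebraically_independent (p \o j) (p \o t).
  move=> Vt inj P Q; rewrite -!(residue_mmap _ hV.1) // => e.
  apply/eqP; rewrite -subr_eq0; apply/eqP/inj; rewrite rmorphB /=.
  apply/pK; first by apply: (subringB hV.1); exact: mV.
  apply: (addIr (p (mmap j t Q))); rewrite -pD ?subrK ?e ?add0r //.
    by apply: (subringB hV.1); exact: mV.
  exact: mV.
split.
  have [t et] := lst_surj s.
  have Vt i : V (t i).
    by apply: sV; apply: gen_mem; rewrite -et; exact: mem_lst.
  exists (p \o t); apply: pinj => // P mP.
  have trt : trl F (lst t) by rewrite et.
  apply: ((trl_mmap j t).1 trt).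
  apply: (subfield_maxid (subfield_gen F s) sV _ mP).
  have sub : rgen F (lst t) `<=` gen F s by rewrite et; exact: rgen_gen.
  by apply: sub; exact: mmap_rgen.
move=> [t' ind].
have /choice[t ht] : forall i, exists z, V z /\ p z = t' i.
  by move=> i; have [z Vz e] := psurj (t' i); exists z.
have Vt i : V (t i) by exact: (ht i).1.
have et' : t' = p \o t by apply: funext => i; rewrite /= (ht i).2.
have inj (P : mpol (size s).+1) : maxid V (mmap j t P) -> P = 0.
  move=> /(pK _ (mV _ _ _ Vt)); rewrite (residue_mmap _ hV.1) // -et' => e.
  apply: ind; rewrite e /mmap msupp0 big_nil //.
have trt : trl F (lst t).
  by apply/trl_mmap => P e; apply: inj; rewrite e; exact: maxid0.
have genV : gen F (lst t) `<=` V.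
  rewrite -(frac_rgen _ hF.1) => _ [_ [_ [/rgen_mmap[P ->] /rgen_mmap[Q ->] Q0 ->]]].
  apply: (subringM hV.1); first exact: mV.
  have [] // := maxidP (mV _ _ Q Vt).
  by move=> /inj e; case/eqP: Q0; rewrite e rmorph0.
have : (size (y :: lst t) <= size (y :: s))%N.
  apply: (Steinitz hF); last by move=> u _; exact: Ky.
  split=> // /(ic_eq (subfield_gen _ _).1)[q [gq qm qy]].
  move/eqP: y0; apply.
  exact: (alg_maxid hV (subfield_gen _ _) genV gq (monic_neq0 qm) qy my).
by rewrite /= size_lst ltnn.
Qed.

(** A relation modulo Q with a nonzero constant term, seen as a polynomial in the
  element of Q', would give a relation modulo Q'; otherwise that element, which
  is outside the prime Q, divides it. *)
Lemma indep_prime (B Q Q' : set K) n (t : 'I_n.+1 -> K) : subring B -> F `<=` B ->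
  Q `<=` Q' -> (forall a b, Q' a -> Q' b -> Q' (a - b)) -> (forall a b, B a -> Q' b -> Q' (a * b)) ->
  (forall a b, B a -> B b -> Q (a * b) -> Q a \/ Q b) ->
  (forall i, B (front t i)) -> (forall P : mpol n, Q' (mmap j (front t) P) -> P = 0) ->
  B (t ord_max) -> Q' (t ord_max) -> ~ Q (t ord_max) ->
  forall P : mpol n.+1, Q (mmap j t P) -> P = 0.
Proof.
move=> hB FB QQ QB QM Qp Bt ind By Q'y nQy P; rewrite mmap_muni => h.
apply: muni_eq0; apply: contrapT => /eqP.
have mB (p : mpol n) : B (mmap j (front t) p).
  have : rgen F (lst (front t)) (mmap j (front t) p) by exact: mmap_rgen.
  by apply: rgen_min => // w /lst_mem[i ->].
have pB (U : {poly mpol n}) : B (map_poly (mmap j (front t)) U).[t ord_max].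
  by apply: (pover_horner hB) => // i; rewrite coef_map; exact: mB.
move: h; elim/poly_ind: (muni P) => [|U c IH]; first by rewrite eqxx.
rewrite rmorphD rmorphM /= map_polyX map_polyC /= hornerD hornerMX hornerC => h U0.
have [c0|c0] := eqVneq c 0; last first.
  case/eqP: c0; apply: ind.
  rewrite -[mmap _ _ _](addrK ((map_poly (mmap j (front t)) U).[t ord_max] * t ord_max)).
  apply: QB; last exact: QM.
  by apply: QQ; rewrite addrC.
rewrite c0 rmorph0 addr0 in h; rewrite c0 polyC0 addr0 in U0.
case: (Qp _ _ (pB U) By h) => [/IH|//]; apply.
by apply/eqP => e; rewrite e mul0r eqxx in U0.
Qed.

(** Dimension is at most the transcendence degree: along a strictly decreasing
  chain of primes, elements of the successive differences are independent. *)
Theorem prime_chain_bound (B : set K) (Q : nat -> set K) l s : subring B -> F `<=` B ->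
  (forall z, ic (gen F s) z) ->
  (forall i, (i <= l)%N -> [/\ Q i `<=` B, Q i 0, ~ Q i 1,
    forall a b, Q i a -> Q i b -> Q i (a - b) & forall a b, B a -> Q i b -> Q i (a * b)] /\
    (forall a b, B a -> B b -> Q i (a * b) -> Q i a \/ Q i b)) ->
  (forall i, (i < l)%N -> Q i.+1 `<` Q i) ->
  (l <= size s)%N.
Proof.
move=> hB FB Ks hQ ltQ.
have hF := subfield_range j.
suff H i : (i <= l)%N -> exists t : 'I_i -> K, (forall x, B (t x)) /\
    forall P : mpol i, Q i (mmap j t P) -> P = 0.
  have [t [Bt indt]] := H l (leqnn l).
  rewrite -(size_lst t); apply: (Steinitz hF); last by move=> u _; exact: Ks.
  apply/trl_mmap => P e; apply: indt; rewrite e.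
  by have [[]] := hQ l (leqnn l).
elim: i => [_|i IH ltil].
  exists (fun _ => 0); split=> [[]//|P QP]; apply/mpolyP => m; rewrite mcoeff0.
  have E (m' : multinom 0) : m' = mnm0 by apply/mnmP => -[].
  apply: contrapT => /eqP c0.
  have eP : mmap j (fun _ : 'I_0 => 0) P = j P@_m.
    have {1}-> : P = mpolyC 0 P@_m.
      by apply/mpolyP => m'; rewrite (E m') (E m) mcoeffC eqxx mulr1.
    by rewrite mmapC.
  have [[_ _ Q1 _ QM] _] := hQ 0%N (leq0n l).
  apply: Q1; rewrite -(mulVf (_ : j P@_m != 0)); last by rewrite fmorph_eq0.
  apply: QM; last by rewrite -eP.
  by apply: FB; rewrite -fmorphV; exists (P@_m)^-1.
have [t [Bt indt]] := IH (ltnW ltil).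
have [sub [y [Qy nQy]]] : Q i.+1 `<=` Q i /\ exists y, Q i y /\ ~ Q i.+1 y.
  have [sub nsub] := ltQ i ltil; split=> //.
  by apply: contrapT => nex; apply: nsub => y Qy; apply: contrapT => nQ; apply: nex; exists y.
have [[QiB _ _ QiD QiM] _] := hQ i (ltnW ltil).
have [_ Qp] := hQ i.+1 ltil.
pose t' (x : 'I_i.+1) := oapp t y (unlift ord_max x).
have ft : front t' = t.
  apply: funext => x; rewrite /front /t'.
  have -> : widen_ord (leqnSn i) x = lift ord_max x.
    by apply: val_inj; rewrite /= /bump leqNgt ltn_ord.
  by rewrite liftK.
have et : t' ord_max = y by rewrite /t' unlift_none.
exists t'; split.
  by move=> x; rewrite /t'; case: unliftP => [x' _|_] /=; [exact: Bt|exact: QiB].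
by apply: (@indep_prime B (Q i.+1) (Q i)) => //; rewrite ?et ?ft //; exact: QiB.
Qed.

End Transcendence.
End MPolyResidue.

Section Chains.
Context (K : fieldType).
Implicit Types (V F k : set K) (s : seq K).

(** The place t = 0 of the subfield F(t) of the residue field of V, extended to
  that residue field and composed with the place V. *)
Lemma valring_refine F t V : subfield F -> valring V -> gen F [:: t] `<=` V ->
  ~ ic F t -> exists V', [/\ valring V', F `<=` V', maxid V' t & maxid V `<=` maxid V'].
Proof.
move=> hF hV tV nt.
have hR := subring_radj t hF.1.
have Rg : radj F t `<=` gen F [:: t] by rewrite -(rgen1 _ hF.1); exact: rgen_gen.
have RV : radj F t `<=` V by move=> a /Rg/tV.
pose S := [set z | exists w m, [/\ radj F t w, maxid V m & z = w + m]].
pose J := [set z | exists w m, [/\ radj F t w, maxid V m & z = w * t + m]].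
have [|V' [hV' SV' JV']] := @Chevalley K S J.
  split; first split.
  - split.
    + by exists 1, 0; split; [exact: (subring1 hR)|exact: maxid0|rewrite addr0].
    + move=> _ _ [w [m [Rw mm ->]]] [w' [m' [Rw' mm' ->]]].
      exists (w - w'), (m - m'); split; [exact: (subringB hR)|exact: maxidB|].
      by rewrite opprD addrACA.
    + move=> _ _ [w [m [Rw mm ->]]] [w' [m' [Rw' mm' ->]]].
      exists (w * w'), (m * w' + (w + m) * m'); split; first exact: (subringM hR).
        apply: maxidD => //; first by apply: maxidMr => //; exact: RV.
        apply: maxidMl => //; apply: (subringD hV.1); [exact: RV|exact: maxid_sub].
      by rewrite mulrDr mulrDl -addrA.
  - move=> _ [w [m [Rw mm ->]]]; exists (w * t), m; split=> //.
    by apply: (subringM hR) => //; exact: radj_gen hF.1.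
  - by exists 0, 0; split; [exact: (subring0 hR)|exact: maxid0|rewrite mul0r addr0].
  - move=> _ _ [w [m [Rw mm ->]]] [w' [m' [Rw' mm' ->]]].
    exists (w + w'), (m + m'); split; [exact: (subringD hR)|exact: maxidD|].
    by rewrite mulrDl addrACA.
  - move=> _ _ [w [m [Rw mm ->]]] [w' [m' [Rw' mm' ->]]].
    exists (w * w'), (m * (w' * t) + (w + m) * m'); split; first exact: (subringM hR).
      apply: maxidD => //.
        apply: maxidMr => //; apply: RV; apply: (subringM hR) => //; exact: radj_gen hF.1.
      apply: maxidMl => //; apply: (subringD hV.1); [exact: RV|exact: maxid_sub].
    by rewrite mulrDr !mulrDl -!addrA !mulrA.
  - move=> [_ [m [[p Fp ->] mm e]]].
    have F1 : pover F 1 by apply: (poverC hF.1); exact: (subring1 hF.1).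
    have e0 : (p * 'X - 1).[t] = 0.
      apply: (@subfield_maxid _ V (gen F [:: t])) => //; first exact: subfield_gen.
        apply: Rg; exists (p * 'X - 1) => //.
        by apply: (poverB hF.1) => //; apply: (poverM hF.1) => //; exact: (poverX hF.1).
      rewrite hornerD hornerN hornerMX hornerC [X in _ - X]e opprD addrA subrr add0r.
      exact: maxidN.
    have := transc_eq0 hF nt _ e0.
    move=> /(_ (poverB hF.1 (poverM hF.1 Fp (poverX hF.1)) F1)) /polyP/(_ 0%N)/eqP.
    by rewrite coefB coefMX coef1 coef0 sub0r oppr_eq0 oner_eq0.
exists V'; split=> //.
- move=> a Fa; apply: SV'; exists a, 0; split; [exact: (radj_sub t hF.1)|exact: maxid0|].
  by rewrite addr0.
- apply: JV'; exists 1, 0; split; [exact: (subring1 hR)|exact: maxid0|].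
  by rewrite mul1r addr0.
- move=> m mm; apply: JV'; exists 0, m; split=> //; first exact: (subring0 hR).
  by rewrite mul0r add0r.
Qed.

(** The variables are sent to zero one after the other. *)
Lemma valring_chain k (ts s : seq K) V : subfield k -> valring V -> trl k s -> gen k s `<=` V ->
  (forall t, t \in ts -> t \in s \/ maxid V t) -> {subset s <= ts} ->
  exists W : nat -> set K, [/\ W 0%N = V,
    forall i, (i <= size s)%N -> [/\ valring (W i), k `<=` W i & forall t, t \in ts -> W i t] &
    forall i, (i < size s)%N -> maxid (W i) `<=` maxid (W i.+1) /\
      exists t, [/\ t \in ts, maxid (W i.+1) t & ~ maxid (W i) t]].
Proof.
move=> hk; elim: s V => [|t s IH] V hV trs sV tsV sts.
  exists (fun=> V); split=> // i _; split=> //.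
    by apply: subset_trans sV; exact: gen_sub.
  by move=> t /tsV[//|]; exact: maxid_sub.
have [nt trs'] := trs.
have hks := subfield_gen k s.
have [||V' [hV' FV' mt sub]] := @valring_refine (gen k s) t V hks hV.
- by rewrite -gen_cons.
- exact: nt.
have ntV : ~ maxid V t.
  move=> mVt; apply: nt; have -> : t = 0.
    apply: (subfield_maxid (subfield_gen k (t :: s)) sV _ mVt).
    by apply: gen_mem; rewrite inE eqxx.
  exact: (subring0 (subring_ic _)).
have tsV' u : u \in ts -> u \in s \/ maxid V' u.
  move=> /tsV[]; last by move=> /sub; right.
  by rewrite inE => /orP[/eqP->|]; [right|left].
have [W [W0 hW stepW]] := IH V' hV' trs' FV' tsV' (fun u us => sts u (mem_behead (s := t :: s) us)).
exists (fun i => if i is i'.+1 then W i' else V); split=> //.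
  move=> [_|i] /=; last exact: hW.
  split=> //; first by apply: subset_trans sV; exact: gen_sub.
  move=> u /tsV[us|]; last exact: maxid_sub.
  by apply: sV; exact: gen_mem.
move=> [_|i] /=; last exact: stepW.
by rewrite W0; split=> //; exists t; split=> //; apply: sts; rewrite inE eqxx.
Qed.

(** Dimension is at least the transcendence degree: by Noether normalization
  R = k[Y] is integral over a polynomial ring, along the variables of which the
  places can be composed. *)
Theorem prime_chain_exists k s (Y : seq K) : subfield k -> trl k s ->
  (forall z, gen k Y z) ->
  exists W : nat -> set K, [/\
    forall i, (i <= size s)%N -> valring (W i) /\ rgen k Y `<=` W i,
    forall i, (i < size s)%N -> maxid (W i) `<=` maxid (W i.+1) &
    forall i, (i < size s)%N -> exists t, [/\ rgen k Y t, maxid (W i.+1) t & ~ maxid (W i) t]].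
Proof.
move=> hk trs KY.
have [ts [trts tsY Yts]] := Noether_subfield Y hk.
have Kts z : ic (gen k ts) z.
  have : gen k Y z by [].
  apply: gen_ic; [exact: subfield_gen|by move=> a ka; apply: ic_sub; exact: gen_sub|].
  by move=> t /Yts; apply: icS; exact: rgen_gen.
have le_s : (size s <= size ts)%N by apply: (Steinitz hk trs) => u _; exact: Kts.
have [//|||W [_ hW stepW]] := @valring_chain k ts ts [set: K] hk (valringT K) trts.
- by move=> t tts; left.
- by [].
exists W; split=> i ilt.
- have [hV kV tsV] := hW i (leq_trans ilt le_s); split=> //.
  apply: rgen_min => //; first exact: hV.1.
  by move=> x /Yts; apply => //; apply: rgen_min => //; exact: hV.1.
- by have [] := stepW i (leq_trans ilt le_s).
- have [_ [t [/tsY tY mt nmt]]] := stepW i (leq_trans ilt le_s).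
  by exists t.
Qed.

End Chains.

From mathcomp Require Import all_classical all_reals all_analysis.

(** * Approximation of a valuation with values in [0, +oo] *)

Section Filtration.
Context (K : fieldType) (k : set K) (hk : subfield k) (Y : seq K).

Fixpoint monomials n : seq K :=
  if n is n'.+1 then [seq a * b | a <- 1 :: Y, b <- monomials n'] else [:: 1].

Lemma span_mul l l1 l2 a b :
  (forall x y, x \in l1 -> y \in l2 -> span k l (x * y)) ->
  span k l1 a -> span k l2 b -> span k l (a * b).
Proof.
move=> h; have [h0 hD hZ] := span_subspace hk l; elim: l1 a h => [|x l1 IH] a h /=.
  by move=> -> _; rewrite mul0r.
move=> [c [w [kc lw ->]]] lb; rewrite mulrDl; apply: (hD); last first.
  by apply: IH => // u v ul vl; apply: h => //; rewrite inE ul orbT.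
rewrite -mulrA; apply: (hZ) => //.
have {}h y : y \in l2 -> span k l (x * y) by apply: h; rewrite inE eqxx.
elim: l2 b lb h {IH} => [|y l2 IH] b /=; first by move=> ->; rewrite mulr0.
move=> [d [w' [kd lw' ->]]] h; rewrite mulrDr mulrCA; apply: (hD).
  by apply: (hZ) => //; apply: h; rewrite inE eqxx.
by apply: IH => // v vl; apply: h; rewrite inE vl orbT.
Qed.

Lemma monomialsS n : {subset monomials n <= monomials n.+1}.
Proof. by move=> z zn; rewrite -[z]mul1r; apply: allpairs_f => //; rewrite inE eqxx. Qed.

Lemma monomials_leq m n : (m <= n)%N -> {subset monomials m <= monomials n}.
Proof.
by move=> /subnK<-; elim: (n - m)%N => [//|p IH] z /IH; rewrite addSn; exact: monomialsS.
Qed.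

Lemma monomialsM m n x y : x \in monomials m -> y \in monomials n ->
  x * y \in monomials (m + n).
Proof.
elim: m x => [|m IH] x; first by rewrite inE add0n => /eqP->; rewrite mul1r.
move=> /allpairsPdep[a [b [aY bm ->]]] yn; rewrite -mulrA addSn.
by apply: allpairs_f => //; exact: IH.
Qed.

Lemma rgen_monomials z : rgen k Y z -> exists n, span k (monomials n) z.
Proof.
apply: (@rgen_min _ k Y [set z | exists n, span k (monomials n) z]).
- split.
  + by exists 0%N; apply: (span_mem hk); rewrite inE.
  + move=> a b [m ma] [n nb]; exists (maxn m n).
    have [_ hD hZ] := span_subspace hk (monomials (maxn m n)).
    have sub p q : (p <= q)%N -> span k (monomials p) `<=` span k (monomials q).
      by move=> pq; apply: (spanS hk) => e /(monomials_leq pq); exact: (span_mem hk).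
    rewrite -mulN1r; apply: hD; first exact: (sub m _ (leq_maxl _ _)).
    apply: hZ; last exact: (sub n _ (leq_maxr _ _)).
    by apply: (subringN hk.1); exact: (subring1 hk.1).
  + move=> a b [m ma] [n nb]; exists (m + n)%N.
    apply: span_mul ma nb => x y xm yn; apply: (span_mem hk); exact: monomialsM.
- by move=> c kc; exists 0%N, c, 0; split=> //; rewrite mulr1 addr0.
- move=> t tY; exists 1%N; apply: (span_mem hk); rewrite -[t]mulr1.
  by apply: allpairs_f; rewrite ?inE ?tY ?orbT.
Qed.

End Filtration.

Section Approximation.
Context (R : realType) (K : fieldType) (k A : set K) (xi : K -> \bar R).
Context (hk : subfield k) (kinf : infinite_pred k) (hA : subring A) (kA : k `<=` A).
Context (xi_ge0 : forall a, A a -> (0 <= xi a)%E)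
  (xiM : forall a b, A a -> A b -> xi (a * b) = (xi a + xi b)%E)
  (xiD : forall a b, A a -> A b -> (mine (xi a) (xi b) <= xi (a + b)%R)%E)
  (xi0 : xi 0 = +oo%E) (xik : forall c, k c -> c != 0 -> xi c = 0%E).

(** xi need not be finite on the nonzero elements of A, so its ring consists of the
  fractions whose denominator has a finite value; a valuation ring that dominates
  it need not be of rank one. *)
Definition xi_ring : set K :=
  [set z | exists a b, [/\ A a, A b, (xi b < +oo)%E, (xi b <= xi a)%E & z = a / b]].
Definition xi_center : set K :=
  [set z | exists a b, [/\ A a, A b, (xi b < +oo)%E, (xi b < xi a)%E & z = a / b]].

Let xi1 : xi 1 = 0%E.
Proof. by apply: xik; [exact: (subring1 hk.1)|exact: oner_neq0]. Qed.

Let xi_neq0 b : (xi b < +oo)%E -> b != 0.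
Proof. by apply: contraTneq => ->; rewrite xi0 ltxx. Qed.

Let xi_fin b : A b -> (xi b < +oo)%E -> xi b \is a fin_num.
Proof. by move=> Ab lt; rewrite ge0_fin_numE //; exact: xi_ge0. Qed.

Let xiN a : A a -> xi (- a) = xi a.
Proof.
move=> Aa; rewrite -mulN1r xiM //.
  rewrite xik ?add0e //; first by apply: (subringN hk.1); exact: (subring1 hk.1).
  by rewrite oppr_eq0 oner_neq0.
by apply: (subringN hA); exact: (subring1 hA).
Qed.

Let xiX a n : A a -> xi (a ^+ n) = (xi a *+ n)%E.
Proof.
move=> Aa; elim: n => [|n IH]; first by rewrite expr0 xi1.
by rewrite exprS xiM ?IH ?muleS //; exact: (subringX hA).
Qed.

Lemma xi_rideal : rideal xi_ring xi_center.
Proof.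
have mulA' a b c : A a -> A b -> A c -> (xi c < +oo)%E -> (xi a <= xi b)%E ->
    (xi (a * c) <= xi (b * c))%E.
  by move=> Aa Ab Ac c_lt le; rewrite !xiM // leeD2r.
have finM b c : A b -> A c -> (xi b < +oo)%E -> (xi c < +oo)%E -> (xi (b * c) < +oo)%E.
  by move=> Ab Ac ? ?; rewrite xiM // lte_add_pinfty.
have mulL a b c : A a -> A b -> A c -> (xi c < +oo)%E -> (xi a < xi b)%E ->
    (xi (a * c) < xi (b * c))%E.
  by move=> Aa Ab Ac c_lt lt; rewrite !xiM // lteD2rE // xi_fin.
have sub : xi_center `<=` xi_ring.
  by move=> z [a [b [Aa Ab lt le ->]]]; exists a, b; split=> //; exact: ltW.
split; [split=> //|].
- split.
  + exists 1, 1; split=> //; try exact: (subring1 hA); last by rewrite divr1.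
    by rewrite xi1 ltry.
  + move=> _ _ [a [b [Aa Ab bf le ->]]] [c [d [Ac Ad df le' ->]]].
    have b0 := xi_neq0 bf; have d0 := xi_neq0 df.
    exists (a * d - c * b), (b * d); split.
    * by apply: (subringB hA); exact: (subringM hA).
    * exact: (subringM hA).
    * exact: finM.
    * apply: le_trans (xiD _ _); [|exact: (subringM hA)|]; last first.
        by apply: (subringN hA); exact: (subringM hA).
      rewrite xiN; last exact: (subringM hA).
      by rewrite le_min mulA' //= mulrC mulA'.
    * by field; rewrite b0 d0.
  + move=> _ _ [a [b [Aa Ab bf le ->]]] [c [d [Ac Ad df le' ->]]].
    exists (a * c), (b * d); split; try exact: (subringM hA); first exact: finM.
      by rewrite !xiM // leeD.
    by rewrite mulf_div.
- exists 0, 1; split; [exact: (subring0 hA)|exact: (subring1 hA)| | |by rewrite mul0r].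
    by rewrite xi1 ltry.
  by rewrite xi1 xi0 ltry.
- move=> _ _ [a [b [Aa Ab bf le ->]]] [c [d [Ac Ad df le' ->]]].
  have b0 := xi_neq0 bf; have d0 := xi_neq0 df.
  exists (a * d + c * b), (b * d); split.
  + by apply: (subringD hA); exact: (subringM hA).
  + exact: (subringM hA).
  + exact: finM.
  + apply: lt_le_trans (xiD _ _); [|exact: (subringM hA)|exact: (subringM hA)].
    by rewrite lt_min mulL //= mulrC mulL.
  + by field; rewrite b0 d0.
- move=> _ _ [a [b [Aa Ab bf le ->]]] [c [d [Ac Ad df le' ->]]].
  exists (a * c), (b * d); split; try exact: (subringM hA); first exact: finM.
    rewrite !xiM //; apply: (@lt_le_trans _ _ (xi b + xi c)%E); last exact: leeD2r.
    by rewrite lteD2lE // xi_fin.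
  by rewrite mulf_div.
- move=> [a [b [Aa Ab bf lt e]]]; move: lt.
  have b0 := xi_neq0 bf.
  by rewrite -(divfK b0 a) -e mul1r ltxx.
Qed.

(** A sequence of valuations of divisorial type that converges to xi on A.

  A is the union of finite-dimensional spaces U_n.  On U_n the place V0, of
  centre {xi > 0}, that dominates xi_ring takes finitely many values, attained
  at the members e of a finite list, and the elements of U_n that are multiples
  of e in V0 are spanned by finitely many z.  If the quotients z / e are
  regular at V, and units at V0 remain units at V, then V takes on the whole of
  U_n the same values as on the list, whatever the cardinality of k.  The
  finitely many conditions that e ^ (n + 1) / f ^ p and f ^ (p + 1) / e ^ (n + 1)
  be regular at V make those values converge to those of xi. *)
Theorem approximating_sequence (Y : seq K) f : A f -> (0 < xi f)%E -> (xi f < +oo)%E ->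
  (forall z, gen k Y z) -> A `<=` rgen k Y -> (forall z, z \in Y -> xi_ring z) ->
  forall n, exists V s y (v : K -> int), [/\
    [/\ valring V, gen k s `<=` V, trl k s, maxid V y & y != 0] /\
      (forall z, ic (gen k (y :: s)) z),
    [/\ forall a b, a != 0 -> b != 0 -> v (a * b) = v a + v b,
      forall z, z != 0 -> (V z <-> 0 <= v z) & exists2 z, z != 0 & v z = 1],
    forall a, A a -> V a /\ (maxid V a <-> (0 < xi a)%E),
    forall a, span k (monomials Y n) a -> A a -> (xi a < +oo)%E ->
      `|(v a)%:~R * fine (xi f) - (v f)%:~R * fine (xi a)| * n.+1%:R <= (v f)%:~R * fine (xi f) &
    forall a, span k (monomials Y n) a -> A a -> a != 0 -> xi a = +oo%E ->
      (n.+1%:R : R) * (v f)%:~R <= (v a)%:~R].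
Proof.
move=> Af f0 foo KY AY YO n.
have f_neq0 := xi_neq0 foo.
have [V0 [hV0 OV0 MV0]] := Chevalley xi_rideal.
have A_O a : A a -> xi_ring a.
  move=> Aa; exists a, 1; split=> //; [exact: (subring1 hA)| | |by rewrite divr1].
    by rewrite xi1 ltry.
  by rewrite xi1 xi_ge0.
have AV0 a : A a -> V0 a by move=> /A_O/OV0.
have A_maxid a : A a -> (maxid V0 a <-> (0 < xi a)%E).
  move=> Aa; split=> [ma|lt]; last first.
    apply: MV0; exists a, 1; split=> //; [exact: (subring1 hA)| | |by rewrite divr1].
      by rewrite xi1 ltry.
    by rewrite xi1.
  rewrite lt_def xi_ge0 // andbT; apply/eqP => a0.
  have an0 : a != 0 by apply: xi_neq0; rewrite a0 ltry.
  apply: (unit_maxid an0 _ ma); apply: OV0; exists 1, a; rewrite div1r; split=> //.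
  - exact: (subring1 hA).
  - by rewrite a0 ltry.
  - by rewrite a0 xi1.
have subA : linear_subspace k A.
  split; [exact: (subring0 hA)|exact: (subringD hA)|].
  by move=> c a /kA Ac Aa; exact: (subringM hA).
have [l hl] := subspace_span hk (monomials Y n) subA.
have [r [rl hr]] := span_values l hV0 hk.
have rA e : e \in r -> A e by move=> /rl[]; rewrite hl => -[].
have re0 e : e \in r -> e != 0 by move=> /rl[].
have kV0 : k `<=` V0 by move=> c /kA/AV0.
have subZ e : linear_subspace k [set a | V0 (a / e)].
  split=> /=.
  - by rewrite mul0r; exact: (subring0 hV0.1).
  - by move=> a b Va Vb; rewrite mulrDl; exact: (subringD hV0.1).
  - by move=> c a /kV0 Vc Va; rewrite -mulrA; exact: (subringM hV0.1).
have /choice[Z hZ] : forall e, exists z, span k z = [set a | V0 (a / e)] `&` span k l.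
  by move=> e; have [z ez] := subspace_span hk l (subZ e); exists z.
have subP : linear_subspace k [set a | A a /\ xi a = +oo%E].
  split=> /=.
  - by split; [exact: (subring0 hA)|].
  - move=> a b [Aa ea] [Ab eb]; split; first exact: (subringD hA).
    by have := xiD Aa Ab; rewrite ea eb minxx leye_eq => /eqP.
  - move=> c a kc [Aa ea]; split; first by apply: (subringM hA) => //; exact: kA.
    rewrite xiM ?ea //; last exact: kA.
    rewrite addey //; apply/eqP => e; have := xi_ge0 (kA kc).
    by rewrite e.
have [P hP] := subspace_span hk l subP.
pose rho e : R := fine (xi e) / fine (xi f).
pose pe e := Num.truncn (n.+1%:R * rho e).
pose bounds e := if (xi e < +oo)%E then
   [:: e ^+ n.+1 / f ^+ pe e; f ^+ (pe e).+1 / e ^+ n.+1] else [::].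
pose Yn := Y ++ flatten [seq [seq z / e | z <- Z e] ++ bounds e | e <- r]
   ++ [seq z / f ^+ n.+1 | z <- P].
have xif : xi f = (fine (xi f))%:E by rewrite fineK // xi_fin.
have xif_gt0 : 0 < fine (xi f) by rewrite -lte_fin -xif.
have pe_itv e : A e -> (pe e)%:R * fine (xi f) <= n.+1%:R * fine (xi e) /\
    n.+1%:R * fine (xi e) <= (pe e).+1%:R * fine (xi f).
  move=> Ae; have rho0 : 0 <= n.+1%:R * rho e.
    by rewrite mulr_ge0 // divr_ge0 ?(ltW xif_gt0) // fine_ge0 // xi_ge0.
  have /andP[h1 h2] := truncn_itv rho0.
  have <- : n.+1%:R * rho e * fine (xi f) = n.+1%:R * fine (xi e).
    by rewrite /rho -!mulrA mulVf ?mulr1 // gt_eqF.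
  by split; rewrite ler_wpM2r // ltW.
have bounds_O e z : e \in r -> z \in bounds e -> xi_ring z.
  move=> er; rewrite /bounds; case: ifP => // eoo.
  have Ae := rA e er.
  have xie : xi e = (fine (xi e))%:E by rewrite fineK // xi_fin.
  have [h1 h2] := pe_itv e Ae.
  have XE a m : A a -> xi a = (fine (xi a))%:E -> xi (a ^+ m) = (m%:R * fine (xi a))%:E.
    by move=> Aa ea; rewrite xiX // ea -EFin_natmul mulr_natl.
  rewrite !inE => /orP[/eqP->|/eqP->].
    exists (e ^+ n.+1), (f ^+ pe e); split=> //; try exact: (subringX hA).
      by rewrite XE // ltry.
    by rewrite !XE // lee_fin.
  exists (f ^+ (pe e).+1), (e ^+ n.+1); split=> //; try exact: (subringX hA).
    by rewrite XE // ltry.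
  by rewrite !XE // lee_fin.
have YnV0 z : z \in Yn -> V0 z.
  rewrite !mem_cat => /or3P[/YO/OV0//| |].
    move=> /flatten_mapP[e er]; rewrite mem_cat => /orP[/mapP[a aZ ->]|/(bounds_O _ _ er)/OV0//].
    by have := span_mem hk aZ; rewrite hZ => -[].
  move=> /mapP[a aP ->]; have := span_mem hk aP; rewrite hP => -[[Aa ea] _].
  apply: OV0; exists a, (f ^+ n.+1); split=> //; first exact: (subringX hA).
    by rewrite xiX // xif -EFin_natmul ltry.
  by rewrite ea leey.
have KYn z : gen k Yn z.
  have : gen k Y z by [].
  by apply: genS; [exact: gen_sub|move=> t tY; apply: gen_mem; rewrite mem_cat tY].
have mf : maxid V0 f by apply/A_maxid.
have [V [s [y [hV YnV cen [sV trs my y0 Ky]]]]] :=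
  divisorial_center hk kinf hV0 kV0 KYn YnV0 mf f_neq0.
have hs := subfield_gen k s.
have [||v [vM v_ge0 v1]] := @discrete_valring K V (gen k s) y hV hs sV my y0 Y.
- by move=> x _; rewrite -gen_cons; exact: Ky.
- move=> z; have : gen k Y z by [].
  by apply: genS; [move=> a ka; do 3 apply: gen_sub|exact: gen_mem].
have hR := subring_rgen k Yn.
have subR e : linear_subspace k [set a | rgen k Yn (a / e)].
  split=> /=; first by rewrite mul0r; exact: (subring0 hR).
    by move=> b d hb hd; rewrite mulrDl; exact: (subringD hR).
  by move=> b d kb hd; rewrite -mulrA; apply: (subringM hR) => //; exact: rgen_sub.
have AR a : A a -> rgen k Yn a.
  move=> /AY; apply: rgenS; first exact: rgen_sub.
  by move=> t tY; apply: rgen_mem; rewrite mem_cat tY.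
have RV : rgen k Yn `<=` V.
  apply: rgen_min; [exact: hV.1| |exact: YnV].
  by move=> c kc; apply: sV; exact: gen_sub.
have AV a : A a -> V a by move=> /AR/RV.
have cA a : A a -> (maxid V a <-> (0 < xi a)%E).
  move=> Aa; split; first by move=> ma; apply/(A_maxid _ Aa)/(cen _ (AR _ Aa)).
  by move=> /(A_maxid _ Aa)/(cen _ (AR _ Aa)).
have v_1 : v 1 = 0 by apply: (addrI (v 1)); rewrite addr0 -vM ?oner_neq0 // mulr1.
have vV z : z != 0 -> v z^-1 = - v z.
  by move=> z0; apply/eqP; rewrite -addr_eq0 -vM ?invr_eq0 // mulVf // v_1.
have vX z m : z != 0 -> v (z ^+ m) = m%:Z * v z.
  move=> z0; elim: m => [|m IH]; first by rewrite expr0 v_1 mul0r.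
  by rewrite exprS vM ?expf_neq0 // IH intS mulrDl mul1r.
have v_div a b : a != 0 -> b != 0 -> V (a / b) -> v b <= v a.
  move=> a0 b0 /v_ge0; rewrite mulf_neq0 ?invr_eq0 // => /(_ isT).
  by rewrite vM ?invr_eq0 // vV // subr_ge0.
exists V, s, y, v; split=> //.
- by move=> a Aa; split; [exact: AV|exact: cA].
- move=> a Un Aa aoo.
  have a0 := xi_neq0 aoo.
  have la : span k l a by rewrite hl.
  have [e [c [er kc c0 [u1 u2 _]]]] := hr a la a0.
  have e0 := re0 e er; have Ae := rA e er.
  have cV : V0 c by exact: kV0.
  have cVi : V0 c^-1 by apply: kV0; exact: subfieldV.
  have ae : V0 (a / e).
    have -> : a / e = c * (a / (c * e)) by field; rewrite c0 e0.
    exact: (subringM hV0.1).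
  have ea : V0 (e / a).
    have -> : e / a = c^-1 * (a / (c * e))^-1 by field; rewrite c0 e0 a0.
    exact: (subringM hV0.1).
  have noMe a' b' : A a' -> A b' -> a' != 0 -> V0 (b' / a') -> (xi b' < +oo)%E ->
      (xi a' <= xi b')%E.
    move=> Aa' Ab' a'0 V0ba b'oo; rewrite leNgt; apply/negP => lt.
    have b'0 := xi_neq0 b'oo.
    have : maxid V0 (a' / b') by apply: MV0; exists a', b'.
    by apply: unit_maxid; rewrite ?mulf_neq0 ?invr_eq0 // invf_div.
  have le1 : (xi e <= xi a)%E by exact: noMe.
  have eoo : (xi e < +oo)%E by exact: le_lt_trans aoo.
  have le2 : (xi a <= xi e)%E by exact: noMe.
  have xiae : xi a = xi e by apply: le_anti; rewrite le1 le2.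
  have Rae : rgen k Yn (a / e).
    have : span k (Z e) a by rewrite hZ.
    apply: (span_sub (subR e)) => z zZ /=; apply: rgen_mem; rewrite !mem_cat; apply/or3P/Or32/flatten_mapP.
    by exists e => //; rewrite mem_cat; apply/orP; left; apply/mapP; exists z.
  have nae : ~ maxid V (a / e).
    move=> /(cen _ Rae); apply: unit_maxid; rewrite ?mulf_neq0 ?invr_eq0 //.
    by rewrite invf_div.
  have [Vea _] := maxidP (RV _ Rae) nae.
  have vae : v a = v e.
    apply: le_anti; rewrite (v_div e a) //=; last by rewrite -invf_div.
    by rewrite (v_div a e) //; exact: RV.
  have bV z : z \in bounds e -> V z.
    move=> zb; apply: YnV; rewrite !mem_cat; apply/or3P/Or32/flatten_mapP.
    by exists e => //; rewrite mem_cat zb orbT.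
  move: bV; rewrite /bounds eoo => bV.
  have b1 : (pe e)%:Z * v f <= n.+1%:Z * v e.
    rewrite -!vX //; apply: v_div; rewrite ?expf_neq0 //.
    by apply: bV; rewrite inE eqxx.
  have b2 : n.+1%:Z * v e <= (pe e).+1%:Z * v f.
    rewrite -!vX //; apply: v_div; rewrite ?expf_neq0 //.
    by apply: bV; rewrite !inE eqxx orbT.
  rewrite vae xiae.
  have [h1 h2] := pe_itv e Ae.
  have vf0 : 0 <= v f by apply/v_ge0 => //; exact: AV.
  have vf0' : (0 : R) <= (v f)%:~R by rewrite ler0z.
  have {}b1 : (pe e)%:R * (v f)%:~R <= n.+1%:R * (v e)%:~R :> R.
    by move: b1; rewrite -(ler_int R) !intrM.
  have {}b2 : n.+1%:R * (v e)%:~R <= (pe e).+1%:R * (v f)%:~R :> R.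
    by move: b2; rewrite -(ler_int R) !intrM.
  rewrite -[X in _ * X]ger0_norm // -normrM ler_norml.
  set x := fine (xi f) in xif_gt0 h1 h2 *; set x' := fine (xi e) in h1 h2 *.
  set N : R := n.+1%:R in h1 h2 b1 b2 *; set F : R := (v f)%:~R in vf0' b1 b2 *.
  set E : R := (v e)%:~R in b1 b2 *.
  move: b2 h2; rewrite -[in (pe e).+1%:R * _]natr1 -[in X in _ <= X * x -> _]natr1.
  set p : R := (pe e)%:R in h1 b1 *; move=> b2 h2.
  have B1 : p * F * x <= N * E * x by rewrite ler_wpM2r // ltW.
  have B2 : N * E * x <= (p + 1) * F * x by rewrite ler_wpM2r // ltW.
  have H1 : p * x * F <= N * x' * F by rewrite ler_wpM2r.
  have H2 : N * x' * F <= (p + 1) * x * F by rewrite ler_wpM2r.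
  by apply/andP; split; lra.
- move=> a Un Aa a0 aoo.
  have la : span k P a.
    by rewrite hP; split=> //; rewrite hl.
  have Va : V (a / f ^+ n.+1).
    apply: RV; move: la; apply: (span_sub (subR _)) => z zP /=; apply: rgen_mem; rewrite !mem_cat; apply/or3P/Or33.
    by apply/mapP; exists z.
  have := v_div a (f ^+ n.+1) a0 (expf_neq0 _ f_neq0) Va.
  by rewrite vX // -(ler_int R) intrM.
Qed.

End Approximation.

(** * The field of fractions of an integral ring *)

Section FractionField.

Definition integral_ring (R : comPzRingType) : Prop :=
  (1 : R) != 0 /\ forall a b : R, a * b = 0 -> a = 0 \/ b = 0.

(** An alias of R that carries the instances of an integral domain. *)
Definition domain_of (R : comPzRingType) (h : integral_ring R) : Type := R.

Context (R : comPzRingType) (h : integral_ring R).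
Local Notation D := (domain_of h).

HB.instance Definition _ := GRing.ComPzRing.on D.
HB.instance Definition _ := GRing.PzSemiRing_isNonZero.Build D h.1.

Definition domain_unit : {pred D} := fun a => `[< exists b : D, b * a = 1 >].
Definition domain_inv (a : D) : D :=
  if pselect (exists b : D, b * a = 1) is left e then projT1 (cid e) else a.

Lemma domain_mulVx : {in domain_unit, left_inverse 1 domain_inv *%R}.
Proof.
move=> a /asboolP ex; rewrite /domain_inv; case: pselect => // e.
by case: cid.
Qed.
Lemma domain_unitPl (a b : D) : b * a = 1 -> domain_unit a.
Proof. by move=> e; apply/asboolP; exists b. Qed.
Lemma domain_invr_out : {in [predC domain_unit], domain_inv =1 id}.
Proof.
move=> a; rewrite inE => /asboolP nex; rewrite /domain_inv.
by case: pselect.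
Qed.
HB.instance Definition _ := GRing.ComNzRing_hasMulInverse.Build D
  domain_mulVx domain_unitPl domain_invr_out.

Lemma domain_integral (a b : D) : a * b = 0 -> (a == 0) || (b == 0).
Proof. by move=> /h.2[->|->]; rewrite eqxx ?orbT. Qed.
HB.instance Definition _ := GRing.ComUnitRing_isIntegral.Build D domain_integral.

Definition domain_frac (a : R) : {fraction D} := @FracField.tofrac D a.

Fact domain_frac_zmod : zmod_morphism domain_frac.
Proof. by move=> a b; rewrite /domain_frac (rmorphB (@FracField.tofrac D)). Qed.
Fact domain_frac_monoid : monoid_morphism domain_frac.
Proof.
split; first exact: (rmorph1 (@FracField.tofrac D)).
by move=> a b; exact: (rmorphM (@FracField.tofrac D)).
Qed.
HB.instance Definition _ := GRing.isZmodMorphism.Build R {fraction D} domain_frac domain_frac_zmod.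
HB.instance Definition _ := GRing.isMonoidMorphism.Build R {fraction D} domain_frac domain_frac_monoid.

Lemma fraction_field_exists :
  exists (K : fieldType) (i : {rmorphism R -> K}), field_of_fractions i.
Proof.
exists {fraction D}, domain_frac; split.
  by move=> a b /eqP; rewrite /= /domain_frac tofrac_eq => /eqP.
move=> z; elim/quotW: z => x.
have x2 : (fraction.frac x).2 != 0 by exact: denom_ratioP.
exists (fraction.frac x).1, (fraction.frac x).2; split.
  by rewrite /= /domain_frac tofrac_eq0.
rewrite /= /domain_frac; apply: (canRL (mulfK _)); first by rewrite tofrac_eq0.
unlock FracField.tofrac; rewrite -[LHS]FracField.pi_mul; apply/eqmodP => /=.
rewrite FracField.equivfE /FracField.mulf !numden_Ratio ?mulr1 ?oner_neq0 //.
by rewrite mulrC.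
Qed.

End FractionField.

(** * Sections over affine open sets *)

Section PackRmorphism.
Context (R S : pzRingType) (f : R -> S) (hz : zmod_morphism f) (hm : monoid_morphism f).
Definition packed : R -> S := f.
HB.instance Definition _ := GRing.isZmodMorphism.Build R S packed hz.
HB.instance Definition _ := GRing.isMonoidMorphism.Build R S packed hm.
Lemma rmorphism_exists : exists g : {rmorphism R -> S}, forall a, g a = f a.
Proof. by exists packed. Qed.
End PackRmorphism.

Section Sections.
Context (X : ringedSpace).
Implicit Types U V W : opens X.

Lemma unit_at_mem U (f : sect U) x : unit_at f x -> oset U x.
Proof. by move=> [V [h [Vx _]]]; exact: h. Qed.

Lemma unit_at_open U (f : sect U) : open (unit_at f).
Proof.
rewrite openE => x [V [h [Vx e]]].
apply: filterS (open_nbhs_nbhs (conj (open_oset V) Vx)) => z Vz.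
by exists V, h.
Qed.

Lemma unit_at_unit U (f g : sect U) x : oset U x -> f * g = 1 -> unit_at f x.
Proof.
move=> Ux e; exists U, (@subset_refl _ U); split=> //; exists g.
by rewrite res_id.
Qed.

Lemma unit_atM U (f g : sect U) x : unit_at (f * g) x <-> unit_at f x /\ unit_at g x.
Proof.
split=> [[V [h [Vx [t e]]]]|[[V [h [Vx [t e]]]] [V' [h' [Vx' [t' e']]]]]].
  split; exists V, h; split=> //; [exists (res h g * t)|exists (res h f * t)].
    by rewrite mulrA -rmorphM.
  by rewrite mulrA [_ * res h f]mulrC -rmorphM.
have hV : opensI V V' `<=` V by move=> ? [].
have hV' : opensI V V' `<=` V' by move=> ? [].
exists (opensI V V'), (subset_trans hV h); split=> //.
exists (res hV t * res hV' t'); rewrite rmorphM /= mulrACA.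
rewrite -(res_comp h hV) -(res_comp h' hV' (subset_trans hV h)).
by rewrite -!rmorphM e e' !rmorph1 mulr1.
Qed.

Lemma unit_atX U (f : sect U) x n : unit_at f x -> unit_at (f ^+ n) x.
Proof.
move=> fx; have Ux := unit_at_mem fx.
elim: n => [|n IH]; last by rewrite exprS; apply/unit_atM.
by rewrite expr0; apply: (@unit_at_unit _ _ 1) => //; rewrite mulr1.
Qed.

Lemma local_inverse_unique W V V' W' (f : sect W) (h : V `<=` W) (h' : V' `<=` W)
    (s : sect V) (s' : sect V') (hi : W' `<=` V) (hj : W' `<=` V') :
  res h f * s = 1 -> res h' f * s' = 1 -> res hi s = res hj s'.
Proof.
move=> e e'; have fW := subset_trans hi h.
have ei : res fW f * res hi s = 1 by rewrite -(res_comp h hi) -rmorphM e rmorph1.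
have ej : res fW f * res hj s' = 1 by rewrite -(res_comp h' hj) -rmorphM e' rmorph1.
by rewrite -[LHS]mulr1 -ej mulrA [_ * res fW f]mulrC ei mul1r.
Qed.

(** Local inverses are unique, so they can be glued. *)
Lemma unit_global W (f : sect W) : (forall x, oset W x -> unit_at f x) -> exists t, f * t = 1.
Proof.
move=> hf.
have /choice[T hT] : forall i : {x : X | oset W x}, exists T : {V : opens X & sect V},
    exists h : projT1 T `<=` W, oset (projT1 T) (projT1 i) /\ res h f * projT2 T = 1.
  by move=> [x Wx]; have [V [h [Vx [t e]]]] := hf x Wx; exists (existT _ V t), h.
have hV i : projT1 (T i) `<=` W by have [] := hT i.
have hT' i : oset (projT1 (T i)) (projT1 i) /\ res (hV i) f * projT2 (T i) = 1.
  by have [h] := hT i; rewrite (Prop_irrelevance (hV i) h).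
have cov : forall x, oset W x -> exists i, oset (projT1 (T i)) x.
  by move=> x Wx; exists (exist _ x Wx); exact: (hT' (exist _ x Wx)).1.
have [t ht] := sect_glue hV cov (s := fun i => projT2 (T i)) (fun i j W' hi hj =>
  local_inverse_unique hi hj (hT' i).2 (hT' j).2).
exists t; apply: (@sect_separated X W _ _ hV _ _ cov) => i.
by rewrite rmorphM /= ht (hT' i).2 rmorph1.
Qed.

Lemma affine0 U x (aU : affine U) : oset U x -> ~ unit_at (0 : sect U) x.
Proof. by move=> Ux; have [h _ _ _] := aU; have [] := h x Ux. Qed.

Lemma unit_at_neq0 U (f : sect U) x : affine U -> unit_at f x -> f != 0.
Proof.
move=> aU fx; apply/eqP => f0; rewrite f0 in fx.
exact: (affine0 aU (unit_at_mem fx) fx).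
Qed.

End Sections.

Section Variety.
Context (k : fieldType) (X : kscheme k) (irrX : irreducible_set [set: X]) (redX : reduced X).
Implicit Types U V W : opens X.

Definition basic U (f : sect U) : opens X :=
  Opens (openI (open_oset U) (unit_at_open f)).

(** The localization of the ring at a is the ring of sections over the empty set,
  which is zero; so a is nilpotent. *)
Lemma affine_eq0 U (a : sect U) : affine U -> (forall x, ~ unit_at a x) -> a = 0.
Proof.
move=> [_ _ _ loc] na.
pose W : opens X := Opens open0.
have hW : W `<=` U by move=> ? [].
have eW : oset W = oset U `&` unit_at a.
  by apply/seteqP; split=> [x []|x [_ /na]].
have [_ /(_ 1)] := loc a W hW eW.
have r0 : res hW 1 = 0.
  by apply: (@sect_separated X W False (fun _ => W) (fun _ => @subset_refl _ W)) => // x [].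
by move=> /(_ r0)[n]; rewrite mulr1; exact: redX.
Qed.

(** By irreducibility the loci where two nonzero sections are units meet. *)
Lemma sect_integral U x : affine U -> oset U x -> integral_ring (sect U).
Proof.
move=> aU Ux; split.
  apply: (@unit_at_neq0 _ _ _ x aU); apply: (@unit_at_unit _ _ _ 1) => //.
  by rewrite mulr1.
move=> a b ab0; apply: contrapT => /not_orP[a0 b0].
have ex (c : sect U) : c <> 0 -> exists z, unit_at c z.
  by move=> c0; apply: contrapT => nex; apply: c0; apply: (affine_eq0 aU) => z cz; apply: nex; exists z.
have [z az] := ex a a0; have [w bw] := ex b b0.
have [_ irr] := irrX.
have [||v [_ [av bv]]] := irr _ _ (unit_at_open a) (unit_at_open b).
- by exists z.
- by exists w.
have : unit_at (a * b) v by apply/unit_atM.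
by rewrite ab0; apply: affine0 => //; exact: unit_at_mem av.
Qed.

Lemma res_eq0 U W (h : W `<=` U) x (a : sect U) : affine U -> oset W x ->
  res h a = 0 -> a = 0.
Proof.
move=> aU Wx a0; have Ux := h _ Wx.
have [_ int] := sect_integral aU Ux.
have [_ _ bas loc] := aU.
have [f [fx fW]] := bas W x h Wx.
have hf : basic f `<=` U by move=> ? [].
have hfW : basic f `<=` W by [].
have [_ /(_ a)] := loc f (basic f) hf erefl.
rewrite -(res_comp h hfW) a0 rmorph0 => /(_ erefl)[n].
have f0 : f <> 0 by apply/eqP; exact: unit_at_neq0 fx.
elim: n => [|n IH]; first by rewrite expr0 mul1r.
by rewrite exprS -mulrA => /int[|/IH].
Qed.

Lemma res_inj U W (h : W `<=` U) x : affine U -> oset W x -> injective (res h).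
Proof.
move=> aU Wx a b e; apply/eqP; rewrite -subr_eq0; apply/eqP.
by apply: (res_eq0 aU Wx (h := h)); rewrite rmorphB e subrr.
Qed.

(** A basic open set of V inside a basic open set of U is basic in U as well: its
  equation is a fraction with an invertible denominator. *)
Lemma common_basic U V y : affine U -> affine V -> oset U y -> oset V y ->
  exists (g : sect U) (h : sect V), [/\ unit_at g y, unit_at h y & oset (basic g) = oset (basic h)].
Proof.
move=> aU aV Uy Vy; have [_ _ basU locU] := aU; have [_ _ basV _] := aV.
have hUV : opensI U V `<=` U by move=> ? [].
have [g0 [g0y sub0]] := basU _ y hUV (conj Uy Vy).
have h1U : basic g0 `<=` U by move=> ? [].
have h1V : basic g0 `<=` V by move=> z /sub0[].
have [h [hy sub]] := basV (basic g0) y h1V (conj Uy g0y).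
have [/(_ (res h1V h))[n [a e]] _] := locU g0 (basic g0) h1U erefl.
have key z : oset (basic g0) z -> unit_at a z <-> unit_at h z.
  move=> g0z; rewrite -(unit_at_res h1U a g0z) -e.
  rewrite unit_atM (unit_at_res h1V h g0z); split=> [[]//|hz]; split=> //.
  by apply: unit_atX; apply/unit_at_res => //; exact: g0z.2.
exists (a * g0), h; split=> //.
  by apply/unit_atM; split=> //; apply/key.
apply/seteqP; split=> z [Oz].
  move=> /unit_atM[az g0z]; split; last exact/key.
  by apply: (h1V); split.
by move=> hz; have [Uz g0z] := sub _ (conj Oz hz); split=> //; apply/unit_atM; split=> //; apply/key.
Qed.

Section Localization.
Context (U : opens X) (aU : affine U) (K : fieldType) (i : {rmorphism sect U -> K}).
Context (hi : field_of_fractions i).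

Lemma frac_neq0 (f : sect U) y : unit_at f y -> i f != 0.
Proof.
move=> fy; have := unit_at_neq0 aU fy; apply: contra_neq => e.
by apply: hi.1; rewrite e rmorph0.
Qed.

Lemma local_fractions (g : sect U) W y (h : W `<=` U) : oset W = oset U `&` unit_at g ->
  oset W y -> exists i2 : {rmorphism sect W -> K},
    forall (s : sect W) n a, s * res h g ^+ n = res h a -> i2 s = i a / i g ^+ n.
Proof.
move=> eW Wy; have gy : unit_at g y by move: Wy; rewrite eW => -[].
have ig0 : i g != 0 by exact: frac_neq0 gy.
have igX n : i g ^+ n != 0 by exact: expf_neq0.
have [_ _ _ loc] := aU.
have /choice[N hN] : forall s : sect W, exists p : nat * sect U, s * res h g ^+ p.1 = res h p.2.
  by move=> s; have [/(_ s)[n [a e]] _] := loc g W h eW; exists (n, a).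
pose i2 s := i (N s).2 / i g ^+ (N s).1.
have i2E (s : sect W) n a : s * res h g ^+ n = res h a -> i2 s = i a / i g ^+ n.
  move=> e; apply/eqP; rewrite eqr_div // -!rmorphXn -!rmorphM; apply/eqP; congr (i _).
  apply: (res_inj aU Wy (h := h)); rewrite !rmorphM !rmorphXn /= -(hN s) -e.
  by rewrite mulrAC.
have hz : zmod_morphism i2.
  move=> s t; rewrite (i2E (s - t) ((N s).1 + (N t).1)%N
      ((N s).2 * g ^+ (N t).1 - (N t).2 * g ^+ (N s).1)); last first.
    rewrite rmorphB !rmorphM !rmorphXn /= -!hN exprD mulrBl; congr (_ - _); first by rewrite mulrA.
    by rewrite [_ ^+ (N s).1 * _]mulrC mulrA.
  rewrite /i2 rmorphB !rmorphM !rmorphXn /= exprD.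
  by field; rewrite !igX.
have hm : monoid_morphism i2.
  split; first by rewrite (i2E 1 0%N 1) ?expr0 ?rmorph1 ?divr1 // mulr1.
  move=> s t; rewrite (i2E (s * t) ((N s).1 + (N t).1)%N ((N s).2 * (N t).2)); last first.
    by rewrite rmorphM /= -!hN exprD mulrACA.
  by rewrite /i2 rmorphM exprD; field; rewrite !igX.
have [i3 e3] := rmorphism_exists hz hm.
by exists i3 => s n a e; rewrite e3; exact: i2E.
Qed.

(** Two affine open sets have the same function field; at a common point y the
  fractions may be taken with denominators that are units at y. *)
Lemma common_localization V y : affine V -> oset U y -> oset V y ->
  exists (iota : {rmorphism sect V -> K}) (g : sect U) (h : sect V),
    [/\ injective iota, unit_at g y, iota h != 0,
        forall W (hU : W `<=` U) (hV : W `<=` V) (a : sect U) (b : sect V),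
          oset W y -> W `<=` basic g -> res hU a = res hV b -> i a = iota b &
    [/\ forall b, exists n a, i b * iota h ^+ n = iota a,
        forall a, exists n b, iota a * i g ^+ n = i b &
        exists n b, (iota h)^-1 * i g ^+ n = i b]].
Proof.
move=> aV Uy Vy.
have [g [h [gy hy egh]]] := common_basic aU aV Uy Vy.
pose W := basic g.
have hU : W `<=` U by move=> ? [].
have hV : W `<=` V by move=> z; rewrite egh => -[].
have Wy : oset W y by split.
have [i2 i2E] := @local_fractions g W y hU erefl Wy.
have i2res a : i2 (res hU a) = i a.
  by rewrite (i2E _ 0%N a) ?expr0 ?mulr1 // divr1.
have ig0 : i g != 0 by exact: frac_neq0 gy.
have [_ _ _ locU] := aU; have [_ _ _ locV] := aV.
have [locU1 _] := locU g W hU erefl.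
have [locV1 _] := locV h W hV egh.
have [t et] : exists t, res hU g * t = 1.
  by apply: unit_global => x Wx; apply/(unit_at_res hU g Wx); exact: Wx.2.
have i2_0 s : i2 s = 0 -> s = 0.
  have [n [a e]] := locU1 s; rewrite (i2E _ _ _ e) => /eqP.
  rewrite mulf_eq0 invr_eq0 expf_eq0 (negPf ig0) andbF orbF => /eqP ia0.
  have a0 : a = 0 by apply: hi.1; rewrite ia0 rmorph0.
  move: e; rewrite a0 rmorph0 => /(congr1 (fun w => w * t ^+ n)).
  by rewrite mul0r -mulrA -exprMn et expr1n mulr1.
exists (i2 \o res hV), g, h; split=> //.
- move=> a b /= e; apply: (res_inj aV Wy (h := hV)); apply/eqP; rewrite -subr_eq0; apply/eqP.
  by apply: i2_0; rewrite rmorphB e subrr.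
- apply/eqP => /= /i2_0 e; have : res hV h = res hV 0 by rewrite e rmorph0.
  move=> /(res_inj aV Wy) h0; move: (unit_at_neq0 aV hy).
  by rewrite h0 eqxx.
- move=> W' hU' hV' a b W'y W'g e /=; rewrite -i2res; congr (i2 _).
  have [n [b' eb]] := locU1 (res hV b).
  have hW'U : W' `<=` W by [].
  have e2 : b' = a * g ^+ n.
    apply: (res_inj aU W'y (h := hU')); rewrite rmorphM rmorphXn /= e.
    rewrite -(res_comp hU hW'U) -eb rmorphM rmorphXn /= (res_comp hV hW'U hV').
    by rewrite (res_comp hU hW'U hU').
  move: eb; rewrite e2 rmorphM rmorphXn /= => /(congr1 (fun w => w * t ^+ n)).
  by rewrite -!mulrA -exprMn et expr1n !mulr1.
split.
- move=> b; have [n [a e]] := locV1 (res hU b); exists n, a.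
  by rewrite /= -e rmorphM rmorphXn /= i2res.
- move=> a; have [n [b e]] := locU1 (res hV a); exists n, b.
  by rewrite /= -(i2res b) -e rmorphM rmorphXn /= i2res.
- have [r er] : exists r, res hV h * r = 1.
    apply: unit_global => x Wx; apply/(unit_at_res hV h Wx).
    by move: Wx; rewrite egh => -[].
  have [n [b e]] := locU1 r; exists n, b.
  have -> : (i2 (res hV h))^-1 = i2 r.
    have e1 : i2 (res hV h) * i2 r = 1 by rewrite -rmorphM er rmorph1.
    have h0 : i2 (res hV h) != 0 by apply: contra_eq_neq e1 => ->; rewrite mul0r eq_sym oner_neq0.
    by apply: (mulfI h0); rewrite divff.
  by rewrite -(i2res b) -e rmorphM rmorphXn /= i2res.
Qed.

End Localization.
End Variety.

(** * The dimension of a variety *)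

Section Dimension.
Context (k : fieldType) (X : kscheme k).
Context (irrX : irreducible_set [set: X]) (redX : reduced X) (ftX : finite_type X).
Context (U : opens X) (aU : affine U) (K : fieldType) (i : {rmorphism sect U -> K}).
Context (hi : field_of_fractions i) (j : {rmorphism k -> K}) (hj : forall c, j c = i (Defs.cst U c)).
Implicit Types (V W : opens X).
Let F : set K := range j.

Lemma fg_rgen V (iota : {rmorphism sect V -> K}) : finitely_generated V ->
  (forall c, iota (Defs.cst V c) = j c) ->
  exists gs : seq (sect V), forall a, rgen F (map iota gs) (iota a).
Proof.
move=> [gs hgs] jE; exists gs.
have hR := subring_rgen F (map iota gs).
suff e : [set a | rgen F (map iota gs) (iota a)] = [set: sect V].
  by move=> a; have : [set a | rgen F (map iota gs) (iota a)] a by rewrite e.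
apply: hgs => /=.
- by move=> c; rewrite jE; apply: rgen_sub; exists c.
- move=> l lt; apply: rgen_mem; apply: map_f; exact: mem_nth.
- by move=> a b ha hb; rewrite rmorphD; exact: (subringD hR).
- by move=> a b ha hb; rewrite rmorphM; exact: (subringM hR).
Qed.

Lemma function_field_chart V y : affine V -> oset U y -> oset V y ->
  exists (iota : {rmorphism sect V -> K}) (g : sect U) (h : sect V),
    [/\ injective iota, unit_at g y, iota h != 0, forall c, iota (Defs.cst V c) = j c &
    [/\ forall b, exists n a, i b * iota h ^+ n = iota a,
        forall a, exists n b, iota a * i g ^+ n = i b &
        exists n b, (iota h)^-1 * i g ^+ n = i b]].
Proof.
move=> aV Uy Vy.
have [iota [g [h [inj gy h0 comp loc]]]] := common_localization irrX redX aU hi aV Uy Vy.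
exists iota, g, h; split=> // c; rewrite hj.
have gU : opensI (basic g) V `<=` U by move=> ? [[]].
have gV : opensI (basic g) V `<=` V by move=> ? [].
apply/esym/(comp _ gU gV); [by split|by move=> ? []|].
have T : opensI (basic g) V `<=` opensT X by [].
by rewrite /Defs.cst (res_comp _ gU T) (res_comp _ gV T).
Qed.

Lemma chart_generates V (iota : {rmorphism sect V -> K}) (h : sect V) gs :
  (forall a, rgen F (map iota gs) (iota a)) ->
  iota h != 0 -> (forall b, exists n a, i b * iota h ^+ n = iota a) ->
  forall z, gen F (map iota gs) z.
Proof.
move=> hgs h0 loc z.
have hG := subfield_gen F (map iota gs).
have gi a : gen F (map iota gs) (iota a) by apply: rgen_gen; exact: hgs.
have gU b : gen F (map iota gs) (i b).
  have [n [a e]] := loc b.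
  have -> : i b = iota a / iota h ^+ n by rewrite -e mulfK // expf_neq0.
  by apply: (subfield_div hG) => //; apply: (subringX hG.1).
have [a [b [_ ->]]] := hi.2 z.
exact: (subfield_div hG).
Qed.

(** In an affine chart V, irreducible closed sets correspond to primes of O(V).  A
  chain of primes of the length of s, cut out by places of K, gives points whose
  closures form a chain in X.  Conversely, for a chain that starts at a point of
  V, the sections that vanish on its members form a strict chain of primes; it is
  strict because V meets every nonempty open part of a larger member. *)
Theorem krull_dim_trdeg (s : seq K) x0 : oset U x0 -> trl F s ->
  (forall z, ic (gen F s) z) -> krull_dim X (size s).
Proof.
move=> Ux0 trs Ks.
have hF := MPoly.subfield_range j.
have [m [Vs [cov hVs]]] := ftX.
split.
  have [l Vy] := cov x0; have [aV fgV] := hVs l; set V := Vs l in aV fgV Vy.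
  have [iota [g [h [inj gy h0 jE [locU _ _]]]]] := function_field_chart aV Ux0 Vy.
  have [gs hgs] := fg_rgen fgV jE.
  have Kgs := chart_generates hgs h0 locU.
  have [W [hW stepW strictW]] := prime_chain_exists hF trs Kgs.
  have [_ ptsV basV locV] := aV.
  have prim p : (p <= size s)%N -> prime_ideal [set a | maxid (W p) (iota a)].
    move=> le_p; have [vW RW] := hW p le_p; split=> /=.
    - by rewrite rmorph0; exact: maxid0.
    - by move=> a b ma mb; rewrite rmorphD; exact: maxidD.
    - by move=> a b mb; rewrite rmorphM; apply: maxidMl => //; exact: RW.
    - by rewrite rmorph1; exact: maxid1.
    - by move=> a b; rewrite rmorphM; apply: maxidM_prime => //; exact: RW.
  have /choice[z hz] : forall p, exists z, (p <= size s)%N ->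
      oset V z /\ [set a | maxid (W p) (iota a)] = vanishing_ideal V z.
    move=> p; have [le_p|] := boolP (p <= size s)%N; last by exists x0.
    by have [z [hz _]] := ptsV _ (prim p le_p); exists z.
  have unitE p a : (p <= size s)%N -> unit_at a (z p) <-> ~ maxid (W p) (iota a).
    move=> le_p; have [_ e] := hz p le_p.
    have eE : maxid (W p) (iota a) <-> ~ unit_at a (z p).
      by have := congr1 (fun A : set (sect V) => A a) e => /= ->.
    split=> [h1 /eE//|h1]; apply: contrapT => h2; exact/h1/eE.
  have sub p : (p < size s)%N -> closure [set z p.+1] `<=` closure [set z p].
    move=> lt_p; rewrite [X in _ `<=` X](proj1 (closure_id _) (@closed_closure _ _)).
    apply: closureS => _ -> N; rewrite nbhsE => -[N' [oN N'z] N'N].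
    have [Vz _] := hz p.+1 lt_p.
    have VO : opensI V (Opens oN) `<=` V by move=> ? [].
    have [f [fz fO]] := basV _ (z p.+1) VO (conj Vz N'z).
    exists (z p); split=> //; apply: N'N.
    suff : (opensI V (Opens oN) : set X) (z p) by case.
    apply: fO; split; first by have [] := hz p (ltnW lt_p).
    by apply/(unitE _ _ (ltnW lt_p)) => mf; move/(unitE _ _ lt_p): fz; apply; exact: stepW.
  have strict p : (p < size s)%N -> ~ closure [set z p.+1] (z p).
    move=> lt_p cl; have [t [Rt mt nt]] := strictW p lt_p.
    have [a ea] : exists a, t = iota a.
      have : range iota t.
        apply: (rgen_min _ _ _ Rt).
        - exact: subring_range.
        - by move=> _ [c _ <-]; exists (Defs.cst V c).
        - by move=> u /mapP[a _ ->]; exists a.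
      by move=> [a _ <-]; exists a.
    subst t.
    have az : unit_at a (z p) by apply/unitE => //; exact: ltnW.
    have [_ [-> /= /unitE h1]] := cl _ (open_nbhs_nbhs (conj (unit_at_open a) az)).
    by apply: (h1 lt_p).
  exists (fun p => closure [set z (size s - p)%N]); split.
    move=> p _; split; first exact: closed_closure.
    split; first by exists (z (size s - p)%N); exact: subset_closure.
    have meet O : open O -> closure [set z (size s - p)%N] `&` O !=set0 -> O (z (size s - p)%N).
      move=> oO [w [cw Ow]].
      by have [_ [-> ]] := cw _ (open_nbhs_nbhs (conj oO Ow)).
    move=> O O' oO oO' hO hO'; exists (z (size s - p)%N); split.
      exact: subset_closure.
    by split; exact: meet.
  move=> p lt_p; have e : (size s - p = (size s - p.+1).+1)%N by rewrite subnSK.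
  have lt : (size s - p.+1 < size s)%N by rewrite -e leq_subr.
  rewrite e; split; first exact: sub.
  move=> sub'; apply: (strict _ lt); apply: sub'.
  exact: subset_closure.
move=> [C [clC ltC]].
have [z0 C0z] : C 0%N !=set0 by have [_ []] := clC 0%N (leq0n _).
have CC p : (p <= (size s).+1)%N -> C 0%N `<=` C p.
  elim: p => [|p IH] lt_p; first exact: subset_refl.
  apply: (subset_trans (IH (ltnW lt_p))).
  by have [] := ltC p lt_p.
have [l Vz] := cov z0; have [aV _] := hVs l; set V := Vs l in aV Vz.
have [_ irr] := irrX.
have [||y [_ [Uy Vy]]] := irr _ _ (open_oset U) (open_oset V).
- by exists x0.
- by exists z0.
have [iota [g [h [inj gy h0 jE _]]]] := function_field_chart aV Uy Vy.
have [primV _ basV _] := aV.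
pose q p : set (sect V) := [set a | forall x, C p x -> oset V x -> ~ unit_at a x].
pose B : set K := range iota.
have hB : subring B := subring_range iota.
have FB : F `<=` B by move=> _ [c _ <-]; exists (Defs.cst V c).
have := @MPolyResidue.prime_chain_bound k K j B (fun p => iota @` q p) (size s).+1 s hB FB Ks.
have primN x (a b : sect V) : oset V x -> ~ unit_at a x -> ~ unit_at b x -> ~ unit_at (a - b) x.
  move=> Vx na nb; have [_ D M _ _] := primV x Vx.
  apply: D => //; rewrite -mulN1r; exact: M.
suff hq : forall p, (p <= (size s).+1)%N -> [/\ q p 0, ~ q p 1,
    forall a b, q p a -> q p b -> q p (a - b), forall a b, q p b -> q p (a * b) &
    forall a b, q p (a * b) -> q p a \/ q p b].
  move=> H; have : ((size s).+1 <= size s)%N; last by rewrite ltnn.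
  apply: H => [p le_p|p lt_p].
    have [q0 q1 qB qM qp] := hq p le_p; split; first split.
    - by move=> _ [a _ <-]; exists a.
    - by exists 0 => //; rewrite rmorph0.
    - by move=> [a qa e]; apply: q1; rewrite -(inj a 1) // e rmorph1.
    - by move=> _ _ [a qa <-] [b qb <-]; exists (a - b); [exact: qB|rewrite rmorphB].
    - by move=> _ _ [a _ <-] [b qb <-]; exists (a * b); [exact: qM|rewrite rmorphM].
    - move=> _ _ [a _ <-] [b _ <-] [c qc]; rewrite -rmorphM => /inj e.
      by rewrite e in qc; have [qa|qb] := qp _ _ qc; [left; exists a|right; exists b].
  have [sub nsub] := ltC p lt_p.
  split; first by move=> _ [a qa <-]; exists a => // x Cx; exact/qa/sub.
  have [x [Cx nCx]] : exists x, C p.+1 x /\ ~ C p x.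
    by apply: contrapT => nex; apply: nsub => x Cx; apply: contrapT => nCx; apply: nex; exists x.
  have [cl _] := clC p (ltnW lt_p).
  have [_ [_ irrC]] := clC p.+1 lt_p.
  have [||w [Cw [Vw nCw]]] := irrC _ _ (open_oset V) (closed_openC cl).
  - by exists z0; split=> //; exact: CC.
  - by exists x.
  have VO : opensI V (Opens (closed_openC cl)) `<=` V by move=> ? [].
  have [f [fw fO]] := basV _ w VO (conj Vw nCw).
  move=> sub2; have [|c qc /inj e] := sub2 (iota f).
    exists f => // v Cv Vv fv; have [_] : (opensI V (Opens (closed_openC cl)) : set X) v by exact: fO.
    exact.
  by rewrite e in qc; exact: (qc w Cw Vw fw).
move=> p le_p; have C0p := CC p le_p z0 C0z.
split.
- by move=> x Cx Vx; exact: (affine0 aV Vx).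
- move=> /(_ z0 C0p Vz); apply; apply: (@unit_at_unit _ _ _ 1) => //; by rewrite mulr1.
- by move=> a b qa qb x Cx Vx; apply: primN => //; [exact: qa|exact: qb].
- by move=> a b qb x Cx Vx /unit_atM[_]; exact: qb.
- move=> a b qab; apply: contrapT => /not_orP[na nb].
  have ex (c : sect V) : ~ q p c -> C p `&` unit_at c !=set0.
    move=> nc; apply: contrapT => nex; apply: nc => x Cx Vx cx.
    by apply: nex; exists x.
  have [_ [_ irrC]] := clC p le_p.
  have [w [Cw [aw bw]]] := irrC _ _ (unit_at_open a) (unit_at_open b) (ex a na) (ex b nb).
  by apply: (qab w Cw (unit_at_mem aw)); apply/unit_atM.
Qed.

End Dimension.

Import numFieldNormedType.Exports.

(** * Valuations as points of a chart *)

(** A polynomial that takes the value 1 on a finite list has a root outside it. *)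
Lemma closed_infinite (k : closedFieldType) (K : fieldType) (j : {rmorphism k -> K}) :
  infinite_pred (range j).
Proof.
move=> l.
have /choice[g hg] : forall z, exists c : k, range j z -> j c = z.
  by move=> z; have [[c _ <-]|nz] := pselect (range j z); [exists c|exists 0].
pose q : {poly k} := \prod_(c <- 0 :: map g l) ('X - c%:P) + 1.
have sq : (1 < size q)%N.
  by rewrite /q size_polyDl ?size_prod_XsubC ?size_poly1.
have [c /rootP cq] : exists c, root q c by apply/closed_rootP; rewrite gtn_eqF.
exists (j c); first by exists c.
apply/negP => jl; have : root (\prod_(c <- 0 :: map g l) ('X - c%:P)) c.
  rewrite root_prod_XsubC inE; apply/orP; right.
  apply/mapP; exists (j c) => //; apply: (fmorph_inj j).
  by rewrite hg //; exists c.
move=> /rootP e; move: cq; rewrite /q hornerD e hornerC add0r => /eqP.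
by rewrite oner_eq0.
Qed.

Section Scaled.
Context (R : realType) (K : fieldType) (V : set K) (v : K -> int) (lam : R).
Hypotheses (hV : valring V) (lam0 : 0 < lam).
Hypotheses (vM : forall a b, a != 0 -> b != 0 -> v (a * b) = v a + v b)
  (vV : forall z, z != 0 -> (V z <-> 0 <= v z)) (v1 : exists2 z, z != 0 & v z = 1).

(** The valuation v, extended by +oo at zero, with values multiplied by lam. *)
Definition scaled z : \bar R := if z == 0 then +oo%E else (lam * (v z)%:~R)%:E.

Lemma scaled_neq0 z : z != 0 -> scaled z = (lam * (v z)%:~R)%:E.
Proof. by rewrite /scaled => /negbTE ->. Qed.

Lemma scaled0 : scaled 0 = +oo%E.
Proof. by rewrite /scaled eqxx. Qed.

Let v_one : v 1 = 0.
Proof.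
have := vM (oner_neq0 K) (oner_neq0 K); rewrite mulr1 => e.
by apply: (addrI (v 1)); rewrite addr0 -e.
Qed.

Lemma scaled_ge0 z : (0 <= scaled z)%E <-> V z.
Proof.
rewrite /scaled; case: (eqVneq z 0) => [->|z0].
  by rewrite leey; split=> // _; exact: (subring0 hV.1).
by rewrite lee_fin pmulr_rge0 // ler0z; split=> /(vV z0).
Qed.

Lemma scaledM z w : scaled (z * w) = (scaled z + scaled w)%E.
Proof.
rewrite /scaled mulf_eq0; case: (eqVneq z 0) => [->|z0] /=.
  by case: ifP.
case: (eqVneq w 0) => //= w0.
by rewrite vM // rmorphD mulrDr.
Qed.

(** The positive elements are those whose inverse is negative, which lies outside V. *)
Lemma scaled_gt0 z : (0 < scaled z)%E <-> maxid V z.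
Proof.
case: (eqVneq z 0) => [->|z0]; first by rewrite scaled0 ltry; split=> // _; left.
have e : scaled z^-1 = (- scaled z)%E.
  rewrite !scaled_neq0 ?invr_eq0 // -EFinN -mulrN -rmorphN; congr (_ * _%:~R)%:E.
  have := vM z0 (invr_neq0 z0); rewrite divff // v_one => h.
  by lia.
rewrite lt_neqAle; split.
  move=> /andP[ne ge]; right => /scaled_ge0; rewrite e oppe_ge0 => le.
  by case/eqP: ne; apply/le_anti/andP.
move=> [ez|nV]; first by rewrite ez eqxx in z0.
have : ~ (0 <= scaled (z^-1)%R)%E by move/scaled_ge0.
by rewrite e oppe_ge0 => /negP; rewrite -ltNge lt_neqAle.
Qed.

Lemma scaledD z w : (mine (scaled z) (scaled w) <= scaled (z + w)%R)%E.
Proof.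
wlog le : z w / (scaled z <= scaled w)%E => [H|].
  case/orP: (le_total (scaled z) (scaled w)) => le; first exact: H.
  by rewrite minC addrC; exact: H.
rewrite min_l //; case: (eqVneq z 0) => [e|z0].
  by move: le; rewrite e add0r.
have -> : z + w = z * (1 + w / z) by rewrite mulrDr mulr1 mulrCA divff // mulr1.
rewrite scaledM leeDl //; apply/scaled_ge0; apply: (subringD hV.1); first exact: (subring1 hV.1).
apply/scaled_ge0; have -> : scaled (w / z) = (scaled w - scaled z)%E.
  have h := scaledM (w / z) z; move: h; rewrite divfK // => ->.
  rewrite (scaled_neq0 z0); case: (scaled _) => //= r.
  by congr (_%:E); rewrite addrK.
by rewrite sube_ge0 // (scaled_neq0 z0).
Qed.

Lemma scaled_discrete : discrete_valuation scaled.
Proof.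
split.
- move=> z; rewrite /scaled; case: (eqVneq z 0) => // z0; split=> // e.
  by move/eqP: z0; rewrite e.
- exact: scaledM.
- exact: scaledD.
- exists lam => //; have [t t0 vt] := v1.
  have vX n : v (t ^+ n) = n%:Z.
    elim: n => [|n IH]; first by rewrite expr0.
    by rewrite exprS vM ?expf_neq0 // vt IH; lia.
  have vN z : z != 0 -> v z^-1 = - v z.
    move=> z0; have := vM z0 (invr_neq0 z0); rewrite divff // v_one => h; lia.
  apply/seteqP; split=> q [].
    by move=> z /= z0 <-; exists (v z) => //; rewrite scaled_neq0 // -mulrzr.
  move=> [n|n] _ <-.
    exists (t ^+ n); first by rewrite /= expf_neq0.
    by rewrite scaled_neq0 ?expf_neq0 // vX mulrzr.
  exists (t ^+ n.+1)^-1; first by rewrite /= invr_eq0 expf_neq0.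
  by rewrite scaled_neq0 ?invr_eq0 ?expf_neq0 // vN ?expf_neq0 // vX mulrzr.
Qed.

Lemma scaled_residue (L : fieldType) (p : K -> L) :
  residue_hom V p -> residue_map scaled p.
Proof.
move=> [p1 pD pM p_surj p0]; split=> //.
- by move=> z w /scaled_ge0 Vz /scaled_ge0 Vw; exact: pD.
- by move=> z w /scaled_ge0 Vz /scaled_ge0 Vw; exact: pM.
- by move=> y; have [z Vz <-] := p_surj y; exists z => //; apply/scaled_ge0.
- move=> z /scaled_ge0 Vz; split=> [/(p0 _ Vz)/scaled_gt0 //|/scaled_gt0 h].
  exact/(p0 _ Vz).
Qed.

End Scaled.

(** * Convergence *)

Section Convergence.
Context (R : realType) (k : fieldType) (X : kscheme k) (D : cartierDivisor X).

Lemma chart_fiber_cvg (U : opens X) (xs : nat -> chart_fiber R D U) (x : chart_fiber R D U) :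
  (forall a, seminorm (xs n) a @[n --> \oo] --> seminorm x a) -> xs n @[n --> \oo] --> x.
Proof.
move=> h.
have : {ptws, (@seminorm_ptws R k X D U \o xs) @ \oo --> seminorm_ptws x}.
  apply/cvg_sup => a B [_ [[C oC <-] Cx] CB].
  have [N _ hN] := h a C (open_nbhs_nbhs (conj oC Cx)).
  by exists N => // n /hN; exact: CB.
move=> H B [_ [[C oC <-] Cx] CB].
have [N _ hN] := H C (open_nbhs_nbhs (conj oC Cx)).
by exists N => // n /hN; exact: CB.
Qed.

Lemma fiber_class_cvg (A : atlas D) i (xs : nat -> chart_fiber R D (chart A i))
    (x : chart_fiber R D (chart A i)) :
  xs n @[n --> \oo] --> x ->
  fiber_class (existT _ i (xs n) : prefiber R A) @[n --> \oo] --> fiber_class (existT _ i x).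
Proof.
move=> h; apply: (@cvg_comp _ _ _ (fun n => existT _ i (xs n) : prefiber R A)).
  apply: (cvg_comp _ _ h); exact: existT_continuous.
exact: pi_continuous.
Qed.

End Convergence.

Section Exponentials.
Context (R : realType).

Lemma expR_approx (t : nat -> R) (c C : R) N :
  (forall n, (N <= n)%N -> `|t n - c| * n.+1%:R <= C) ->
  expR (- t n) @[n --> \oo] --> expR (- c).
Proof.
move=> h.
have ct : t n @[n --> \oo] --> c.
  apply/cvgrPdist_le => e e0; near=> n.
  have : `|t n - c| * n.+1%:R <= C by apply: h; near: n; exact: nbhs_infty_ge.
  rewrite distrC => H; rewrite -(ler_pM2r (ltr0Sn R n)); apply: (le_trans H).
  rewrite mulrC -ler_pdivrMr //; apply: ltW.
  near: n; apply: filterS (nbhs_infty_gtr (C / e)) => n lt; apply: (lt_trans lt).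
  by rewrite ltr_nat.
by apply: (cvg_comp _ _ (cvgN ct)); exact: continuous_expR.
Unshelve. all: by end_near. Qed.

Lemma expR_vanish (t : nat -> R) (C : R) N : 0 < C ->
  (forall n, (N <= n)%N -> n.+1%:R * C <= t n) -> expR (- t n) @[n --> \oo] --> (0 : R).
Proof.
move=> C0 h; apply/cvgrPdist_le => e e0; near=> n.
have tn : n.+1%:R * C <= t n by apply: h; near: n; exact: nbhs_infty_ge.
have t0 : 0 < t n by apply: lt_le_trans tn; rewrite mulr_gt0.
rewrite sub0r normrN ger0_norm ?expR_ge0 // expRN.
rewrite -[e]invrK lef_pV2 ?posrE ?expR_gt0 ?invr_gt0 //.
apply: (le_trans _ (expR_ge1Dx _)); apply: (@le_trans _ _ (t n)); last by rewrite lerDr.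
apply: le_trans tn; rewrite -ler_pdivrMr //; apply: ltW.
near: n; apply: filterS (nbhs_infty_gtr (e^-1 / C)) => n lt; apply: (lt_trans lt).
by rewrite ltr_nat.
Unshelve. all: by end_near. Qed.

End Exponentials.

(** The elements algebraic over gen F s form a subfield contained in V. *)
Lemma trl_cons_maxid (K : fieldType) (F V : set K) s y : valring V -> gen F s `<=` V ->
  trl F s -> maxid V y -> y != 0 -> trl F (y :: s).
Proof.
move=> hV sV trs my y0; split=> // icy.
have hE := subfield_gen F s.
apply: (unit_maxid y0 _ my).
exact: ((subfield_ic hE).2 _ icy).
Qed.

(** * Approximation in a chart *)

Section ChartApproximation.
Context (R : realType) (k : closedFieldType) (X : kscheme k).
Context (irrX : irreducible_set [set: X]) (redX : reduced X) (ftX : finite_type X).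
Context (D : cartierDivisor X) (U : opens X) (aU : affine U) (nu : chart_fiber R D U).

(** The point nu is approximated by multiples of the valuations of
  approximating_sequence, scaled so as to take at f the value of nu.  A section a
  with a finite value satisfies an estimate of order 1 / n, and one with an
  infinite value is forced to have values of order n; so the seminorms converge
  pointwise.  The centres agree because positivity on A is preserved. *)
Theorem chart_approximation : exists xs : nat -> chart_fiber R D U,
  [/\ forall n, divisorial_valuation (Defs.nu (xs n)),
      forall a, seminorm (xs n) a @[n --> \oo] --> seminorm nu a &
      forall n, reduction_ideal (xs n) = reduction_ideal nu].
Proof.
have [Uy redE] := chart_reductionP aU nu; set y := chart_reduction aU nu in Uy redE.
have [K [i hi]] := fraction_field_exists (sect_integral irrX redX aU Uy).
pose j : {rmorphism k -> K} :=
  [the {rmorphism k -> K} of i \o res (@subsetT _ U : U `<=` opensT X) \o structural X].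
have jE c : j c = i (Defs.cst U c) by [].
have hk := MPoly.subfield_range j.
have kinf := closed_infinite j.
(* The generators Y come from an affine chart W of finite type around the centre
   y: they generate K, and, being regular at y, they belong to xi_ring. *)
have [m [Vs [cov hVs]]] := ftX.
have [l Vy] := cov y; have [aV fgV] := hVs l; set W := Vs l in aV fgV Vy.
have [iota [g [h [inj gy h0 iotaE [locU locV invh]]]]] :=
  function_field_chart irrX redX aU hi jE aV Uy Vy.
have [gs hgs] := fg_rgen fgV iotaE.
pose Y := (iota h)^-1 :: map iota gs.
have sub_gs : {subset map iota gs <= Y} by move=> z z_gs; rewrite inE z_gs orbT.
have KY z : gen (range j) Y z.
  have Kgs := chart_generates hi hgs h0 locU.
  apply: (genS _ _ (Kgs z)); first exact: gen_sub.
  by move=> t tY; apply: gen_mem; exact: sub_gs.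
have hY := subring_rgen (range j) Y.
have AY : range i `<=` rgen (range j) Y.
  move=> _ [b _ <-]; have [n [a e]] := locU b.
  have -> : i b = iota a * (iota h)^-1 ^+ n.
    by rewrite -e exprVn mulfK // expf_neq0.
  apply: (subringM hY).
    apply: (rgenS _ _ (hgs a)); first exact: rgen_sub.
    by move=> t tY; apply: rgen_mem; exact: sub_gs.
  by apply: (subringX hY); apply: rgen_mem; rewrite inE eqxx.
have hA := subring_range i.
have kA : range j `<=` range i by move=> _ [c _ <-]; exists (Defs.cst U c).
have /choice[xi hxi] : forall z, exists r : \bar R, forall a, i a = z -> nu a = r.
  move=> z; have [[a _ <-]|nz] := pselect (range i z).
    by exists (nu a) => b /hi.1 ->.
  by exists 0%E => a e; case: nz; exists a.
have xiE a : xi (i a) = nu a by rewrite (hxi (i a) a).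
have xi_ge0 a : range i a -> (0 <= xi a)%E.
  by move=> [b _ <-]; rewrite xiE; exact: nu_ge0.
have xiM a b : range i a -> range i b -> xi (a * b) = (xi a + xi b)%E.
  by move=> [a' _ <-] [b' _ <-]; rewrite -rmorphM !xiE nuM.
have xiD a b : range i a -> range i b -> (mine (xi a) (xi b) <= xi (a + b)%R)%E.
  by move=> [a' _ <-] [b' _ <-]; rewrite -rmorphD !xiE nuD.
have xi0 : xi 0 = +oo%E by rewrite -(rmorph0 i) xiE nu0.
have xik c : range j c -> c != 0 -> xi c = 0%E.
  move=> [c' _ <-] c0; rewrite jE xiE nu_cst //.
  by apply: contraNneq c0 => ->; rewrite rmorph0.
have nug n : nu (g ^+ n) = 0%E.
  have : ~ reduction_ideal nu (g ^+ n) by rewrite redE => /(_ (unit_atX n gy)).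
  rewrite /reduction_ideal /= seminorm_lt1 => /negP; rewrite -leNgt => le.
  by apply/le_anti; rewrite le nu_ge0.
have g0 n : i g ^+ n != 0.
  rewrite -rmorphXn; apply/eqP => e; have := xiE (g ^+ n).
  by rewrite e xi0 nug.
have YO z : z \in Y -> xi_ring (range i) xi z.
  have inO u n b : u * i g ^+ n = i b -> xi_ring (range i) xi u.
    move=> e; exists (i b), (i g ^+ n); rewrite -rmorphXn !xiE nug; split=> //.
    - exact: nu_ge0.
    - by rewrite rmorphXn -e mulfK.
  rewrite inE => /predU1P[->|/mapP[a _ ->]].
    by have [n [b e]] := invh; exact: inO e.
  by have [n [b e]] := locV a; exact: inO e.
have [f [fD /andP[f0 foo]]] := nu_equation nu.
have xif0 : (0 < xi (i f))%E by rewrite xiE.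
have xifoo : (xi (i f) < +oo)%E by rewrite xiE.
have if0 : i f != 0 by apply: contraTneq xifoo => ->; rewrite xi0 ltxx.
have approx := approximating_sequence hk kinf hA kA xi_ge0 xiM xiD xi0 xik
  (ex_intro2 _ _ f I erefl) xif0 xifoo KY AY YO.
pose c := fine (nu f).
have c0 : 0 < c by apply: fine_gt0; rewrite f0.
have main n : exists x : chart_fiber R D U, [/\ divisorial_valuation (Defs.nu x),
    reduction_ideal x = reduction_ideal nu &
    forall a, a != 0 -> span (range j) (monomials Y n) (i a) -> exists t : R, [/\ x a = t%:E,
      (nu a < +oo)%E -> `|t - fine (nu a)| * n.+1%:R <= c & nu a = +oo%E -> n.+1%:R * c <= t]].
  have [V [s [t [v [[[hV sV trs mt t0] Ks] [vM vV v1] hAV fin inf]]]]] := approx n.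
  have kV : range j `<=` V by apply: subset_trans sV; exact: gen_sub.
  have Ai a : range i (i a) by exists a.
  have vf0 : (0 : R) < (v (i f))%:~R.
    have : (0 < scaled v (1 : R) (i f))%E.
      by apply/(scaled_gt0 hV ltr01 vM vV); apply/(hAV _ (Ai f)).2.
    by rewrite scaled_neq0 // mul1r lte_fin.
  pose lam := c / (v (i f))%:~R.
  have lam0 : 0 < lam by rewrite divr_gt0.
  pose w := scaled v lam.
  have w_gt0 a : (0 < w (i a))%E <-> (0 < nu a)%E.
    by rewrite -xiE -(hAV (i a) _).2; [exact: scaled_gt0 hV lam0 vM vV _|exists a].
  have wc (b : k) : b != 0 -> w (i (Defs.cst U b)) = 0%E.
    move=> b0; have jb : range j (j b) by exists b.
    have jb0 : j b != 0 by rewrite fmorph_eq0.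
    apply/le_anti/andP; split; last exact/(scaled_ge0 hV lam0 vV)/kV.
    rewrite leNgt; apply/negP => /(scaled_gt0 hV lam0 vM vV)/(subfield_maxid hk kV jb)/eqP.
    by apply/negP.
  have wf : exists f, local_equation D f /\ (0 < w (i f) < +oo)%E.
    exists f; split=> //; apply/andP; split; first by apply/w_gt0.
    by rewrite /w scaled_neq0 // ltry.
  exists (@ChartFiber R k X D U (w \o i)
    (fun a => proj2 (scaled_ge0 hV lam0 vV (i a)) (hAV (i a) (Ai a)).1)
    (fun a b => etrans (congr1 w (rmorphM i a b)) (scaledM lam vM (i a) (i b)))
    (fun a b => eq_rect_r (fun z => mine (w (i a)) (w (i b)) <= w z)%E
       (scaledD hV lam0 vM vV (i a) (i b)) (rmorphD i a b))
    (etrans (congr1 w (rmorph0 i)) (scaled0 v lam)) wc wf); split.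
  - have [L [p hp]] := residue_field_exists hV.
    exists K, i, w, L, p; split=> //.
    + exact: (scaled_discrete hV lam0 vM vV v1).
    + exact: (scaled_residue hV lam0 vM vV hp).
    exists (size s); split.
      have trts := trl_cons_maxid hV sV trs mt t0.
      exact: (krull_dim_trdeg irrX redX ftX aU hi jE Uy trts Ks).
    exact: (MPolyResidue.residue_transcendence hV sV trs mt t0 Ks hp).
  - apply/seteqP; split=> a; rewrite /reduction_ideal /= !seminorm_lt1 /=; by move/w_gt0.
  - move=> a a0 sa; exists (lam * (v (i a))%:~R).
    have ia0 : i a != 0 by rewrite -(rmorph0 i) (inj_eq hi.1).
    split=> /=; first by rewrite /w scaled_neq0.
    + move=> fina; have := fin (i a) sa (Ai a); rewrite !xiE => /(_ fina) h'.
      rewrite -(ler_pM2l vf0); apply: le_trans h'.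
      rewrite mulrA -{1}(gtr0_norm vf0) -normrM mulrBr /lam mulrA [_ * (c / _)]mulrCA.
      by rewrite divff ?lt0r_neq0 // mulr1 [c * _]mulrC.
    + move=> infa; have := inf (i a) sa (Ai a); rewrite xiE => h'.
      rewrite /lam mulrAC ler_pdivlMr // mulrAC [c * _]mulrC ler_pM2r //.
      exact: h'.
have /choice[xs hxs] := main.
exists xs; split=> [n|a|n]; [by have [] := hxs n| |by have [] := hxs n].
have [->|a0] := eqVneq a 0.
  by rewrite /seminorm nu0; under eq_fun do rewrite nu0; exact: cvg_cst.
have [N sN] := rgen_monomials hk (AY _ (ex_intro2 _ _ a I erefl)).
have sn n : (N <= n)%N -> span (range j) (monomials Y n) (i a).
  move=> le; apply: (spanS hk _ sN) => e eY; apply: (span_mem hk).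
  exact: (monomials_leq le).
have /choice[t ht] : forall n, exists t : R, (N <= n)%N -> [/\ xs n a = t%:E,
    (nu a < +oo)%E -> `|t - fine (nu a)| * n.+1%:R <= c & nu a = +oo%E -> n.+1%:R * c <= t].
  move=> n; have [/sn sa|] := boolP (N <= n)%N; last by exists 0.
  by have [_ _ /(_ a a0 sa)[t ht]] := hxs n; exists t.
have cvg_t l' : expR (- t n) @[n --> \oo] --> l' -> seminorm (xs n) a @[n --> \oo] --> l'.
  move=> cvt; apply: cvg_trans cvt; apply: near_eq_cvg; exists N => // n /= le.
  by have [e _ _] := ht n le; rewrite /seminorm e.
apply: cvg_t; rewrite /seminorm; have := nu_ge0 nu a.
case E : (nu a) => [r||] //= r0.
  apply: (@expR_approx _ _ _ c N) => n le; have [_ + _] := ht n le.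
  by rewrite E /= ltry; apply.
by apply: (@expR_vanish _ _ c N) => // n le; have [_ _] := ht n le; apply.
Qed.

End ChartApproximation.

Theorem corollaryB (R : realType) (k : closedFieldType) (X : kscheme k)
    (hX : normal_variety X) (D : cartierDivisor X) (A : atlas D)
    (x : generic_fiber R A) :
  exists xs : nat -> generic_fiber R A,
    [/\ forall n, divisorial (xs n),
        xs n @[n --> \oo] --> x &
        forall n, closure [set reduction x] (reduction (xs n))].
Proof.
have [irrX redX _ _ ftX] := hX.
have [p ->] : exists p : prefiber R A, x = fiber_class p.
  by exists (repr x); rewrite /fiber_class reprK.
case: p => i nu.
have [xs [div_xs cvg_xs red_xs]] := chart_approximation irrX redX ftX (chart_affine A i) nu.
exists (fun n => fiber_class (existT _ i (xs n) : prefiber R A)); split=> [n||n].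
- exists (existT _ i (xs n)); split=> //; exact: div_xs.
- by apply: fiber_class_cvg; exact: chart_fiber_cvg.
- rewrite !reductionE /prereduction /=; apply: subset_closure => /=.
  have [Uy e] := chart_reductionP (chart_affine A i) nu.
  by apply: chart_reduction_unique => //; rewrite red_xs.
Qed.
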